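(* Let $m,m'\in\mathbb N$, $\boldsymbol\lambda\in(\mathfrak h^* )^m\setminus\{0\}$, $\boldsymbol\lambda'\in(\mathfrak h^* )^{m'}$, let $\mathbf a\in\mathbb C^m$ and $\mathbf a'\in\mathbb C^{m'}$ each have nonzero pairwise distinct entries, let $\gamma,\gamma'\in\hat{\mathfrak h}^*$, and let $\eta,\eta':\tilde{\mathfrak n}_+\to\mathbb C$ be nonzero Lie algebra homomorphisms. Let $\hat V(\gamma),\hat V(\gamma')$ be the irreducible highest weight $\hat{\mathfrak g}$-modules of highest weights $\gamma,\gamma'$, and let $W(\eta),W(\eta')$ be irreducible Whittaker $\hat{\mathfrak g}$-modules of types $\eta,\eta'$. Then: (1) $(E(\boldsymbol\lambda,\mathbf a)\otimes\hat V(\gamma))[d]$ and $(E(\boldsymbol\lambda',\mathbf a')\otimes W(\eta))[d]$ are never isomorphic as $\tilde{\mathfrak g}$-modules; (2) $(E(\boldsymbol\lambda,\mathbf a)\otimes\hat V(\gamma))[d]\simeq(E(\boldsymbol\lambda',\mathbf a')\otimes\hat V(\gamma'))[d]$ as $\tilde{\mathfrak g}$-modules if and only if $E(\boldsymbol\lambda,\mathbf a)\simeq E(\boldsymbol\lambda',\mathbf a')$ as $\hat{\mathfrak g}$-modules and $\gamma=\gamma'$; (3) $(E(\boldsymbol\lambda,\mathbf a)\otimes W(\eta))[d]\simeq(E(\boldsymbol\lambda',\mathbf a')\otimes W(\eta'))[d]$ as $\tilde{\mathfrak g}$-modules if and only if $E(\boldsymbol\lambda,\mathbf a)\simeq E(\boldsymbol\lambda',\mathbf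 a')$ and $W(\eta)\simeq W(\eta')$ as $\hat{\mathfrak g}$-modules.
   Context: $\mathfrak g$ is a finite-dimensional simple Lie algebra over $\mathbb C$ with Cartan subalgebra $\mathfrak h$, a fixed base of its root system, and triangular decomposition $\mathfrak g=\mathfrak n_-\oplus\mathfrak h\oplus\mathfrak n_+$. $\tilde{\mathfrak g}=\mathfrak g\otimes\mathbb C[t,t^{-1}]\oplus\mathbb CK\oplus\mathbb Cd$ is the untwisted affine Kac-Moody algebra, with $K$ central, $[x\otimes t^m,y\otimes t^n]=[x,y]\otimes t^{m+n}+(x|y)\,m\,\delta_{m+n,0}K$ and $[d,x\otimes t^m]=m\,x\otimes t^m$, where $(\cdot|\cdot)$ is the Killing form; $\hat{\mathfrak g}=\mathfrak g\otimes\mathbb C[t,t^{-1}]\oplus\mathbb CK$. Put $\hat{\mathfrak h}=\mathfrak h\oplus\mathbb CK$ and $\tilde{\mathfrak n}_+=\mathfrak n_+\oplus(\mathfrak g\otimes t\mathbb C[t])$. A highest weight $\hat{\mathfrak g}$-module of highest weight $\gamma\in\hat{\mathfrak h}^*$ is one generated by a nonzero $v$ with $\tilde{\mathfrak n}_+v=0$ and $xv=\gamma(x)v$ for $x\in\hat{\mathfrak h}$. A Whittaker $\hat{\mathfrak g}$-module of type $\eta$ ($\eta:\tilde{\mathfrak n}_+\to\mathbb C$ a nonzero Lie algebra homomorphism) is one generated by a nonzero $v$ with $xv=\eta(x)v$ for all $x\in\tilde{\mathfrak n}_+$; irreducible ones of a given type need not be unique. For $\lambda\in\mathfrak h^*$,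 $V(\lambda)$ is the irreducible highest weight $\mathfrak g$-module of highest weight $\lambda$ (possibly infinite-dimensional). For $\boldsymbol\lambda=(\lambda_1,\dots,\lambda_m)\in(\mathfrak h^* )^m$ and $\mathbf a=(a_1,\dots,a_m)$ with nonzero pairwise distinct entries, $E(\boldsymbol\lambda,\mathbf a)$ is the $\hat{\mathfrak g}$-module $V(\lambda_1)\otimes\cdots\otimes V(\lambda_m)$ with $K$ acting as $0$ and $(x\otimes t^k)(v_1\otimes\cdots\otimes v_m)=\sum_{i=1}^m a_i^k\,v_1\otimes\cdots\otimes xv_i\otimes\cdots\otimes v_m$. For a $\hat{\mathfrak g}$-module $M$, $M[d]=U(\tilde{\mathfrak g})\otimes_{U(\hat{\mathfrak g})}M$. $\mathbb N$ denotes the positive integers.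
   Formalization: At the critical level (K acting by -1/2) the irreducible highest weight module of weight γ is not unique and (2) fails for arbitrary ones; there V̂(γ), V̂(γ') are taken to be the graded ones, i.e. d acts compatibly and kills the highest weight vector. *)

(* Defs.v *)
From HB Require Import structures.
From mathcomp Require Import all_boot all_order all_algebra.
From mathcomp Require Import generic_quotient complex boolp classical_sets reals.

Set Implicit Arguments.
Unset Strict Implicit.
Unset Printing Implicit Defensive.

Import GRing.Theory passmx.
Local Open Scope ring_scope.
Local Open Scope quotient_scope.

(** ** Vector spaces presented by generators and relations

    [pmod R] is the K-vector space generated by the symbols [pgen R t], t : T,
    subject to the relations u = v for R u v. *)

Inductive lcomb (K T : Type) : Type :=
| LZero
| LGen of T
| LAdd of lcomb K T & lcomb K T
| LScale of K & lcomb K T.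
Arguments LZero {K T}.
Arguments LGen K {T}.

HB.instance Definition _ (K T : Type) := gen_eqMixin (lcomb K T).
HB.instance Definition _ (K T : Type) := gen_choiceMixin (lcomb K T).

Fixpoint leval (K : fieldType) (T : Type) (W : lmodType K) (F : T -> W)
    (u : lcomb K T) : W :=
  match u with
  | LZero => 0
  | LGen t => F t
  | LAdd u v => leval F u + leval F v
  | LScale a u => a *: leval F u
  end.

Inductive lcong (K : fieldType) (T : Type) (R : lcomb K T -> lcomb K T -> Prop) :
  lcomb K T -> lcomb K T -> Prop :=
| LC_rel u v : R u v -> lcong R u v
| LC_refl u : lcong R u u
| LC_sym u v : lcong R u v -> lcong R v u
| LC_trans u v w : lcong R u v -> lcong R v w -> lcong R u w
| LC_add u u' v v' :
    lcong R u u' -> lcong R v v' -> lcong R (LAdd u v) (LAdd u' v')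
| LC_scale a u u' : lcong R u u' -> lcong R (LScale a u) (LScale a u')
| LC_addA u v w : lcong R (LAdd u (LAdd v w)) (LAdd (LAdd u v) w)
| LC_addC u v : lcong R (LAdd u v) (LAdd v u)
| LC_add0 u : lcong R (LAdd LZero u) u
| LC_addN u : lcong R (LAdd (LScale (-1) u) u) LZero
| LC_scaleA a b u : lcong R (LScale a (LScale b u)) (LScale (a * b) u)
| LC_scale1 u : lcong R (LScale 1 u) u
| LC_scaleDr a u v :
    lcong R (LScale a (LAdd u v)) (LAdd (LScale a u) (LScale a v))
| LC_scaleDl a b u :
    lcong R (LScale (a + b) u) (LAdd (LScale a u) (LScale b u)).

Section Presented.
Variables (K : fieldType) (T : Type) (R : lcomb K T -> lcomb K T -> Prop).

Definition lcongb (u v : lcomb K T) : bool := `[< lcong R u v >].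

Lemma lcongb_refl : reflexive lcongb.
Proof. by move=> u; apply/asboolP; apply: LC_refl. Qed.

Lemma lcongb_sym : symmetric lcongb.
Proof. by move=> u v; apply/asboolP/asboolP => /LC_sym. Qed.

Lemma lcongb_trans : transitive lcongb.
Proof.
by move=> v u w /asboolP uv /asboolP vw; apply/asboolP; apply: LC_trans vw.
Qed.

Canonical lcongb_equiv := EquivRel lcongb lcongb_refl lcongb_sym lcongb_trans.

Definition pmod := {eq_quot lcongb}.

HB.instance Definition _ := Choice.on pmod.
HB.instance Definition _ := EqQuotient.on pmod.

Definition pcl (u : lcomb K T) : pmod := \pi_pmod u.

Lemma pmod_eqP (u v : lcomb K T) : lcong R u v <-> pcl u = pcl v.
Proof.
split=> [uv|/eqquotP/asboolP//]; by apply/eqquotP/asboolP.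
Qed.

Lemma lcong_repr u : lcong R (repr (pcl u)) u.
Proof. by apply/pmod_eqP; rewrite /pcl reprK. Qed.

Lemma pclW (P : pmod -> Prop) : (forall u, P (pcl u)) -> forall x, P x.
Proof. by move=> Pp x; rewrite -[x]reprK; apply: Pp. Qed.

Definition pzero : pmod := pcl LZero.
Definition padd (x y : pmod) : pmod := pcl (LAdd (repr x) (repr y)).
Definition pscale (a : K) (x : pmod) : pmod := pcl (LScale a (repr x)).
Definition popp (x : pmod) : pmod := pscale (-1) x.

Lemma paddE u v : padd (pcl u) (pcl v) = pcl (LAdd u v).
Proof. by apply/pmod_eqP/LC_add; apply: lcong_repr. Qed.

Lemma pscaleE a u : pscale a (pcl u) = pcl (LScale a u).
Proof. by apply/pmod_eqP/LC_scale; apply: lcong_repr. Qed.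

Lemma paddA : associative padd.
Proof.
elim/pclW=> u; elim/pclW=> v; elim/pclW=> w; rewrite !paddE.
by apply/pmod_eqP/LC_addA.
Qed.

Lemma paddC : commutative padd.
Proof.
by elim/pclW=> u; elim/pclW=> v; rewrite !paddE; apply/pmod_eqP/LC_addC.
Qed.

Lemma padd0 : left_id pzero padd.
Proof. by elim/pclW=> u; rewrite paddE; apply/pmod_eqP/LC_add0. Qed.

Lemma paddN : left_inverse pzero popp padd.
Proof.
by elim/pclW=> u; rewrite /popp pscaleE paddE; apply/pmod_eqP/LC_addN.
Qed.

HB.instance Definition _ := GRing.isZmodule.Build pmod paddA paddC padd0 paddN.

Lemma pscaleA a b x : pscale a (pscale b x) = pscale (a * b) x.
Proof.
by move: x; elim/pclW=> u; rewrite !pscaleE; apply/pmod_eqP/LC_scaleA.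
Qed.

Lemma pscale1 : left_id 1 pscale.
Proof. by elim/pclW=> u; rewrite pscaleE; apply/pmod_eqP/LC_scale1. Qed.

Lemma pscaleDr : right_distributive pscale +%R.
Proof.
move=> a; elim/pclW=> u; elim/pclW=> v.
by rewrite /GRing.add /= paddE !pscaleE paddE; apply/pmod_eqP/LC_scaleDr.
Qed.

Lemma pscaleDl x : {morph pscale^~ x : a b / a + b}.
Proof.
move=> a b; move: x; elim/pclW=> u.
rewrite [in RHS]/GRing.add /= !pscaleE paddE; exact/pmod_eqP/LC_scaleDl.
Qed.

HB.instance Definition _ := GRing.Zmodule_isLmodule.Build K pmod
  pscaleA pscale1 pscaleDr pscaleDl.

Definition pgen (t : T) : pmod := pcl (LGen K t).

Lemma pi_leval u : pcl u = leval pgen u.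
Proof.
elim: u => [|t|u IHu v IHv|a u IHu] //=.
- by rewrite -IHu -IHv -[LHS]paddE.
- by rewrite -IHu -[LHS]pscaleE.
Qed.

Lemma pgen_rel u v : R u v -> leval pgen u = leval pgen v.
Proof. by move=> uv; rewrite -!pi_leval; apply/pmod_eqP/LC_rel. Qed.

Lemma pmod_ind (P : pmod -> Prop) :
  P 0 -> (forall t, P (pgen t)) -> (forall a x y, P x -> P y -> P (a *: x + y)) ->
  forall x, P x.
Proof.
move=> P0 Pg Pl; elim/pclW=> u; rewrite pi_leval.
elim: u => [|t|u IHu v IHv|a u IHu] //=.
- by rewrite -[leval pgen u]scale1r; apply: Pl.
- by rewrite -[_ *: _]addr0; apply: Pl.
Qed.

Section Lift.
Variables (W : lmodType K) (F : T -> W).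
Hypothesis F_rel : forall u v, R u v -> leval F u = leval F v.

Lemma leval_cong u v : lcong R u v -> leval F u = leval F v.
Proof.
elim=> //=.
- by move=> ? ? ? _ -> _ ->.
- by move=> ? ? ? ? _ -> _ ->.
- by move=> ? ? ? _ ->.
- by move=> *; rewrite addrA.
- by move=> *; rewrite addrC.
- by move=> *; rewrite add0r.
- by move=> w; rewrite scaleN1r addNr.
- by move=> *; rewrite scalerA.
- by move=> *; rewrite scale1r.
- by move=> *; rewrite scalerDr.
- by move=> *; rewrite scalerDl.
Qed.

Definition plift of (forall u v, R u v -> leval F u = leval F v) :=
  fun x : pmod => leval F (repr x).

Lemma plift_pcl u : plift F_rel (pcl u) = leval F u.
Proof. by apply: leval_cong; apply: lcong_repr. Qed.

Lemma plift_gen t : plift F_rel (pgen t) = F t.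
Proof. exact: plift_pcl. Qed.

Lemma plift_linear : linear (plift F_rel).
Proof.
move=> a; elim/pclW=> u; elim/pclW=> v.
have -> : a *: pcl u + pcl v = pcl (LAdd (LScale a u) v) by rewrite !pi_leval.
by rewrite !plift_pcl.
Qed.

HB.instance Definition _ :=
  GRing.isLinear.Build K pmod W *:%R (plift F_rel) plift_linear.

End Lift.
End Presented.

Lemma leval_lin (K : fieldType) (T : Type) (W W' : lmodType K)
    (f : {linear W -> W'}) (F : T -> W) (u : lcomb K T) :
  leval (fun t => f (F t)) u = f (leval F u).
Proof.
elim: u => [|t|u IHu v IHv|a u IHu] //=; first by rewrite linear0.
- by rewrite IHu IHv linearD.
- by rewrite IHu linearZ.
Qed.

Lemma leval_comb (K : fieldType) (T : Type) (W : lmodType K) (a : K)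
    (F G : T -> W) (u : lcomb K T) :
  leval (fun t => a *: F t + G t) u = a *: leval F u + leval G u.
Proof.
elim: u => [|t|u IHu v IHv|b u IHu] //=.
- by rewrite scaler0 addr0.
- by rewrite IHu IHv scalerDr addrACA.
- by rewrite IHu scalerDr !scalerA mulrC.
Qed.

Lemma leval0 (K : fieldType) (T : Type) (W : lmodType K) (u : lcomb K T) :
  leval (fun=> 0 : W) u = 0.
Proof.
by elim: u => [|t|u IHu v IHv|b u IHu] /=; rewrite ?IHu ?IHv ?(addr0, scaler0).
Qed.

Section BilinearLift.
Variables (K : fieldType) (T1 T2 : Type).
Variables (R1 : lcomb K T1 -> lcomb K T1 -> Prop).
Variables (R2 : lcomb K T2 -> lcomb K T2 -> Prop).
Variables (W : lmodType K) (F : T1 -> T2 -> W).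
Hypothesis F_rel1 : forall t u v, R1 u v -> leval (F^~ t) u = leval (F^~ t) v.
Hypothesis F_rel2 : forall t u v, R2 u v -> leval (F t) u = leval (F t) v.

Lemma plift2_rel (y : pmod R2) (u v : lcomb K T1) :
  R1 u v -> leval (fun t => plift (F_rel2 t) y) u
          = leval (fun t => plift (F_rel2 t) y) v.
Proof.
move=> uv; elim/pmod_ind: y => [|t|a x y IHx IHy].
- by under eq_fun do rewrite linear0; rewrite !leval0.
- by under eq_fun do rewrite plift_gen; apply: F_rel1.
- by under eq_fun do rewrite linearP; rewrite !leval_comb IHx IHy.
Qed.

Definition plift2 (x : pmod R1) (y : pmod R2) : W := plift (plift2_rel y) x.

Lemma plift2_gen s t : plift2 (pgen R1 s) (pgen R2 t) = F s t.
Proof. by rewrite /plift2 !plift_gen. Qed.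

Lemma plift2_linearl y : linear (plift2^~ y).
Proof. by move=> a u v; rewrite /plift2 linearP. Qed.

Lemma plift2_0l y : plift2 0 y = 0.
Proof. exact: linear0. Qed.

Lemma plift2_linearr x : linear (plift2 x).
Proof.
move=> a u v; elim/pmod_ind: x => [|t|b x y IHx IHy].
- by rewrite !plift2_0l scaler0 addr0.
- by rewrite /plift2 !plift_gen linearP.
- by rewrite !plift2_linearl IHx IHy !scalerDr !scalerA mulrC addrACA.
Qed.
End BilinearLift.

(** ** Lie algebras and their modules *)

HB.mixin Record Lmodule_isLieAlgebra (K : fieldType) L of GRing.Lmodule K L := {
  lie : L -> L -> L;
  lie_linearl : forall y, linear (lie^~ y);
  lie_linearr : forall x, linear (lie x);
  liexx : forall x, lie x x = 0;
  lie_jacobi : forall x y z,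
    lie x (lie y z) + lie y (lie z x) + lie z (lie x y) = 0
}.

#[short(type="lieAlgType")]
HB.structure Definition LieAlgebra (K : fieldType) :=
  { L of GRing.Lmodule K L & Lmodule_isLieAlgebra K L }.

#[short(type="finLieAlgType")]
HB.structure Definition FinLieAlgebra (K : fieldType) :=
  { L of LieAlgebra K L & Vector K L }.

HB.instance Definition _ (K : fieldType) (L : lieAlgType K) (x : L) :=
  GRing.isLinear.Build K L L *:%R (lie x) (lie_linearr x).

Section LieTheory.
Variables (K : fieldType) (L : lieAlgType K).
Implicit Types x y z : L.

Lemma lieDl x y z : lie (x + y) z = lie x z + lie y z.
Proof. by have := lie_linearl z 1 x y; rewrite !scale1r. Qed.

Lemma lie0l x : lie 0 x = 0.
Proof. by apply: (addIr (lie 0 x)); rewrite -lieDl !add0r. Qed.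

Lemma lieZl a x y : lie (a *: x) y = a *: lie x y.
Proof. by have := lie_linearl y a x 0; rewrite !addr0 lie0l addr0. Qed.

Lemma lieC x y : lie x y = - lie y x.
Proof.
apply/eqP; rewrite -addr_eq0; apply/eqP.
have := liexx (x + y); rewrite lieDl (linearD (lie x)) (linearD (lie y)) /=.
by rewrite !liexx add0r addr0.
Qed.

Lemma lieA x y z : lie (lie x y) z = lie x (lie y z) - lie y (lie x z).
Proof.
have := lie_jacobi x y z; rewrite (lieC z (lie x y)) (lieC z x) (linearN (lie y)) /=.
by move/eqP; rewrite subr_eq0 => /eqP.
Qed.
End LieTheory.

Record lieModule (K : fieldType) (L : lieAlgType K) := LieModule {
  lmodule_sort :> lmodType K;
  act : L -> lmodule_sort -> lmodule_sort;
  act_linearl : forall u, linear (act^~ u);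
  act_linearr : forall x, linear (act x);
  act_lie : forall x y u, act (lie x y) u = act x (act y u) - act y (act x u)
}.
Arguments act {K L M} x u : rename.

HB.instance Definition _ (K : fieldType) (L : lieAlgType K) (M : lieModule L)
  (x : L) := GRing.isLinear.Build K M M *:%R (@act K L M x) (act_linearr x).

Section ModuleTheory.
Variables (K : fieldType) (L : lieAlgType K) (M : lieModule L).
Implicit Types (x y : L) (u v : M).

Lemma actDl x y u : act (x + y) u = act x u + act y u.
Proof. by have := act_linearl u 1 x y; rewrite !scale1r. Qed.

Lemma act0l u : act (0 : L) u = 0.
Proof. by apply: (addIr (act (0 : L) u)); rewrite -actDl !add0r. Qed.

Lemma actZl a x u : act (a *: x) u = a *: act x u.
Proof. by have := act_linearl u a x 0; rewrite !addr0 act0l addr0. Qed.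
End ModuleTheory.

Local Open Scope classical_set_scope.

Definition submodule (K : fieldType) (L : lieAlgType K) (M : lieModule L)
    (S : set M) : Prop :=
  [/\ S 0, forall a u v, S u -> S v -> S (a *: u + v) &
      forall x u, S u -> S (act x u)].

Definition irreducible (K : fieldType) (L : lieAlgType K) (M : lieModule L) :=
  (exists u : M, u != 0) /\
  forall S : set M, submodule S -> S = [set 0] \/ S = setT.

Definition generates (K : fieldType) (L : lieAlgType K) (M : lieModule L)
    (v : M) : Prop :=
  forall S : set M, submodule S -> S v -> S = setT.

Definition lieModule_iso (K : fieldType) (L : lieAlgType K)
    (M N : lieModule L) : Prop :=
  exists f : {linear M -> N},
    bijective f /\ forall (x : L) (u : M), f (act x u) = act x (f u).

(** ** Tensor products *)

Section Tensor.
Variables (K : fieldType) (M N : lmodType K).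

Inductive tensor_rel : lcomb K (M * N) -> lcomb K (M * N) -> Prop :=
| TR_l a x y n : tensor_rel (LGen K (a *: x + y, n))
                            (LAdd (LScale a (LGen K (x, n))) (LGen K (y, n)))
| TR_r m a x y : tensor_rel (LGen K (m, a *: x + y))
                            (LAdd (LScale a (LGen K (m, x))) (LGen K (m, y))).

Definition tensor := pmod tensor_rel.
HB.instance Definition _ := GRing.Lmodule.on tensor.

Definition tens (m : M) (n : N) : tensor := pgen tensor_rel (m, n).

Lemma tens_linearl n : linear (tens^~ n).
Proof. by move=> a x y; apply: (pgen_rel (TR_l a x y n)). Qed.

Lemma tens_linearr m : linear (tens m).
Proof. by move=> a x y; apply: (pgen_rel (TR_r m a x y)). Qed.

End Tensor.

Lemma zmod_cross (V : zmodType) (p q p' q' a b : V) :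
  p - p' + (q - q') = p + b + (a + q) - (p' + a + (b + q')).
Proof.
rewrite [a + q]addrC [p + b + _]addrACA [b + q']addrC [p' + a + _]addrACA.
by rewrite [a + b]addrC [in RHS]opprD [RHS]addrACA subrr addr0 opprD addrACA.
Qed.

Lemma zmod_sum3 (V : zmodType) (p q r p' q' r' : V) :
  p + p' + (q + q') + (r + r') = p + q + r + (p' + q' + r').
Proof. by rewrite (addrACA p) (addrACA (p + q)). Qed.

Section TensorModule.
Variables (K : fieldType) (L : lieAlgType K) (M N : lieModule L).

Definition tensor_act_gen (x : L) (p : M * N) : tensor M N :=
  tens (act x p.1) p.2 + tens p.1 (act x p.2).

Lemma tensor_act_rel x u v : tensor_rel u v ->
  leval (tensor_act_gen x) u = leval (tensor_act_gen x) v.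
Proof.
case=> [a p q n|m a p q] /=; rewrite /tensor_act_gen /= linearP.
- by rewrite !tens_linearl scalerDr addrACA.
- by rewrite !tens_linearr scalerDr addrACA.
Qed.

Definition tensor_act (x : L) : tensor M N -> tensor M N :=
  plift (tensor_act_rel x).

Lemma tensor_act_tens x m n :
  tensor_act x (tens m n) = tens (act x m) n + tens m (act x n).
Proof. exact: plift_gen. Qed.

Lemma tensor_act_linearr x : linear (tensor_act x).
Proof. exact: linearP. Qed.

HB.instance Definition _ x :=
  GRing.isLinear.Build K (tensor M N) (tensor M N) *:%R (tensor_act x)
    (tensor_act_linearr x).

Lemma tensor_act_linearl u : linear (tensor_act^~ u).
Proof.
move=> a x y; elim/pmod_ind: u => [|[m n]|b u v IHu IHv].
- by rewrite !linear0 addr0.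
- rewrite !tensor_act_tens act_linearl act_linearl.
  by rewrite tens_linearl tens_linearr scalerDr addrACA.
- by rewrite !tensor_act_linearr IHu IHv !scalerDr !scalerA mulrC addrACA.
Qed.

Lemma tensor_act_lie x y u :
  tensor_act (lie x y) u
    = tensor_act x (tensor_act y u) - tensor_act y (tensor_act x u).
Proof.
elim/pmod_ind: u => [|[m n]|b u v IHu IHv].
- by rewrite !linear0 addr0.
- rewrite !tensor_act_tens !linearD /= !tensor_act_tens !act_lie.
  have tBl p q r : tens (p - q) r = tens p r - tens q r :> tensor M N.
    by rewrite -scaleN1r addrC tens_linearl scaleN1r addrC.
  have tBr p q r : tens r (p - q) = tens r p - tens r q :> tensor M N.
    by rewrite -scaleN1r addrC tens_linearr scaleN1r addrC.
  by rewrite tBl tBr -opprD; apply: zmod_cross.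
- by rewrite !tensor_act_linearr IHu IHv scalerBr /= opprD addrACA.
Qed.

Definition tensorModule : lieModule L :=
  LieModule tensor_act_linearl tensor_act_linearr tensor_act_lie.
End TensorModule.

Section MultiTensor.
Variables (K : fieldType) (n : nat) (M : 'I_n -> lmodType K).

Inductive multitensor_rel :
  lcomb K (forall i, M i) -> lcomb K (forall i, M i) -> Prop :=
| MR (v : forall i, M i) (i : 'I_n) (a : K) (x y : M i) :
    multitensor_rel (LGen K (dfwith v (a *: x + y)))
      (LAdd (LScale a (LGen K (dfwith v x))) (LGen K (dfwith v y))).

Definition multitensor := pmod multitensor_rel.
HB.instance Definition _ := GRing.Lmodule.on multitensor.

Definition mtens (v : forall i, M i) : multitensor := pgen multitensor_rel v.

Lemma mtens_linear v i a (x y : M i) :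
  mtens (dfwith v (a *: x + y)) = a *: mtens (dfwith v x) + mtens (dfwith v y).
Proof. exact: (pgen_rel (MR v a x y)). Qed.

Lemma dfwith_same (v : forall i, M i) i (x y : M i) :
  dfwith (dfwith v x) y = dfwith v y.
Proof.
apply: functional_extensionality_dep => j.
by case: dfwithP => [|k ik]; rewrite ?dfwith_in ?dfwith_out.
Qed.

Lemma dfwith_swap (v : forall i, M i) i j (x : M i) (y : M j) : i != j ->
  dfwith (dfwith v x) y = dfwith (dfwith v y) x.
Proof.
move=> ij; apply: functional_extensionality_dep => k.
have [jk|jk] := eqVneq j k.
- by subst k; rewrite dfwith_in dfwith_out // dfwith_in.
- rewrite dfwith_out //; have [ik|ik] := eqVneq i k.
    by subst k; rewrite !dfwith_in.
  by rewrite !dfwith_out.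
Qed.

Lemma dfwith_id (v : forall i, M i) i : dfwith v (v i) = v.
Proof. by apply: functional_extensionality_dep => j; case: dfwithP. Qed.

End MultiTensor.

Section MultiTensorModule.
Variables (K : fieldType) (L : lieAlgType K) (n : nat).
Variables (M : 'I_n -> lieModule L).
Let M' i : lmodType K := M i.

Definition multitensor_act_gen (x : L) (v : forall i, M' i) : multitensor M' :=
  \sum_(i < n) mtens (dfwith v (act x (v i) : M' i)).

Lemma multitensor_act_rel x u v : multitensor_rel u v ->
  leval (multitensor_act_gen x) u = leval (multitensor_act_gen x) v.
Proof.
case=> {}v i a p q /=; rewrite /multitensor_act_gen scaler_sumr -big_split /=.
apply: eq_bigr => j _; have [<-|ij] := eqVneq i j.
- by rewrite !dfwith_same !dfwith_in -mtens_linear act_linearr.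
- by rewrite !(dfwith_out _ _ ij) !(dfwith_swap _ _ _ ij) mtens_linear.
Qed.

Definition multitensor_act (x : L) : multitensor M' -> multitensor M' :=
  plift (multitensor_act_rel x).

Lemma multitensor_act_mtens x v :
  multitensor_act x (mtens v)
    = \sum_(i < n) mtens (dfwith v (act x (v i) : M' i)).
Proof. exact: plift_gen. Qed.

Lemma multitensor_act_linearr x : linear (multitensor_act x).
Proof. exact: linearP. Qed.

HB.instance Definition _ x :=
  GRing.isLinear.Build K (multitensor M') (multitensor M') *:%R
    (multitensor_act x) (multitensor_act_linearr x).

Lemma multitensor_act_linearl u : linear (multitensor_act^~ u).
Proof.
move=> a x y; elim/pmod_ind: u => [|v|b u v IHu IHv].
- by rewrite !linear0 addr0.
- rewrite !multitensor_act_mtens scaler_sumr -big_split /=.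
  by apply: eq_bigr => j _; rewrite act_linearl mtens_linear.
- rewrite !multitensor_act_linearr IHu IHv !scalerDr !scalerA mulrC.
  by rewrite addrACA.
Qed.

Lemma multitensor_act_lie x y u :
  multitensor_act (lie x y) u
    = multitensor_act x (multitensor_act y u)
      - multitensor_act y (multitensor_act x u).
Proof.
elim/pmod_ind: u => [|v|b u v IHu IHv].
- by rewrite !linear0 addr0.
- have step z t : multitensor_act z (multitensor_act t (mtens v)) =
      \sum_(i < n) mtens (dfwith v (act z (act t (v i)) : M' i)) +
      \sum_(i < n) \sum_(j < n | j != i)
        mtens (dfwith (dfwith v (act t (v i) : M' i)) (act z (v j) : M' j)).
    rewrite multitensor_act_mtens linear_sum -big_split /=.
    apply: eq_bigr => i _; rewrite multitensor_act_mtens (bigD1 i) //=.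
    rewrite dfwith_same dfwith_in; congr (_ + _).
    by apply: eq_bigr => j ji; rewrite dfwith_out // eq_sym.
  rewrite (step x y) (step y x) multitensor_act_mtens.
  set A := (X in _ = _ + X - _); set B := (X in _ = _ - (_ + X)).
  have -> : A = B.
    rewrite /A /B (exchange_big_dep predT) //=.
    apply: eq_bigr => i _; apply: eq_big => [j|j ij]; first by rewrite eq_sym.
    by rewrite dfwith_swap // eq_sym.
  rewrite opprD addrACA subrr addr0 -sumrB; apply: eq_bigr => i _.
  rewrite act_lie -scaleN1r addrC mtens_linear.
  by rewrite scaleN1r addrC.
- by rewrite !multitensor_act_linearr IHu IHv scalerBr /= opprD addrACA.
Qed.

Definition multitensorModule : lieModule L :=
  LieModule multitensor_act_linearl multitensor_act_linearr
    multitensor_act_lie.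
End MultiTensorModule.

(** ** Universal enveloping algebras *)

(** [uea L] is the unital associative algebra generated by the symbols
    [ugen x], x : L, subject to: [ugen] is linear and
    [ugen (lie x y) = ugen x * ugen y - ugen y * ugen x]. *)

Inductive uterm (K L : Type) : Type :=
| UGen of L
| UOne
| UZero
| UAdd of uterm K L & uterm K L
| UMul of uterm K L & uterm K L
| UScale of K & uterm K L.
Arguments UGen {K L}.
Arguments UOne {K L}.
Arguments UZero {K L}.

HB.instance Definition _ (K L : Type) := gen_eqMixin (uterm K L).
HB.instance Definition _ (K L : Type) := gen_choiceMixin (uterm K L).

Inductive ucong (K : fieldType) (L : lieAlgType K) :
  uterm K L -> uterm K L -> Prop :=
| UC_lin a (x y : L) :
    ucong (UGen (a *: x + y)) (UAdd (UScale a (UGen x)) (UGen y))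
| UC_lie (x y : L) :
    ucong (UGen (lie x y)) (UAdd (UMul (UGen x) (UGen y))
                                 (UScale (-1) (UMul (UGen y) (UGen x))))
| UC_refl u : ucong u u
| UC_sym u v : ucong u v -> ucong v u
| UC_trans u v w : ucong u v -> ucong v w -> ucong u w
| UC_add u u' v v' : ucong u u' -> ucong v v' -> ucong (UAdd u v) (UAdd u' v')
| UC_mul u u' v v' : ucong u u' -> ucong v v' -> ucong (UMul u v) (UMul u' v')
| UC_scale a u u' : ucong u u' -> ucong (UScale a u) (UScale a u')
| UC_addA u v w : ucong (UAdd u (UAdd v w)) (UAdd (UAdd u v) w)
| UC_addC u v : ucong (UAdd u v) (UAdd v u)
| UC_add0 u : ucong (UAdd UZero u) u
| UC_addN u : ucong (UAdd (UScale (-1) u) u) UZero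
| UC_mulA u v w : ucong (UMul u (UMul v w)) (UMul (UMul u v) w)
| UC_mul1l u : ucong (UMul UOne u) u
| UC_mul1r u : ucong (UMul u UOne) u
| UC_mulDl u v w : ucong (UMul (UAdd u v) w) (UAdd (UMul u w) (UMul v w))
| UC_mulDr u v w : ucong (UMul u (UAdd v w)) (UAdd (UMul u v) (UMul u w))
| UC_scaleA a b u : ucong (UScale a (UScale b u)) (UScale (a * b) u)
| UC_scale1 u : ucong (UScale 1 u) u
| UC_scaleDr a u v :
    ucong (UScale a (UAdd u v)) (UAdd (UScale a u) (UScale a v))
| UC_scaleDl a b u :
    ucong (UScale (a + b) u) (UAdd (UScale a u) (UScale b u))
| UC_scaleAl a u v : ucong (UScale a (UMul u v)) (UMul (UScale a u) v)
| UC_scaleAr a u v : ucong (UScale a (UMul u v)) (UMul u (UScale a v)).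

Fixpoint ueval (K : fieldType) (L : Type) (A : algType K) (f : L -> A)
    (u : uterm K L) : A :=
  match u with
  | UGen x => f x
  | UOne => 1
  | UZero => 0
  | UAdd u v => ueval f u + ueval f v
  | UMul u v => ueval f u * ueval f v
  | UScale a u => a *: ueval f u
  end.

Lemma ueval_cong (K : fieldType) (L : lieAlgType K) (A : algType K)
    (f : L -> A) (f_lin : linear f)
    (f_lie : forall x y, f (lie x y) = f x * f y - f y * f x) u v :
  ucong u v -> ueval f u = ueval f v.
Proof.
elim=> //=.
- by move=> x y; rewrite f_lie scaleN1r.
- by move=> ? ? ? _ -> _ ->.
- by move=> ? ? ? ? _ -> _ ->.
- by move=> ? ? ? ? _ -> _ ->.
- by move=> ? ? ? _ ->.
- by move=> *; rewrite addrA.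
- by move=> *; rewrite addrC.
- by move=> *; rewrite add0r.
- by move=> *; rewrite scaleN1r addNr.
- by move=> *; rewrite mulrA.
- by move=> *; rewrite mul1r.
- by move=> *; rewrite mulr1.
- by move=> *; rewrite mulrDl.
- by move=> *; rewrite mulrDr.
- by move=> *; rewrite scalerA.
- by move=> *; rewrite scale1r.
- by move=> *; rewrite scalerDr.
- by move=> *; rewrite scalerDl.
- by move=> *; rewrite scalerAl.
- by move=> *; rewrite scalerAr.
Qed.

Section Enveloping.
Variables (K : fieldType) (L : lieAlgType K).

Definition ucongb (u v : uterm K L) : bool := `[< ucong u v >].

Lemma ucongb_refl : reflexive ucongb.
Proof. by move=> u; apply/asboolP; apply: UC_refl. Qed.

Lemma ucongb_sym : symmetric ucongb.
Proof. by move=> u v; apply/asboolP/asboolP => /UC_sym. Qed.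

Lemma ucongb_trans : transitive ucongb.
Proof.
by move=> v u w /asboolP uv /asboolP vw; apply/asboolP; apply: UC_trans vw.
Qed.

Canonical ucongb_equiv := EquivRel ucongb ucongb_refl ucongb_sym ucongb_trans.

Definition uea := {eq_quot ucongb}.

HB.instance Definition _ := Choice.on uea.
HB.instance Definition _ := EqQuotient.on uea.

Definition ucl (u : uterm K L) : uea := \pi_uea u.

Lemma uea_eqP (u v : uterm K L) : ucong u v <-> ucl u = ucl v.
Proof.
split=> [uv|/eqquotP/asboolP//]; by apply/eqquotP/asboolP.
Qed.

Lemma ucong_repr u : ucong (repr (ucl u)) u.
Proof. by apply/uea_eqP; rewrite /ucl reprK. Qed.

Lemma uclW (P : uea -> Prop) : (forall u, P (ucl u)) -> forall x, P x.
Proof. by move=> Pp x; rewrite -[x]reprK; apply: Pp. Qed.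

Definition uzero : uea := ucl UZero.
Definition uone : uea := ucl UOne.
Definition uadd (x y : uea) : uea := ucl (UAdd (repr x) (repr y)).
Definition umul (x y : uea) : uea := ucl (UMul (repr x) (repr y)).
Definition uscale (a : K) (x : uea) : uea := ucl (UScale a (repr x)).
Definition uopp (x : uea) : uea := uscale (-1) x.

Lemma uaddE u v : uadd (ucl u) (ucl v) = ucl (UAdd u v).
Proof. by apply/uea_eqP/UC_add; apply: ucong_repr. Qed.

Lemma umulE u v : umul (ucl u) (ucl v) = ucl (UMul u v).
Proof. by apply/uea_eqP/UC_mul; apply: ucong_repr. Qed.

Lemma uscaleE a u : uscale a (ucl u) = ucl (UScale a u).
Proof. by apply/uea_eqP/UC_scale; apply: ucong_repr. Qed.

Lemma uaddA : associative uadd.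
Proof.
elim/uclW=> u; elim/uclW=> v; elim/uclW=> w; rewrite !uaddE.
by apply/uea_eqP/UC_addA.
Qed.

Lemma uaddC : commutative uadd.
Proof.
by elim/uclW=> u; elim/uclW=> v; rewrite !uaddE; apply/uea_eqP/UC_addC.
Qed.

Lemma uadd0 : left_id uzero uadd.
Proof. by elim/uclW=> u; rewrite uaddE; apply/uea_eqP/UC_add0. Qed.

Lemma uaddN : left_inverse uzero uopp uadd.
Proof.
by elim/uclW=> u; rewrite /uopp uscaleE uaddE; apply/uea_eqP/UC_addN.
Qed.

HB.instance Definition _ := GRing.isZmodule.Build uea uaddA uaddC uadd0 uaddN.

Lemma umulA : associative umul.
Proof.
elim/uclW=> u; elim/uclW=> v; elim/uclW=> w; rewrite !umulE.
by apply/uea_eqP/UC_mulA.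
Qed.

Lemma umul1l : left_id uone umul.
Proof. by elim/uclW=> u; rewrite umulE; apply/uea_eqP/UC_mul1l. Qed.

Lemma umul1r : right_id uone umul.
Proof. by elim/uclW=> u; rewrite umulE; apply/uea_eqP/UC_mul1r. Qed.

Lemma umulDl : left_distributive umul +%R.
Proof.
elim/uclW=> u; elim/uclW=> v; elim/uclW=> w.
by rewrite /GRing.add /= uaddE !umulE uaddE; apply/uea_eqP/UC_mulDl.
Qed.

Lemma umulDr : right_distributive umul +%R.
Proof.
elim/uclW=> u; elim/uclW=> v; elim/uclW=> w.
by rewrite /GRing.add /= uaddE !umulE uaddE; apply/uea_eqP/UC_mulDr.
Qed.

Lemma uone_neq0 : uone != 0.
Proof.
apply/eqP => /uea_eqP /(@ueval_cong K L K^o (fun=> 0)) /= e.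
have /eqP : (1 : K^o) = 0.
  by apply: e => [a x y|x y]; rewrite ?scaler0 ?addr0 // mulr0 subr0.
by rewrite oner_eq0.
Qed.

HB.instance Definition _ := GRing.Zmodule_isNzRing.Build uea
  umulA umul1l umul1r umulDl umulDr uone_neq0.

Lemma uscaleA a b x : uscale a (uscale b x) = uscale (a * b) x.
Proof.
by move: x; elim/uclW=> u; rewrite !uscaleE; apply/uea_eqP/UC_scaleA.
Qed.

Lemma uscale1 : left_id 1 uscale.
Proof. by elim/uclW=> u; rewrite uscaleE; apply/uea_eqP/UC_scale1. Qed.

Lemma uscaleDr : right_distributive uscale +%R.
Proof.
move=> a; elim/uclW=> u; elim/uclW=> v.
by rewrite /GRing.add /= uaddE !uscaleE uaddE; apply/uea_eqP/UC_scaleDr.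
Qed.

Lemma uscaleDl x : {morph uscale^~ x : a b / a + b}.
Proof.
move=> a b; move: x; elim/uclW=> u.
rewrite [in RHS]/GRing.add /= !uscaleE uaddE; exact/uea_eqP/UC_scaleDl.
Qed.

HB.instance Definition _ := GRing.Zmodule_isLmodule.Build K uea
  uscaleA uscale1 uscaleDr uscaleDl.

Lemma uscaleAl (a : K) (x y : uea) : a *: (x * y) = a *: x * y.
Proof.
move: x y; elim/uclW=> u; elim/uclW=> v.
rewrite /GRing.scale /GRing.mul /= uscaleE !umulE uscaleE.
exact/uea_eqP/UC_scaleAl.
Qed.

HB.instance Definition _ := GRing.Lmodule_isLalgebra.Build K uea uscaleAl.

Lemma uscaleAr (a : K) (x y : uea) : a *: (x * y) = x * (a *: y).
Proof.
move: x y; elim/uclW=> u; elim/uclW=> v.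
rewrite /GRing.scale /GRing.mul /= uscaleE !umulE uscaleE.
exact/uea_eqP/UC_scaleAr.
Qed.

HB.instance Definition _ := GRing.Lalgebra_isAlgebra.Build K uea uscaleAr.

Definition ugen (x : L) : uea := ucl (UGen x).

Lemma ucl_ueval u : ucl u = ueval ugen u.
Proof.
elim: u => [x|||u IHu v IHv|u IHu v IHv|a u IHu] //=.
- by rewrite -IHu -IHv -[LHS]uaddE.
- by rewrite -IHu -IHv -[LHS]umulE.
- by rewrite -IHu -[LHS]uscaleE.
Qed.

Lemma ugen_linear : linear ugen.
Proof.
move=> a x y; transitivity (ucl (UAdd (UScale a (UGen x)) (UGen y))).
  exact/uea_eqP/UC_lin.
by rewrite ucl_ueval.
Qed.

Lemma ugen_lie x y : ugen (lie x y) = ugen x * ugen y - ugen y * ugen x.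
Proof.
transitivity (ucl (UAdd (UMul (UGen x) (UGen y))
                        (UScale (-1) (UMul (UGen y) (UGen x))))).
  exact/uea_eqP/UC_lie.
by rewrite ucl_ueval /= scaleN1r.
Qed.

Lemma uea_ind (P : uea -> Prop) :
  P 0 -> P 1 -> (forall x, P (ugen x)) ->
  (forall a u v, P u -> P v -> P (a *: u + v)) ->
  (forall u v, P u -> P v -> P (u * v)) -> forall u, P u.
Proof.
move=> P0 P1 Pg Pl Pm; elim/uclW=> u; rewrite ucl_ueval.
elim: u => [x|||u IHu v IHv|u IHu v IHv|a u IHu] //=.
- by rewrite -[ueval ugen u]scale1r; apply: Pl.
- exact: Pm.
- by rewrite -[_ *: _]addr0; apply: Pl.
Qed.
End Enveloping.

(** The action of U(L) on an L-module. *)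
Fixpoint ueval_act (K : fieldType) (L : lieAlgType K) (M : lieModule L)
    (u : uterm K L) : M -> M :=
  match u with
  | UGen x => fun m => act x m
  | UOne => fun m => m
  | UZero => fun=> 0
  | UAdd u v => fun m => ueval_act u m + ueval_act v m
  | UMul u v => fun m => ueval_act u (ueval_act v m)
  | UScale a u => fun m => a *: ueval_act u m
  end.

Section EnvelopingAction.
Variables (K : fieldType) (L : lieAlgType K) (M : lieModule L).

Lemma ueval_act_linear (u : uterm K L) : linear (@ueval_act K L M u).
Proof.
elim: u => [x|||u IHu v IHv|u IHu v IHv|a u IHu] b p q //=.
- exact: act_linearr.
- by rewrite scaler0 addr0.
- by rewrite IHu IHv scalerDr addrACA.
- by rewrite IHv IHu.
- by rewrite IHu scalerDr !scalerA mulrC.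
Qed.

Lemma ueval_act_cong (u v : uterm K L) :
  ucong u v -> forall m : M, ueval_act u m = ueval_act v m.
Proof.
have addE (w : uterm K L) (p q : M) :
    ueval_act w (p + q) = ueval_act w p + ueval_act w q.
  by have := ueval_act_linear w 1 p q; rewrite !scale1r.
have zeroE (w : uterm K L) : ueval_act w (0 : M) = 0.
  by apply: (addIr (ueval_act w (0 : M))); rewrite -addE !add0r.
elim=> //=.
- by move=> a x y m; rewrite act_linearl.
- by move=> x y m; rewrite act_lie scaleN1r.
- by move=> ? ? ? _ IHu _ IHv m; rewrite IHu.
- by move=> ? ? ? ? _ IHu _ IHv m; rewrite IHu IHv.
- by move=> ? ? ? ? _ IHu _ IHv m; rewrite IHu IHv.
- by move=> ? ? ? _ IHu m; rewrite IHu.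
- by move=> *; rewrite addrA.
- by move=> *; rewrite addrC.
- by move=> *; rewrite add0r.
- by move=> *; rewrite scaleN1r addNr.
- by move=> *; rewrite scalerA.
- by move=> *; rewrite scale1r.
- by move=> *; rewrite scalerDr.
- by move=> *; rewrite scalerDl.
- move=> a u' v' m; have := ueval_act_linear u' a (ueval_act v' m) 0.
  by rewrite !addr0 zeroE addr0.
Qed.

Definition uact (u : uea L) (m : M) : M := ueval_act (repr u) m.

Lemma uact_ucl u m : uact (ucl u) m = ueval_act u m.
Proof. by apply: ueval_act_cong; apply: ucong_repr. Qed.

Lemma uact_gen x m : uact (ugen x) m = act x m.
Proof. exact: uact_ucl. Qed.

Lemma uact1 m : uact 1 m = m.
Proof. exact: uact_ucl. Qed.

Lemma uactM u v m : uact (u * v) m = uact u (uact v m).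
Proof.
move: u v; elim/uclW=> u; elim/uclW=> v.
by rewrite [ucl u * ucl v]umulE !uact_ucl.
Qed.

Lemma uact_linearl m : linear (uact^~ m).
Proof.
move=> a; elim/uclW=> u; elim/uclW=> v.
have -> : a *: ucl u + ucl v = ucl (UAdd (UScale a u) v).
  by rewrite !ucl_ueval.
by rewrite !uact_ucl.
Qed.

Lemma uact_linearr u : linear (uact u).
Proof. exact: ueval_act_linear. Qed.
End EnvelopingAction.

Record lieHom (K : fieldType) (L1 L2 : lieAlgType K) := LieHom {
  lieHom_fun :> {linear L1 -> L2};
  lieHom_lie : forall x y, lieHom_fun (lie x y) = lie (lieHom_fun x) (lieHom_fun y)
}.

Section Induction.
Variables (K : fieldType) (S L : lieAlgType K) (phi : lieHom S L).

(** The algebra morphism U(S) -> U(L) extending phi. *)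
Definition umap (u : uea S) : uea L := ueval (fun x => ugen (phi x)) (repr u).

Lemma umap_ucl u : umap (ucl u) = ueval (fun x => ugen (phi x)) u.
Proof.
apply: ueval_cong (ucong_repr u) => [a x y|x y].
- by rewrite linearP ugen_linear.
- by rewrite lieHom_lie ugen_lie.
Qed.

Lemma umap_gen x : umap (ugen x) = ugen (phi x).
Proof. exact: umap_ucl. Qed.

Lemma umap1 : umap 1 = 1.
Proof. exact: umap_ucl. Qed.

Lemma umapM u v : umap (u * v) = umap u * umap v.
Proof.
move: u v; elim/uclW=> u; elim/uclW=> v.
by rewrite [ucl u * ucl v]umulE !umap_ucl.
Qed.

Lemma umap_linear : linear umap.
Proof.
move=> a; elim/uclW=> u; elim/uclW=> v.
have -> : a *: ucl u + ucl v = ucl (UAdd (UScale a u) v).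
  by rewrite !ucl_ueval.
by rewrite !umap_ucl.
Qed.

Variable M : lieModule S.

(** U(L) (x)_{U(S)} M; [IR_bal] is the balancing relation. *)
Inductive induced_rel : lcomb K (uea L * M) -> lcomb K (uea L * M) -> Prop :=
| IR_l a u v m : induced_rel (LGen K (a *: u + v, m))
                             (LAdd (LScale a (LGen K (u, m))) (LGen K (v, m)))
| IR_r u a m n : induced_rel (LGen K (u, a *: m + n))
                             (LAdd (LScale a (LGen K (u, m))) (LGen K (u, n)))
| IR_bal u (w : uea S) m : induced_rel (LGen K (u * umap w, m))
                                       (LGen K (u, uact w m)).

Definition induced := pmod induced_rel.
HB.instance Definition _ := GRing.Lmodule.on induced.

Definition itens (u : uea L) (m : M) : induced := pgen induced_rel (u, m).

Lemma itens_linearl m : linear (itens^~ m).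
Proof. by move=> a u v; apply: (pgen_rel (IR_l a u v m)). Qed.

Lemma itens_linearr u : linear (itens u).
Proof. by move=> a m n; apply: (pgen_rel (IR_r u a m n)). Qed.

Lemma itens_bal u w m : itens (u * umap w) m = itens u (uact w m).
Proof. exact: (pgen_rel (IR_bal u w m)). Qed.

Definition induced_act_gen (x : L) (p : uea L * M) : induced :=
  itens (ugen x * p.1) p.2.

Lemma induced_act_rel x u v : induced_rel u v ->
  leval (induced_act_gen x) u = leval (induced_act_gen x) v.
Proof.
case=> [a {}u {}v m|{}u a m n|{}u w m]; rewrite /= /induced_act_gen /=.
- by rewrite mulrDr -scalerAr itens_linearl.
- by rewrite itens_linearr.
- by rewrite mulrA itens_bal.
Qed.

Definition induced_act (x : L) : induced -> induced :=
  plift (induced_act_rel x).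

Lemma induced_act_itens x u m :
  induced_act x (itens u m) = itens (ugen x * u) m.
Proof. exact: plift_gen. Qed.

Lemma induced_act_linearr x : linear (induced_act x).
Proof. exact: linearP. Qed.

HB.instance Definition _ x :=
  GRing.isLinear.Build K induced induced *:%R (induced_act x)
    (induced_act_linearr x).

Lemma induced_act_linearl t : linear (induced_act^~ t).
Proof.
move=> a x y; elim/pmod_ind: t => [|[u m]|b u v IHu IHv].
- by rewrite !linear0 addr0.
- by rewrite !induced_act_itens ugen_linear mulrDl -scalerAl itens_linearl.
- by rewrite !induced_act_linearr IHu IHv !scalerDr !scalerA mulrC addrACA.
Qed.

Lemma induced_act_lie x y t :
  induced_act (lie x y) t
    = induced_act x (induced_act y t) - induced_act y (induced_act x t).
Proof.
elim/pmod_ind: t => [|[u m]|b u v IHu IHv].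
- by rewrite !linear0 addr0.
- rewrite !induced_act_itens ugen_lie mulrBl !mulrA -scaleN1r addrC.
  by rewrite itens_linearl scaleN1r addrC.
- by rewrite !induced_act_linearr IHu IHv scalerBr /= opprD addrACA.
Qed.

Definition inducedModule : lieModule L :=
  LieModule induced_act_linearl induced_act_linearr induced_act_lie.
End Induction.

(** ** The affine algebras *)

Section Killing.
Variables (K : fieldType) (g : finLieAlgType K).
Implicit Types x y z : g.

Definition ad x : 'End(g) := linfun (lie x).

Definition killing x y : K :=
  \tr (mxof (vbasis {:g}) (vbasis {:g}) (ad x \o ad y)%VF).

Lemma adE x y : ad x y = lie x y.
Proof. exact: lfunE. Qed.

Lemma ad_linear : linear ad.
Proof.
move=> a x y; apply/lfunP=> z.
by rewrite add_lfunE scale_lfunE !adE lie_linearl.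
Qed.

Lemma ad_lie x y : ad (lie x y) = (ad x \o ad y)%VF - (ad y \o ad x)%VF.
Proof.
by apply/lfunP=> z; rewrite add_lfunE opp_lfunE !comp_lfunE !adE lieA.
Qed.

Lemma killing_linearl y : linear (killing^~ y : g -> K^o).
Proof.
move=> a x z; rewrite /killing ad_linear comp_lfunDl -comp_lfunZl.
by rewrite !linearP.
Qed.

Lemma killingC x y : killing x y = killing y x.
Proof.
have eb := vbasisP {:g}.
by rewrite /killing !(mxof_comp _ _ eb) mxtrace_mulC.
Qed.

Lemma killing_linearr x : linear (killing x : g -> K^o).
Proof. by move=> a y z; rewrite ![killing x _]killingC killing_linearl. Qed.

Lemma killing_lie x y z : killing (lie x y) z = killing x (lie y z).
Proof.
have eb := vbasisP {:g}.
rewrite /killing !ad_lie comp_lfunDl comp_lfunDr comp_lfunNl comp_lfunNr.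
rewrite !linearB /=.
rewrite !(mxof_comp _ _ eb) -!mulmxA; congr (_ - _).
by rewrite mulmxA mxtrace_mulC.
Qed.
End Killing.

Section LinearFun.
Variables (K : fieldType) (U W : lmodType K) (F : U -> W).
Hypothesis F_lin : linear F.

Lemma lin0 : F 0 = 0.
Proof. by have := F_lin (-1) 0 0; rewrite !scaleN1r !addNr. Qed.

Lemma linZ a x : F (a *: x) = a *: F x.
Proof. by have := F_lin a x 0; rewrite lin0 !addr0. Qed.

Lemma linD x y : F (x + y) = F x + F y.
Proof. by have := F_lin 1 x y; rewrite !scale1r. Qed.

Lemma linN x : F (- x) = - F x.
Proof. by rewrite -!scaleN1r linZ. Qed.
End LinearFun.

(** [loop g] is g (x) K[t, t^-1], presented by the symbols [lmon x k] standing
    for x (x) t^k, linear in x. *)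
Inductive loop_rel (K : fieldType) (g : finLieAlgType K) :
  lcomb K (g * int) -> lcomb K (g * int) -> Prop :=
| LR a x y k : loop_rel (LGen K (a *: x + y, k))
                        (LAdd (LScale a (LGen K (x, k))) (LGen K (y, k))).

Definition loop (K : fieldType) (g : finLieAlgType K) := pmod (@loop_rel K g).
HB.instance Definition _ (K : fieldType) (g : finLieAlgType K) :=
  GRing.Lmodule.on (loop g).

Section Loop.
Variables (K : fieldType) (g : finLieAlgType K).
Implicit Types (x y : g) (k : int) (f : loop g).

Definition lmon x k : loop g := pgen (@loop_rel K g) (x, k).

Lemma lmon_linear k : linear (lmon^~ k).
Proof. by move=> a x y; apply: (pgen_rel (LR a x y k)). Qed.

Lemma lmon0 k : lmon 0 k = 0.
Proof. exact: (lin0 (lmon_linear k)). Qed.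

Lemma lmonD x y k : lmon (x + y) k = lmon x k + lmon y k.
Proof. exact: (linD (lmon_linear k)). Qed.

Lemma loop_ind (P : loop g -> Prop) :
  P 0 -> (forall x k, P (lmon x k)) ->
  (forall a f f', P f -> P f' -> P (a *: f + f')) -> forall f, P f.
Proof. by move=> P0 Pm Pl; apply: pmod_ind => // -[x k]; apply: Pm. Qed.

Definition loop_lie_gen (p q : g * int) : loop g :=
  lmon (lie p.1 q.1) (p.2 + q.2).

Lemma loop_lie_rel1 q u v : loop_rel u v ->
  leval (loop_lie_gen^~ q) u = leval (loop_lie_gen^~ q) v.
Proof.
by case=> a x y k /=; rewrite /loop_lie_gen /= lie_linearl lmon_linear.
Qed.

Lemma loop_lie_rel2 p u v : loop_rel u v ->
  leval (loop_lie_gen p) u = leval (loop_lie_gen p) v.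
Proof.
by case=> a x y k /=; rewrite /loop_lie_gen /= lie_linearr lmon_linear.
Qed.

Definition loop_lie : loop g -> loop g -> loop g :=
  plift2 loop_lie_rel1 loop_lie_rel2.

Lemma loop_lie_lmon x y k l :
  loop_lie (lmon x k) (lmon y l) = lmon (lie x y) (k + l).
Proof. exact: plift2_gen. Qed.

Definition cocycle_gen (p q : g * int) : K^o :=
  if p.2 + q.2 == 0 then p.2%:~R * killing p.1 q.1 else 0.

Lemma cocycle_rel1 q u v : loop_rel u v ->
  leval (cocycle_gen^~ q) u = leval (cocycle_gen^~ q) v.
Proof.
case=> a x y k /=; rewrite /cocycle_gen /=; case: eqP => _.
- by rewrite killing_linearl mulrDr /GRing.scale /= mulrCA.
- by rewrite scaler0 addr0.
Qed.

Lemma cocycle_rel2 p u v : loop_rel u v ->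
  leval (cocycle_gen p) u = leval (cocycle_gen p) v.
Proof.
case=> a x y k /=; rewrite /cocycle_gen /=; case: eqP => _.
- by rewrite killing_linearr mulrDr /GRing.scale /= mulrCA.
- by rewrite scaler0 addr0.
Qed.

Definition cocycle : loop g -> loop g -> K^o :=
  plift2 cocycle_rel1 cocycle_rel2.

Lemma cocycle_lmon x y k l :
  cocycle (lmon x k) (lmon y l)
    = if k + l == 0 then k%:~R * killing x y else 0.
Proof. exact: plift2_gen. Qed.

Definition degree_gen (p : g * int) : loop g := p.2%:~R *: lmon p.1 p.2.

Lemma degree_rel u v : loop_rel u v -> leval degree_gen u = leval degree_gen v.
Proof.
case=> a x y k; rewrite /= /degree_gen /= lmon_linear.
by rewrite scalerDr !scalerA mulrC.
Qed.

Definition degree : loop g -> loop g := plift degree_rel.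

Lemma degree_lmon x k : degree (lmon x k) = k%:~R *: lmon x k.
Proof. exact: plift_gen. Qed.

Lemma degree_linear : linear degree.
Proof. exact: linearP. Qed.

HB.instance Definition _ :=
  GRing.isLinear.Build K (loop g) (loop g) *:%R degree degree_linear.

Lemma loop_lie_linearl f : linear (loop_lie^~ f).
Proof. exact: plift2_linearl. Qed.

Lemma loop_lie_linearr f : linear (loop_lie f).
Proof. exact: plift2_linearr. Qed.

Lemma cocycle_linearl f : linear (cocycle^~ f).
Proof. exact: plift2_linearl. Qed.

Lemma cocycle_linearr f : linear (cocycle f).
Proof. exact: plift2_linearr. Qed.

HB.instance Definition _ f :=
  GRing.isLinear.Build K (loop g) (loop g) *:%R (loop_lie f)
    (loop_lie_linearr f).
HB.instance Definition _ f :=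
  GRing.isLinear.Build K (loop g) K^o *:%R (cocycle f) (cocycle_linearr f).

Lemma linear_ext1 (W : lmodType K) (F G : loop g -> W) :
  linear F -> linear G -> (forall x k, F (lmon x k) = G (lmon x k)) -> F =1 G.
Proof.
move=> linF linG FG; elim/loop_ind=> [|x k|a f f' IHf IHf']; last 2 first.
- exact: FG.
- by rewrite linF linG IHf IHf'.
by have := FG 0 0; rewrite lmon0.
Qed.

Lemma loop_lieC f f' : loop_lie f f' = - loop_lie f' f.
Proof.
apply: (linear_ext1 (F := loop_lie^~ f') (G := fun h => - loop_lie f' h)).
- exact: loop_lie_linearl.
- by move=> a u v; rewrite linearP opprD scalerN.
move=> x k; apply: (linear_ext1 (F := loop_lie (lmon x k))
                                (G := fun h => - loop_lie h (lmon x k))).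
- exact: loop_lie_linearr.
- by move=> a u v; rewrite loop_lie_linearl opprD scalerN.
move=> y l; rewrite !loop_lie_lmon lieC [l + k]addrC.
exact: (linN (lmon_linear (k + l))).
Qed.

Lemma loop_liexx f : loop_lie f f = 0.
Proof.
elim/loop_ind: f => [|x k|a f f' IHf IHf'].
- exact: linear0.
- by rewrite loop_lie_lmon liexx lmon0.
rewrite loop_lie_linearr !loop_lie_linearl IHf IHf'.
by rewrite scaler0 add0r addr0 loop_lieC scalerN addNr.
Qed.

Lemma cocycleC f f' : cocycle f f' = - cocycle f' f.
Proof.
apply: (linear_ext1 (F := cocycle^~ f') (G := fun h => - cocycle f' h)).
- exact: cocycle_linearl.
- by move=> a u v; rewrite linearP opprD scalerN.
move=> x k; apply: (linear_ext1 (F := cocycle (lmon x k))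
                                (G := fun h => - cocycle h (lmon x k))).
- exact: cocycle_linearr.
- by move=> a u v; rewrite cocycle_linearl opprD scalerN.
move=> y l; rewrite !cocycle_lmon [l + k]addrC; case: eqP => [kl|]; last first.
  by rewrite oppr0.
by rewrite -(addr0_eq kl) mulrNz mulNr opprK killingC.
Qed.

Lemma cocyclexx f : cocycle f f = 0.
Proof.
elim/loop_ind: f => [|x k|a f f' IHf IHf'].
- exact: linear0.
- rewrite cocycle_lmon; case: eqP => // kk.
  suff -> : k = 0 by rewrite mulr0z mul0r.
  by apply/eqP; have := Num.Theory.mulrn_eq0 k 2; rewrite mulr2n kk eqxx.
rewrite cocycle_linearr !cocycle_linearl IHf IHf'.
by rewrite scaler0 add0r addr0 cocycleC scalerN addNr.
Qed.

Lemma degree_lie f f' :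
  degree (loop_lie f f') = loop_lie (degree f) f' + loop_lie f (degree f').
Proof.
apply: (linear_ext1 (F := fun h => degree (loop_lie h f'))
  (G := fun h => loop_lie (degree h) f' + loop_lie h (degree f'))).
- by move=> a u v; rewrite loop_lie_linearl linearP.
- move=> a u v; rewrite linearP !loop_lie_linearl scalerDr.
  by rewrite addrACA.
move=> x k; apply: (linear_ext1 (F := fun h => degree (loop_lie (lmon x k) h))
  (G := fun h => loop_lie (degree (lmon x k)) h + loop_lie (lmon x k) (degree h))).
- by move=> a u v; rewrite loop_lie_linearr linearP.
- move=> a u v; rewrite degree_linear !loop_lie_linearr scalerDr.
  by rewrite addrACA.
move=> y l; rewrite loop_lie_lmon !degree_lmon.
rewrite (linZ (loop_lie_linearr (lmon x k))) (linZ (loop_lie_linearl (lmon y l))) /=.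
by rewrite loop_lie_lmon -scalerDl intrD.
Qed.

Lemma cocycle_degree f f' : cocycle (degree f) f' + cocycle f (degree f') = 0.
Proof.
apply: (linear_ext1
  (F := fun h => cocycle (degree h) f' + cocycle h (degree f')) (G := fun=> 0)).
- move=> a u v; rewrite linearP !cocycle_linearl scalerDr.
  by rewrite addrACA.
- by move=> a u v; rewrite scaler0 addr0.
move=> x k; apply: (linear_ext1
  (F := fun h => cocycle (degree (lmon x k)) h + cocycle (lmon x k) (degree h))
  (G := fun=> 0)).
- move=> a u v; rewrite degree_linear !cocycle_linearr scalerDr.
  by rewrite addrACA.
- by move=> a u v; rewrite scaler0 addr0.
move=> y l; rewrite !degree_lmon.
rewrite (linZ (cocycle_linearr (lmon x k))) (linZ (cocycle_linearl (lmon y l))) /=.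
rewrite cocycle_lmon -scalerDl -intrD; case: eqP => [->|_].
- by rewrite scale0r.
- by rewrite scaler0.
Qed.

Lemma loop_jacobi f1 f2 f3 :
  loop_lie f1 (loop_lie f2 f3) + loop_lie f2 (loop_lie f3 f1)
    + loop_lie f3 (loop_lie f1 f2) = 0.
Proof.
have linz : linear (fun=> 0 : loop g) by move=> ? ? ?; rewrite scaler0 addr0.
apply: (linear_ext1 (F := fun h => loop_lie h (loop_lie f2 f3)
  + loop_lie f2 (loop_lie f3 h) + loop_lie f3 (loop_lie h f2)) (G := fun=> 0)).
- move=> a u v; rewrite !loop_lie_linearl !loop_lie_linearr.
  by rewrite !scalerDr zmod_sum3.
- exact: linz.
move=> x k; apply: (linear_ext1 (F := fun h => loop_lie (lmon x k) (loop_lie h f3)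
  + loop_lie h (loop_lie f3 (lmon x k)) + loop_lie f3 (loop_lie (lmon x k) h))
  (G := fun=> 0)).
- move=> a u v; rewrite !(loop_lie_linearl, loop_lie_linearr).
  by rewrite !scalerDr zmod_sum3.
- exact: linz.
move=> y l; apply: (linear_ext1 (F := fun h => loop_lie (lmon x k) (loop_lie (lmon y l) h)
  + loop_lie (lmon y l) (loop_lie h (lmon x k)) + loop_lie h (loop_lie (lmon x k) (lmon y l)))
  (G := fun=> 0)).
- move=> a u v; rewrite !(loop_lie_linearl, loop_lie_linearr).
  by rewrite !scalerDr zmod_sum3.
- exact: linz.
move=> z m; rewrite !loop_lie_lmon.
have -> : l + (m + k) = k + (l + m) by rewrite addrA addrC.
have -> : m + (k + l) = k + (l + m) by rewrite addrC addrA.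
by rewrite -!lmonD lie_jacobi lmon0.
Qed.

Lemma cocycle_jacobi f1 f2 f3 :
  cocycle f1 (loop_lie f2 f3) + cocycle f2 (loop_lie f3 f1)
    + cocycle f3 (loop_lie f1 f2) = 0.
Proof.
have linz : linear (fun _ : loop g => 0 : K^o).
  by move=> ? ? ?; rewrite scaler0 addr0.
apply: (linear_ext1 (F := fun h => cocycle h (loop_lie f2 f3)
  + cocycle f2 (loop_lie f3 h) + cocycle f3 (loop_lie h f2)) (G := fun=> 0)).
- move=> a u v.
  rewrite !(loop_lie_linearl, loop_lie_linearr, cocycle_linearl, cocycle_linearr).
  by rewrite !scalerDr zmod_sum3.
- exact: linz.
move=> x k; apply: (linear_ext1 (F := fun h => cocycle (lmon x k) (loop_lie h f3)
  + cocycle h (loop_lie f3 (lmon x k)) + cocycle f3 (loop_lie (lmon x k) h))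
  (G := fun=> 0)).
- move=> a u v.
  rewrite !(loop_lie_linearl, loop_lie_linearr, cocycle_linearl, cocycle_linearr).
  by rewrite !scalerDr zmod_sum3.
- exact: linz.
move=> y l; apply: (linear_ext1 (F := fun h => cocycle (lmon x k) (loop_lie (lmon y l) h)
  + cocycle (lmon y l) (loop_lie h (lmon x k)) + cocycle h (loop_lie (lmon x k) (lmon y l)))
  (G := fun=> 0)).
- move=> a u v.
  rewrite !(loop_lie_linearl, loop_lie_linearr, cocycle_linearl, cocycle_linearr).
  by rewrite !scalerDr zmod_sum3.
- exact: linz.
move=> z m; rewrite !loop_lie_lmon !cocycle_lmon.
have -> : l + (m + k) = k + (l + m) by rewrite addrA addrC.
have -> : m + (k + l) = k + (l + m) by rewrite addrC addrA.
case: eqP => [e|_]; last by rewrite !addr0.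
rewrite -[killing y _]killing_lie [killing (lie y z) x]killingC.
rewrite -[killing z _]killingC killing_lie -!mulrDl -!intrD -addrA e.
by rewrite mulr0z mul0r.
Qed.

End Loop.

Section HatTilde.
Variables (K : fieldType) (g : finLieAlgType K).

(** The pair (f, c) stands for f + c K. *)
Definition hat : Type := (loop g * K^o)%type.
HB.instance Definition _ := GRing.Lmodule.on hat.

Definition hat_lie (u v : hat) : hat := (loop_lie u.1 v.1, cocycle u.1 v.1).

Lemma hat_linearl v : linear (hat_lie^~ v).
Proof.
by move=> a x y; rewrite /hat_lie /= loop_lie_linearl cocycle_linearl.
Qed.

Lemma hat_linearr u : linear (hat_lie u).
Proof.
by move=> a x y; rewrite /hat_lie /= loop_lie_linearr cocycle_linearr.
Qed.

Lemma hat_liexx u : hat_lie u u = 0.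
Proof. by rewrite /hat_lie loop_liexx cocyclexx. Qed.

Lemma hat_jacobi u v w :
  hat_lie u (hat_lie v w) + hat_lie v (hat_lie w u) + hat_lie w (hat_lie u v)
    = 0.
Proof.
by congr pair; rewrite /= ?loop_jacobi ?cocycle_jacobi.
Qed.

HB.instance Definition _ := Lmodule_isLieAlgebra.Build K hat
  hat_linearl hat_linearr hat_liexx hat_jacobi.

(** The pair (u, b) stands for u + b d. *)
Definition tilde : Type := (hat * K^o)%type.
HB.instance Definition _ := GRing.Lmodule.on tilde.

Definition tilde_lie (u v : tilde) : tilde :=
  ((loop_lie u.1.1 v.1.1 + ((u.2 : K) *: degree v.1.1 - (v.2 : K) *: degree u.1.1),
    cocycle u.1.1 v.1.1), 0).

Lemma tilde_linearl v : linear (tilde_lie^~ v).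
Proof.
move=> a x y; congr (_, _, _); rewrite /= ?scaler0 ?addr0 ?cocycle_linearl //.
rewrite loop_lie_linearl degree_linear !scalerDr scalerDl scalerN !scalerA.
rewrite [v.2 * a]mulrC [in RHS]addrACA; congr (_ + _).
by rewrite opprD addrACA.
Qed.

Lemma tilde_liexx u : tilde_lie u u = 0.
Proof. by rewrite /tilde_lie loop_liexx cocyclexx subrr addr0. Qed.

Lemma tilde_lieC u v : tilde_lie u v = - tilde_lie v u.
Proof.
congr (_, _, _); rewrite /= ?oppr0 //; last exact: cocycleC.
by rewrite loop_lieC opprD opprB.
Qed.

Lemma tilde_linearr u : linear (tilde_lie u).
Proof.
move=> a x y; rewrite !(tilde_lieC u) tilde_linearl.
by rewrite opprD scalerN.
Qed.

Lemma cocycle_degreeC (f f' : loop g) :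
  cocycle f (degree f') = cocycle f' (degree f) :> K^o.
Proof.
rewrite [RHS]cocycleC; apply/eqP; rewrite -addr_eq0 addrC.
by apply/eqP; apply: cocycle_degree.
Qed.

Lemma zmod_jacobi (V : zmodType) (j1 j2 j3 p1 p2 p3 q1 q2 q3 e1 e2 e3 : V) :
  j1 + j2 + j3 = 0 ->
  j1 + (p1 - q1) + ((- p3 + q2) + (e1 - e3))
  + (j2 + (p2 - q2) + ((- p1 + q3) + (e2 - e1)))
  + (j3 + (p3 - q3) + ((- p2 + q1) + (e3 - e2))) = 0.
Proof.
move=> j0.
have zB (a b c a' b' c' : V) :
    a - a' + (b - b') + (c - c') = a + b + c - (a' + b' + c').
  by rewrite zmod_sum3 -!opprD.
rewrite ![- _ + _]addrC zmod_sum3 (zmod_sum3 j1) (zmod_sum3 (q2 - p3)) j0 !zB add0r.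
have -> : q2 + q3 + q1 = q1 + q2 + q3 by rewrite addrC addrA.
have -> : p3 + p1 + p2 = p1 + p2 + p3 by rewrite -addrA addrC.
have -> : e3 + e1 + e2 = e1 + e2 + e3 by rewrite -addrA addrC.
by rewrite subrr addr0 -[X in _ + X]opprB subrr.
Qed.

Lemma tilde_jacobi u v w :
  tilde_lie u (tilde_lie v w) + tilde_lie v (tilde_lie w u)
    + tilde_lie w (tilde_lie u v) = 0.
Proof.
case: u => [[f1 c1] b1]; case: v => [[f2 c2] b2]; case: w => [[f3 c3] b3].
congr (_, _, _); rewrite /= ?addr0 //; last first.
  have lN (f h : loop g) : cocycle f (- h) = - cocycle f h := linN (cocycle_linearr f) h.
  have lD (f h h' : loop g) : cocycle f (h + h') = cocycle f h + cocycle f h' :=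
    linD (cocycle_linearr f) h h'.
  have lZ (f : loop g) a h : cocycle f (a *: h) = a *: cocycle f h :=
    linZ (cocycle_linearr f) a h.
  rewrite !(lN, lD, lZ) zmod_sum3 cocycle_jacobi add0r.
  rewrite [cocycle f3 (degree f1)]cocycle_degreeC.
  rewrite [cocycle f2 (degree f1)]cocycle_degreeC.
  rewrite [cocycle f3 (degree f2)]cocycle_degreeC.
  set x := b2 *: _; set y := b3 *: _; set z := b1 *: _.
  by rewrite !addrA !subrK subrr.
have lN (f h : loop g) : loop_lie f (- h) = - loop_lie f h := linN (loop_lie_linearr f) h.
have lD (f h h' : loop g) : loop_lie f (h + h') = loop_lie f h + loop_lie f h' :=
  linD (loop_lie_linearr f) h h'.
have lZ (f : loop g) a h : loop_lie f (a *: h) = a *: loop_lie f h :=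
  linZ (loop_lie_linearr f) a h.
rewrite !scale0r !subr0 !linearD !linearN !linearZ /=.
rewrite !degree_lie !(loop_lieC (degree _)).
rewrite !scalerDr !scalerN !scalerA.
by apply: zmod_jacobi; apply: loop_jacobi.
Qed.

HB.instance Definition _ := Lmodule_isLieAlgebra.Build K tilde
  tilde_linearl tilde_linearr tilde_liexx tilde_jacobi.

Definition hat_to_tilde (u : hat) : tilde := (u, 0).

Lemma hat_to_tilde_linear : linear hat_to_tilde.
Proof. by move=> a u v; congr pair; rewrite /= scaler0 addr0. Qed.

HB.instance Definition _ :=
  GRing.isLinear.Build K hat tilde *:%R hat_to_tilde hat_to_tilde_linear.

Lemma hat_to_tilde_lie u v :
  hat_to_tilde (lie u v) = lie (hat_to_tilde u) (hat_to_tilde v).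
Proof.
by rewrite /lie /= /tilde_lie /= !scale0r subrr addr0.
Qed.

Definition hat_tilde : lieHom hat tilde :=
  LieHom hat_to_tilde_lie.
End HatTilde.

(** M[d] = U(tilde g) (x)_{U(hat g)} M. *)
Definition dind (K : fieldType) (g : finLieAlgType K)
    (M : lieModule (hat g)) : lieModule (tilde g) :=
  inducedModule (hat_tilde g) M.

(** ** Evaluation modules *)

Section Evaluation.
Variables (K : fieldType) (g : finLieAlgType K) (a : K).

Definition ev_gen (p : g * int) : g := a ^ p.2 *: p.1.

Lemma ev_rel u v : @loop_rel K g u v -> leval ev_gen u = leval ev_gen v.
Proof.
by case=> b x y k; rewrite /= /ev_gen /= scalerDr !scalerA mulrC.
Qed.

(** Evaluation at t = a. *)
Definition ev : loop g -> g := plift ev_rel.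

Lemma ev_lmon x k : ev (lmon x k) = a ^ k *: x.
Proof. exact: plift_gen. Qed.

Lemma ev_linear : linear ev.
Proof. exact: linearP. Qed.

Lemma ev_lie (a_neq0 : a != 0) f f' : ev (loop_lie f f') = lie (ev f) (ev f').
Proof.
apply: (linear_ext1 (F := fun h => ev (loop_lie h f'))
                    (G := fun h => lie (ev h) (ev f'))).
- by move=> b u v; rewrite loop_lie_linearl ev_linear.
- by move=> b u v; rewrite ev_linear lie_linearl.
move=> x k; apply: (linear_ext1 (F := fun h => ev (loop_lie (lmon x k) h))
                                (G := fun h => lie (ev (lmon x k)) (ev h))).
- by move=> b u v; rewrite loop_lie_linearr ev_linear.
- by move=> b u v; rewrite ev_linear lie_linearr.
move=> y l; rewrite loop_lie_lmon !ev_lmon lieZl (linZ (lie_linearr x)).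
by rewrite scalerA -expfzDr.
Qed.

Variables (a_neq0 : a != 0) (M : lieModule g).

Definition ev_act (u : hat g) (m : M) : M := act (ev u.1) m.

Lemma ev_act_linearl m : linear (ev_act^~ m).
Proof. by move=> b u v; rewrite /ev_act ev_linear act_linearl. Qed.

Lemma ev_act_linearr u : linear (ev_act u).
Proof. exact: act_linearr. Qed.

Lemma ev_act_lie u v m :
  ev_act (lie u v) m = ev_act u (ev_act v m) - ev_act v (ev_act u m).
Proof. by rewrite /ev_act ev_lie // act_lie. Qed.

Definition evModule : lieModule (hat g) :=
  LieModule ev_act_linearl ev_act_linearr ev_act_lie.
End Evaluation.

Definition evTensor (K : fieldType) (g : finLieAlgType K) (n : nat)
    (a : 'I_n -> K) (a_neq0 : forall i, a i != 0) (M : 'I_n -> lieModule g) :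
    lieModule (hat g) :=
  multitensorModule (fun i => evModule (a_neq0 i) (M i)).

Lemma evTensor_act (K : fieldType) (g : finLieAlgType K) (n : nat)
    (a : 'I_n -> K) (a_neq0 : forall i, a i != 0) (M : 'I_n -> lieModule g)
    (x : g) (k : int) (c : K^o) (v : forall i, M i) :
  act ((lmon x k, c) : hat g) (mtens v : evTensor a_neq0 M)
    = \sum_(i < n) a i ^ k *: mtens (dfwith v (act x (v i))).
Proof.
rewrite /act /= multitensor_act_mtens; apply: eq_bigr => i _.
rewrite /act /= /ev_act ev_lmon actZl.
have /= := @mtens_linear K n (fun i => M i) v i (a i ^ k) (act x (v i)) 0.
have -> : mtens (dfwith v (0 : M i)) = 0 :> multitensor (fun i => M i).
  have := @mtens_linear K n (fun i => M i) v i (-1) 0 0.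
  by rewrite scaler0 addr0 scaleN1r addNr.
by rewrite !addr0.
Qed.

(** ** Simple Lie algebras, Cartan subalgebras, bases of root systems *)

Section Structure.
Variables (K : fieldType) (g : finLieAlgType K).

Definition simple : Prop :=
  (exists x y : g, lie x y != 0) /\
  forall I : {vspace g}, (forall x y, y \in I -> lie x y \in I) ->
    I = 0%VS \/ I = fullv.

Definition lie_prod (U V : {vspace g}) : {vspace g} :=
  <<[seq lie x y | x <- vbasis U, y <- vbasis V]>>%VS.

Definition nilpotent (h : {vspace g}) : Prop :=
  exists n, iter n (lie_prod h) h = 0%VS.

Definition cartan_subalgebra (h : {vspace g}) : Prop :=
  [/\ forall x y, x \in h -> y \in h -> lie x y \in h,
      nilpotent h &
      forall x, (forall y, y \in h -> lie x y \in h) -> x \in h].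

Variable h : {vspace g}.

Definition dual := 'Hom(subvs_of h, K^o).
HB.instance Definition _ := Vector.on dual.

Definition root_space (al : dual) : set g :=
  [set x | forall y : subvs_of h, lie (vsval y) x = (al y : K) *: x].

Definition is_root (al : dual) : Prop :=
  al != 0 /\ exists2 x, x != 0 & root_space al x.

Definition nonneg_comb (D : seq dual) (al : dual) : Prop :=
  exists c : 'I_(size D) -> nat, al = \sum_(i < size D) D`_i *+ c i.

Definition root_base (D : seq dual) : Prop :=
  [/\ basis_of fullv D, forall al, al \in D -> is_root al &
      forall al, is_root al -> nonneg_comb D al \/ nonneg_comb D (- al)].

Definition lspan (V : lmodType K) (A : set V) : set V :=
  [set x | exists n (c : 'I_n -> K) (v : 'I_n -> V),
    (forall i, A (v i)) /\ x = \sum_(i < n) c i *: v i].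

Variable D : seq dual.

Definition nplus : set g :=
  lspan [set x | exists al, [/\ is_root al, nonneg_comb D al & root_space al x]].

Definition tilde_nplus : set (hat g) :=
  lspan ([set ((lmon x 0, 0) : hat g) | x in nplus] `|`
         [set u | exists x k, (0 < k)%R /\ u = (lmon x k, 0)]).

Definition highest_weight (lam : dual) (M : lieModule g) : Prop :=
  exists v : M, [/\ v != 0, generates v,
    forall x, nplus x -> act x v = 0 &
    forall y : subvs_of h, act (vsval y : g) v = (lam y : K) *: v].

(** The dual of hat h = h (+) K K; (y, c) stands for y (x) 1 + c K. *)
Definition hat_dual := 'Hom((subvs_of h * K^o)%type, K^o).
HB.instance Definition _ := Vector.on hat_dual.

Definition hat_cartan (p : subvs_of h * K^o) : hat g :=
  (lmon (vsval p.1) 0, p.2).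

Definition hat_highest_weight_vector (gam : hat_dual) (M : lieModule (hat g))
    (v : M) : Prop :=
  [/\ v != 0, generates v,
    forall u, tilde_nplus u -> act u v = 0 &
    forall p : subvs_of h * K^o, act (hat_cartan p) v = (gam p : K) *: v].

Definition hat_degree (u : hat g) : hat g := (degree u.1, 0).

(** The action of [hat g] on M extends to [tilde g] with d v = 0. *)
Definition graded_from (M : lieModule (hat g)) (v : M) : Prop :=
  exists delta : {linear M -> M},
    (forall x u, delta (act x u) = act (hat_degree x) u + act x (delta u)) /\
    delta v = 0.

(** M is the irreducible highest weight [hat g]-module of highest weight gam.
    For the Killing form, K = -1/2 is the critical level. At this level only,
    gam does not determine an irreducible highest weight [hat g]-module (nor
    conversely), and the irreducible quotient of the Verma module is understood
    to be the graded one: the restriction of the irreducible highest weight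
    [tilde g]-module. At all other levels no grading is required. *)
Definition hat_irreducible_highest_weight (gam : hat_dual)
    (M : lieModule (hat g)) : Prop :=
  irreducible M /\
  exists v : M, hat_highest_weight_vector gam v /\
    ((gam (0, 1) : K) = - 2%:R^-1 -> graded_from v).

(** A nonzero Lie algebra homomorphism from [tilde_nplus] to K; only the values
    of eta on [tilde_nplus] matter. *)
Definition whittaker_type (eta : hat g -> K) : Prop :=
  [/\ forall a u v, tilde_nplus u -> tilde_nplus v ->
        eta (a *: u + v) = a * eta u + eta v,
      forall u v, tilde_nplus u -> tilde_nplus v -> eta (lie u v) = 0 &
      exists2 u, tilde_nplus u & eta u != 0].

Definition whittaker (eta : hat g -> K) (M : lieModule (hat g)) : Prop :=
  exists v : M, [/\ v != 0, generates v &
    forall u, tilde_nplus u -> act u v = eta u *: v].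

End Structure.

(* Main.v *)
From HB Require Import structures.
Require Import Defs.
From mathcomp Require Import all_boot all_order all_algebra.
From mathcomp Require Import complex boolp classical_sets functions reals.
From mathcomp Require Import zify spectral.

Set Implicit Arguments.
Unset Strict Implicit.
Unset Printing Implicit Defensive.

Import Order.TTheory GRing.Theory Num.Theory passmx.
Local Open Scope ring_scope.
Local Open Scope complex_scope.
Local Open Scope classical_set_scope.

(** Evaluation modules see only finitely many values of a loop, while every vector
    of a highest weight or Whittaker module is killed by [x t^k] for all large k.
    By interpolation [hat g] therefore contains elements acting on E as prescribed
    and killing any given finite subset of the other factor. A density argument
    then shows that E (x) V is irreducible and, with Schur's lemma for E, that an
    isomorphism E (x) V ~ E' (x) V' forces E ~ E' and V ~ V'.

    To remove [d], M[d] is mapped to the functions int -> M, f(d) (x) m going to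
    z |-> f(z) m. The translations of int commute with [hat g], so the highest
    nonvanishing difference of a map M -> N[d] is a [hat g]-morphism M -> N.

    It remains to compare the modules V. For a grading of [hat g] whose positive
    part is [tilde_nplus], products of positive total degree kill a highest weight
    vector. Hence positive homogeneous elements are locally nilpotent on highest
    weight modules, which excludes Whittaker vectors. An operator measuring the
    degree makes every singular vector of an irreducible highest weight module a
    multiple of the generator, so the module determines its weight, and two such
    modules with the same weight are related by the graph of an isomorphism, the
    submodule of their direct sum generated by the pair of generators. Off the
    critical level this operator comes from the Sugawara construction. *)

(** * Subspaces and functionals *)

(** Irreducible Whittaker modules are not controlled by their type, and the modules V are
    infinite-dimensional in general. Schur's lemma is therefore used on the side of E only, where it
    comes from singular vectors instead of eigenvalues of endomorphisms.

    The Cartan subalgebra is given as nilpotent and self-normalising, and the base through its root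
    spaces, so the classical structure is rebuilt from there. For the element [y0] on which all
    simple roots are 1, [ad y0] has integer generalized eigenvalues; this makes the Killing form
    nondegenerate. Derivations are then inner, hence Cartan elements act semisimply and [g] is
    spanned by weight vectors.

    The constant -1/2 stems from the Casimir element, which for the Killing form is 1 on the adjoint
    representation: at level k the commutator of the Sugawara operator with x t^j is -j (1 + 2 k) x
    t^j. For k different from -1/2 this operator is a rescaled [d]; at k = -1/2 it commutes with
    everything, and the grading is part of the definition of the module. *)

Section Subspaces.
Variables (K : fieldType) (V : lmodType K).

Definition subspace (S : set V) : Prop :=
  S 0 /\ forall a u v, S u -> S v -> S (a *: u + v).

Variable S : set V.
Hypothesis sS : subspace S.

Lemma subspace0 : S 0. Proof. by case: sS. Qed.

Lemma subspaceD u v : S u -> S v -> S (u + v).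
Proof. by case: sS => _ h Su Sv; rewrite -[u]scale1r; apply: h. Qed.

Lemma subspaceZ a u : S u -> S (a *: u).
Proof. by case: sS => S0 h Su; rewrite -[_ *: _]addr0; apply: h. Qed.

Lemma subspaceN u : S u -> S (- u).
Proof. by rewrite -scaleN1r; apply: subspaceZ. Qed.

Lemma subspaceB u v : S u -> S v -> S (u - v).
Proof. by move=> Su Sv; apply/subspaceD/subspaceN. Qed.

Lemma subspace_sum (I : Type) (r : seq I) (P : pred I) (F : I -> V) :
  (forall i, P i -> S (F i)) -> S (\sum_(i <- r | P i) F i).
Proof.
move=> SF; elim/big_ind: _ => //; first exact: subspace0.
exact: subspaceD.
Qed.

End Subspaces.

Lemma linear_sum_fun (K : fieldType) (U V : lmodType K) (f : U -> V) :
  linear f -> forall (I : Type) (r : seq I) (P : pred I) (F : I -> U),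
  f (\sum_(i <- r | P i) F i) = \sum_(i <- r | P i) f (F i).
Proof.
move=> lf I r P F; elim/big_rec2: _ => [|i y x _ <-]; first exact: lin0 lf.
by rewrite (linD lf).
Qed.

(** By Zorn's lemma there is a maximal subspace [A] containing [T] and avoiding [v]. It is a
    complement of the line of [v], and [phi] is the coordinate along [v]. *)
Lemma separating_functional (K : fieldType) (V : lmodType K) (T : set V) (v : V) :
  subspace T -> ~ T v ->
  exists2 phi : V -> K^o, linear phi & (forall t, T t -> phi t = 0) /\ phi v = 1.
Proof.
move=> sT Tv.
pose P (A : set V) := A = set0 \/ [/\ subspace A, T `<=` A & ~ A v].
have [F FP totF|A [PA Amax]] := @Zorn_bigcup V P.
  have [[X FX [x Xx]]|noX] := pselect (exists2 X, F X & X !=set0); last first.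
    left; apply/seteqP; split=> // x [X FX Xx].
    by case: noX; exists X => //; exists x.
  have big Y y : F Y -> Y y -> [/\ subspace Y, T `<=` Y & ~ Y v].
    by move=> FY Yy; case: (FP _ FY) => // Y0; rewrite Y0 in Yy.
  right; split.
  - split; first by exists X => //; apply: subspace0; case: (big _ _ FX Xx).
    move=> a u w [Y FY Yu] [Z FZ Zw].
    case: (totF _ _ FY FZ) => [YZ|ZY].
    + exists Z => //; case: (big _ _ FZ Zw) => [[_ cl] _ _].
      by apply: cl => //; apply: YZ.
    + exists Y => //; case: (big _ _ FY Yu) => [[_ cl] _ _].
      by apply: cl => //; apply: ZY.
  - by move=> t Tt; exists X => //; case: (big _ _ FX Xx) => _ TX _; apply: TX.
  - by move=> [Y FY Yv]; case: (big _ _ FY Yv).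
have [sA TA Av] : [/\ subspace A, T `<=` A & ~ A v].
  case: PA => // A0; exfalso; apply: (Amax T); last by right; split=> // ?.
  rewrite A0; split; first by move=> ?.
  by move=> /(_ 0 (subspace0 sT)).
have ex w : exists c : K, A (w - c *: v).
  have [Aw|nAw] := pselect (A w); first by exists 0; rewrite scale0r subr0.
  pose B := [set u | exists c x, A x /\ u = x + c *: w].
  have sB : subspace B.
    split; first by exists 0, 0; rewrite scale0r addr0; split=> //; apply: subspace0.
    move=> a _ _ [c [x [Ax ->]]] [d [y [Ay ->]]].
    exists (a * c + d), (a *: x + y); split; first by case: sA => _; apply.
    by rewrite scalerDr scalerDl scalerA addrACA.
  have AB : A `<=` B by move=> x Ax; exists 0, x; rewrite scale0r addr0.
  have Bw : B w by exists 1, 0; rewrite scale1r add0r; split=> //; apply: subspace0.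
  (* By maximality of [A], the larger subspace A + K w cannot avoid [v]. *)
  have Bv : B v.
    apply: contrapT => nBv; apply: (Amax B).
      by split=> // BA; apply: nAw; apply: BA.
    by right; split=> //; apply: subset_trans AB.
  case: Bv => c [x [Ax vE]].
  have c0 : c != 0.
    by apply/eqP => c0; apply: Av; rewrite vE c0 scale0r addr0.
  exists c^-1; rewrite vE scalerDr scalerA mulVf // scale1r opprD addrA addrAC subrr add0r.
  by apply: subspaceN => //; apply: subspaceZ.
have uniq w c d : A (w - c *: v) -> A (w - d *: v) -> c = d.
  move=> Ac Ad; apply/eqP; rewrite -subr_eq0; apply/negPn/negP => cd.
  apply: Av; rewrite -[v]scale1r -(mulVf cd) -scalerA; apply: subspaceZ => //.
  have -> : (c - d) *: v = (w - d *: v) - (w - c *: v).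
    by rewrite opprB scalerBl [RHS]addrC addrA subrK.
  exact: subspaceB.
pose phi w : K^o := proj1_sig (cid (ex w)).
have phiP w : A (w - phi w *: v) by rewrite /phi; case: cid.
exists phi; last split.
- move=> a x y; apply: (uniq (a *: x + y)); first exact: phiP.
  rewrite scalerDl opprD addrACA -scalerA -scalerBr.
  by case: sA => _; apply.
- by move=> t Tt; apply: (uniq t); [exact: phiP|rewrite scale0r subr0; apply: TA].
- apply: (uniq v); [exact: phiP|rewrite scale1r subrr; exact: subspace0].
Qed.

Lemma nonzero_functional (K : fieldType) (V : lmodType K) (v : V) : v != 0 ->
  exists2 phi : V -> K^o, linear phi & phi v = 1.
Proof.
move=> /eqP v0; have [|//|phi lphi [_ phiv]] := @separating_functional K V [set 0] v.
  by split=> // a _ _ -> ->; rewrite scaler0 addr0.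
by exists phi.
Qed.

(** * Homomorphisms, isomorphisms and irreducibility of modules *)

Section ModuleHom.
Variables (K : fieldType) (L : lieAlgType K).
Implicit Types M N P : lieModule L.

Definition module_hom M N (f : M -> N) : Prop :=
  linear f /\ forall x u, f (act x u) = act x (f u).

Definition schur M : Prop :=
  forall f : M -> M, module_hom f -> exists c, forall u, f u = c *: u.

Lemma act_linear0 M (x : L) : act x (0 : M) = 0.
Proof. exact: (lin0 (act_linearr x)). Qed.

Lemma iso_of_hom M N (f : M -> N) (g : N -> M) :
  module_hom f -> cancel f g -> cancel g f -> lieModule_iso M N.
Proof.
move=> [lf fx] fK gK.
pose f' : {linear M -> N} := HB.pack f (GRing.isLinear.Build K M N *:%R f lf).
by exists f'; split=> //; exists g.
Qed.

Lemma hom_of_iso M N : lieModule_iso M N ->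
  exists f : M -> N, exists g : N -> M,
    [/\ module_hom f, module_hom g, cancel f g & cancel g f].
Proof.
move=> [f [[g fK gK] fx]]; exists f, g; split=> //.
- by split=> //; apply: linearP.
- split=> [a u v|x u].
    by apply: (can_inj fK); rewrite gK linearP !gK.
  by apply: (can_inj fK); rewrite gK fx gK.
Qed.

Lemma lieModule_iso_sym M N : lieModule_iso M N -> lieModule_iso N M.
Proof. by move=> /hom_of_iso [f [g [hf hg fK gK]]]; apply: (iso_of_hom hg gK fK). Qed.

Lemma iso_of_bij M N (f : M -> N) : module_hom f -> injective f ->
  (forall v, exists u, f u = v) -> lieModule_iso M N.
Proof.
move=> hf fI fS; pose g v := proj1_sig (cid (fS v)).
have gK : cancel g f by move=> v; rewrite /g; case: cid.
by apply: (iso_of_hom hf _ gK) => u; apply: fI; rewrite gK.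
Qed.

Lemma iso_of_irreducible M N (f : M -> N) : irreducible M -> irreducible N ->
  module_hom f -> (exists u, f u != 0) -> lieModule_iso M N.
Proof.
move=> [_ irrM] [_ irrN] [lf fx] [u fu].
apply: (iso_of_bij (conj lf fx)).
- have sk : submodule [set w | f w = 0].
    split=> [|a w v /= w0 v0|x w /= w0]; first exact: lin0 lf.
      by rewrite lf w0 v0 scaler0 addr0.
    by rewrite fx w0 act_linear0.
  case: (irrM _ sk) => [k0|kT]; last first.
    by have : [set w | f w = 0] u; [rewrite kT|move=> /= fu0; rewrite fu0 eqxx in fu].
  move=> w v e; apply/eqP; rewrite -subr_eq0; apply/eqP.
  have : [set w | f w = 0] (w - v) by rewrite /= (linD lf) (linN lf) e subrr.
  by rewrite k0.
- have si : submodule [set w | exists v, f v = w].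
    split=> [|a _ _ [w <-] [v <-]|x _ [w <-]].
    + by exists 0; apply: lin0 lf.
    + by exists (a *: w + v); rewrite lf.
    + by exists (act x w).
  case: (irrN _ si) => [i0|iT] v; last by have : [set: N] v by []; rewrite -iT.
  have : [set w | exists v, f v = w] (f u) by exists u.
  by rewrite i0 => fu0; rewrite fu0 eqxx in fu.
Qed.

Lemma iso_irreducible M N : lieModule_iso M N -> irreducible M -> irreducible N.
Proof.
move=> /hom_of_iso [f [g [[lf fx] [lg gx] fK gK]]] [[u u0] irrM]; split.
  by exists (f u); apply: contra_neq u0 => /(congr1 g); rewrite fK (lin0 lg).
move=> S [S0 Sl Sx].
have sT : submodule [set w | S (f w)].
  split=> [|a w v /= Sw Sv|x w /= Sw]; first by rewrite /= (lin0 lf).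
    by rewrite lf; apply: Sl.
  by rewrite fx; apply: Sx.
case: (irrM _ sT) => e; [left|right]; apply/seteqP; split=> v //=.
- move=> Sv; have : [set w | S (f w)] (g v) by rewrite /= gK.
  by rewrite e /= => gv0; rewrite -[v]gK gv0 (lin0 lf).
- by move=> ->.
- by move=> _; have : [set: M] (g v) by []; rewrite -e /= gK.
Qed.

Lemma iso_schur M N : lieModule_iso M N -> schur M -> schur N.
Proof.
move=> /hom_of_iso [f [g [[lf fx] [lg gx] fK gK]]] schM h [lh hx].
have [|c hc] := schM (g \o h \o f).
  by split=> [a u v|x u] /=; rewrite ?lf ?lh ?lg ?fx ?hx ?gx.
exists c => u; have /(congr1 f) := hc (g u).
by rewrite /= !gK (linZ lf) gK.
Qed.

Lemma nonzero_submodule M (S : set M) : submodule S ->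
  S = [set 0] \/ exists2 u, S u & u != 0.
Proof.
move=> sS; have [[u Su u0]|nS] := pselect (exists2 u, S u & u != 0).
  by right; exists u.
left; apply/seteqP; split=> u /=; last by move=> ->; case: sS.
by move=> Su; apply: contrapT => /eqP u0; apply: nS; exists u.
Qed.

End ModuleHom.

(** * Contractions of tensors by functionals *)

Section TensorFunctor.
Variables (K : fieldType) (M N M' N' : lmodType K).

Lemma tens0l (n : N) : tens (0 : M) n = 0.
Proof. exact: (lin0 (tens_linearl n)). Qed.

Lemma tens0r (m : M) : tens m (0 : N) = 0.
Proof. exact: (lin0 (tens_linearr m)). Qed.

Lemma tensor_sum_tens (u : tensor M N) :
  exists s : seq (M * N), u = \sum_(p <- s) tens p.1 p.2.
Proof.
elim/pmod_ind: u => [|[m n]|a u v [s ->] [t ->]].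
- by exists [::]; rewrite big_nil.
- by exists [:: (m, n)]; rewrite big_seq1.
- exists ([seq (a *: p.1, p.2) | p <- s] ++ t).
  rewrite big_cat big_map scaler_sumr /=; congr (_ + _).
  by apply: eq_bigr => p _; rewrite (linZ (tens_linearl _)).
Qed.

Section Tmap.
Variables (f : M -> M') (g : N -> N').
Hypotheses (lf : linear f) (lg : linear g).

Lemma tmap_rel u v : tensor_rel u v ->
  leval (fun p : M * N => tens (f p.1) (g p.2)) u
  = leval (fun p => tens (f p.1) (g p.2)) v.
Proof.
case=> [a p q n|m a p q] /=; first by rewrite lf tens_linearl.
by rewrite lg tens_linearr.
Qed.

Definition tmap : tensor M N -> tensor M' N' := plift tmap_rel.

Lemma tmap_tens m n : tmap (tens m n) = tens (f m) (g n).
Proof. exact: plift_gen. Qed.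

Lemma tmap_linear : linear tmap.
Proof. exact: linearP. Qed.

End Tmap.

Section Contraction.
Variable phi : N -> K^o.
Hypothesis lphi : linear phi.

Lemma contr_rel u v : tensor_rel u v ->
  leval (fun p : M * N => (phi p.2 : K) *: p.1) u
  = leval (fun p => (phi p.2 : K) *: p.1) v.
Proof.
case=> [a p q n|m a p q] /=; first by rewrite scalerDr !scalerA mulrC.
by rewrite lphi scalerDl scalerA.
Qed.

Definition contr : tensor M N -> M := plift contr_rel.

Lemma contr_tens m n : contr (tens m n) = (phi n : K) *: m.
Proof. exact: plift_gen. Qed.

Lemma contr_linear : linear contr.
Proof. exact: linearP. Qed.

End Contraction.

Section ContractionLeft.
Variable psi : M -> K^o.
Hypothesis lpsi : linear psi.

Lemma contrl_rel u v : tensor_rel u v ->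
  leval (fun p : M * N => (psi p.1 : K) *: p.2) u
  = leval (fun p => (psi p.1 : K) *: p.2) v.
Proof.
case=> [a p q n|m a p q] /=; last by rewrite scalerDr !scalerA mulrC.
by rewrite lpsi scalerDl scalerA.
Qed.

Definition contrl : tensor M N -> N := plift contrl_rel.

Lemma contrl_tens m n : contrl (tens m n) = (psi m : K) *: n.
Proof. exact: plift_gen. Qed.

Lemma contrl_linear : linear contrl.
Proof. exact: linearP. Qed.

End ContractionLeft.
End TensorFunctor.

Section TensorSeparation.
Variables (K : fieldType) (M N : lmodType K).

Fixpoint span_seq (l : seq N) : set N :=
  if l is y :: l' then [set x | exists c, span_seq l' (x - c *: y)] else [set 0].

Lemma span_seq_subspace l : subspace (span_seq l).
Proof.
elim: l => [|y l IH]; first by split=> // a u v -> ->; rewrite scaler0 addr0.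
split=> [|a u v [c cu] [d dv]]; first by exists 0; rewrite scale0r subr0; case: IH.
exists (a * c + d); rewrite scalerDl opprD addrACA -scalerA -scalerBr.
by case: IH => _; apply.
Qed.

Lemma span_seq_mem l x : x \in l -> span_seq l x.
Proof.
elim: l => //= y l IH; rewrite inE => /orP[/eqP ->|/IH xl].
  by exists 1; rewrite scale1r subrr; exact: (subspace0 (span_seq_subspace l)).
by exists 0; rewrite scale0r subr0.
Qed.

(** Expanding [x] in the right factors of [s] moves each piece of m (x) x onto the matching left
    factor, so no term is added. *)
Lemma tens_absorb (s : seq (M * N)) m x : span_seq [seq p.2 | p <- s] x ->
  exists2 s' : seq (M * N), size s' = size s &
    tens m x + \sum_(p <- s) tens p.1 p.2 = \sum_(p <- s') tens p.1 p.2.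
Proof.
elim: s x => [|p s IH] x /=.
  by move=> ->; exists [::]; rewrite // tens0r add0r.
move=> [c /IH [s' ss' e]]; exists ((c *: m + p.1, p.2) :: s'); first by rewrite /= ss'.
rewrite !big_cons -e /= tens_linearl (linD (tens_linearr m)).
rewrite (linN (tens_linearr m)) (linZ (tens_linearr m)).
set d := c *: _; set b := tens p.1 _; set a := tens m _.
by rewrite [d + b]addrC -addrA [d + _]addrA [d + _]addrC subrK addrCA.
Qed.

(** Induction on the number of terms. If the first right factor depends on the others, its term is
    absorbed; if not, a functional that is 1 on it and 0 on the others shows that its left factor
    vanishes. *)
Lemma tensor_separated (u : tensor M N) :
  (forall (phi : N -> K^o) (lphi : linear phi), contr lphi u = 0) -> u = 0.
Proof.
have [s ->] := tensor_sum_tens u; have [r] := ubnP (size s).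
elim: r s => // r IH [|p s] /=; first by rewrite big_nil.
rewrite ltnS => sr; rewrite big_cons => c0.
have [sp|nsp] := pselect (span_seq [seq q.2 | q <- s] p.2).
  have [s' ss' e] := tens_absorb p.1 sp.
  by move: c0; rewrite e; apply: IH; rewrite ss'.
have [phi lphi [phi0 phi1]] := separating_functional (span_seq_subspace _) nsp.
have cs : contr (M := M) lphi (\sum_(q <- s) tens q.1 q.2) = 0.
  rewrite (linear_sum_fun (contr_linear lphi)) big_seq big1 // => q qs.
  by rewrite contr_tens phi0 ?scale0r //; apply/span_seq_mem/map_f.
have := c0 phi lphi; rewrite (linD (contr_linear lphi)) cs addr0 contr_tens phi1.
rewrite scale1r => p0; move: c0; rewrite p0 tens0l add0r; exact: IH.
Qed.

Lemma tens_neq0 (m : M) (n : N) : m != 0 -> n != 0 -> tens m n != 0.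
Proof.
move=> m0 /nonzero_functional [phi lphi phin]; apply: contra_neq m0.
by move=> /(congr1 (contr lphi)); rewrite contr_tens phin scale1r (lin0 (contr_linear _)).
Qed.

End TensorSeparation.

(** * Tensor products of modules *)

Section LeftAction.
Variables (K : fieldType) (L : lieAlgType K).
Implicit Types (M N : lieModule L).

Lemma linear_id (V : lmodType K) : linear (@id V).
Proof. by []. Qed.

(** This is how any element acts that agrees with [x] on [M] and kills the right factors that occur;
    see [lact_decoupled]. *)
Definition lact M (V : lmodType K) (x : L) : tensor M V -> tensor M V :=
  tmap (act_linearr x) (@linear_id V).

Lemma lact_tens M (V : lmodType K) x (m : M) (v : V) :
  lact x (tens m v) = tens (act x m) v.
Proof. exact: tmap_tens. Qed.

Lemma lact_linear M (V : lmodType K) x : linear (@lact M V x).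
Proof. exact: tmap_linear. Qed.

Lemma contr_lact M (V : lmodType K) (phi : V -> K^o) (lphi : linear phi) x
  (u : tensor M V) : contr lphi (lact x u) = act x (contr lphi u).
Proof.
elim/pmod_ind: u => [|[m n]|a u v IHu IHv].
- by rewrite (lin0 (lact_linear x)) (lin0 (contr_linear lphi)) act_linear0.
- by rewrite [lact x _]lact_tens !contr_tens (linZ (act_linearr x)).
- by rewrite lact_linear !contr_linear IHu IHv act_linearr.
Qed.

Definition left_hom M M' (V : lmodType K) (F : M -> tensor M' V) : Prop :=
  linear F /\ forall x m, F (act x m) = lact x (F m).

Lemma left_hom_contr M M' (V : lmodType K) (F : M -> tensor M' V)
  (phi : V -> K^o) (lphi : linear phi) :
  left_hom F -> module_hom (contr lphi \o F).
Proof.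
move=> [lF Fx]; split=> [a u v|x u] /=; first by rewrite lF contr_linear.
by rewrite Fx contr_lact.
Qed.

(** Each contraction of [F] is an endomorphism of [M], hence a scalar c(phi). The vector [v], read
    off at a single [m0], satisfies phi v = c(phi), so [F m] and m (x) v have the same
    contractions. *)
Lemma left_hom_pure M (V : lmodType K) (F : M -> tensor M V) :
  (exists m : M, m != 0) -> schur M -> left_hom F ->
  exists v, forall m, F m = tens m v.
Proof.
move=> [m0 m0n] schM hF; have [lF Fx] := hF.
have [psi lpsi psi1] := nonzero_functional m0n.
pose v := contrl lpsi (F m0); exists v => m.
apply/eqP; rewrite -subr_eq0; apply/eqP/tensor_separated => phi lphi.
have [c hc] := schM _ (left_hom_contr lphi hF).
rewrite (linD (contr_linear lphi)) (linN (contr_linear lphi)) contr_tens.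
have phic : forall u, phi (contrl lpsi u) = psi (contr lphi u).
  elim/pmod_ind=> [|[p q]|a u w IHu IHw].
  - rewrite (lin0 (contr_linear _)) (lin0 (contrl_linear _)).
    by rewrite (lin0 lphi) (lin0 lpsi).
  - rewrite [contrl _ _]contrl_tens [contr _ _]contr_tens (linZ lphi) (linZ lpsi).
    by rewrite /GRing.scale /= mulrC.
  - by rewrite contrl_linear contr_linear lphi lpsi IHu IHw.
have -> : phi v = c.
  by rewrite /v phic [contr _ _]hc (linZ lpsi) psi1 /GRing.scale /= mulr1.
by rewrite [contr _ _]hc subrr.
Qed.

(** If the first coefficients of the sums in [S] over fixed vectors of [V]
    determine these sums, they do so through a [left_hom]; otherwise some nonzero
    sum in [S] is shorter. *)
Lemma left_stable_pure M (V : lmodType K) (S : set (tensor M V)) :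
  irreducible M -> schur M -> subspace S ->
  (forall x u, S u -> S (lact x u)) -> (exists2 u, S u & u != 0) ->
  exists2 v, v != 0 & forall m, S (tens m v).
Proof.
move=> [M0 irrM] schM sS Sx [u Su u0].
have [s us] := tensor_sum_tens u; have [r] := ubnP (size s).
elim: r s u us Su u0 => // r IH [|p s] u us Su u0.
  by rewrite us big_nil eqxx in u0.
rewrite /= ltnS => sr.
pose l := [seq q.2 | q <- s].
pose pair_sum (z : M) (w : nat -> M) :=
  tens z p.2 + \sum_(i < size l) tens (w i) (nth 0 l i).
have psD a z w z' w' :
    pair_sum (a *: z + z') (fun i => a *: w i + w' i)
    = a *: pair_sum z w + pair_sum z' w'.
  rewrite /pair_sum scalerDr scaler_sumr addrACA -tens_linearl; congr (_ + _).
  by rewrite -big_split; apply: eq_bigr => i _; rewrite tens_linearl.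
have psx x z w : pair_sum (act x z) (fun i => act x (w i)) = lact x (pair_sum z w).
  rewrite /pair_sum (linD (lact_linear x)) lact_tens; congr (_ + _).
  rewrite (linear_sum_fun (lact_linear x)).
  by apply: eq_bigr => i _; rewrite lact_tens.
have pu : u = pair_sum p.1 (fun i => (nth (0, 0) s i).1).
  rewrite us big_cons; congr (_ + _); rewrite (big_nth (0, 0)) big_mkord size_map.
  by apply: eq_bigr => i _; rewrite (nth_map (0, 0)).
have small w : S (pair_sum 0 w) -> pair_sum 0 w != 0 ->
    exists2 v, v != 0 & forall m, S (tens m v).
  move=> Sw w0.
  apply: (IH [seq (w i, nth 0 l i) | i <- iota 0 (size l)] (pair_sum 0 w)) => //.
    rewrite /pair_sum tens0l add0r big_map -[in RHS](subn0 (size l)).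
    by rewrite -/(index_iota 0 (size l)) big_mkord.
  by rewrite size_map size_iota size_map.
have sP : submodule [set z | exists w, S (pair_sum z w)].
  split=> [|a z z' [w Sw] [w' Sw']|x z [w Sw]].
  - exists (fun=> 0); rewrite /pair_sum tens0l add0r big1 => [|i _].
      exact: subspace0.
    by rewrite tens0l.
  - exists (fun i => a *: w i + w' i); rewrite psD; case: sS => _; exact.
  - by exists (fun i => act x (w i)); rewrite psx; apply: Sx.
case: (irrM _ sP) => [P0|PT].
  have p10 : p.1 = 0.
    have : [set z | exists w, S (pair_sum z w)] p.1.
      by exists (fun i => (nth (0, 0) s i).1); rewrite -pu.
    by rewrite P0.
  by move: Su u0; rewrite pu p10; apply: small.
have [[w [Sw w0]]|nw] := pselect (exists w, S (pair_sum 0 w) /\ pair_sum 0 w != 0).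
  exact: (small w).
have {}nw w : S (pair_sum 0 w) -> pair_sum 0 w = 0.
  by move=> Sw; apply: contrapT => /eqP w0; apply: nw; exists w.
have ex z : exists w, S (pair_sum z w) by have : [set: M] z by []; rewrite -PT.
have wd z w w' : S (pair_sum z w) -> S (pair_sum z w') -> pair_sum z w = pair_sum z w'.
  move=> Sw Sw'; have e : pair_sum 0 (fun i => - 1 *: w i + w' i) =
      - 1 *: pair_sum z w + pair_sum z w' by rewrite -psD scaleN1r addNr.
  have : pair_sum 0 (fun i => - 1 *: w i + w' i) = 0.
    by apply: nw; rewrite e; case: sS => _; exact.
  by rewrite e scaleN1r => /eqP; rewrite addrC subr_eq0 => /eqP.
(* The coefficients are chosen arbitrarily; by [wd] the sum does not depend on them. *)
pose F z := pair_sum z (proj1_sig (cid (ex z))).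
have FS z : S (F z) by rewrite /F; case: cid.
have Fe z w : S (pair_sum z w) -> F z = pair_sum z w.
  by move=> Sw; rewrite /F; case: cid => w' Sw' /=; apply: wd.
have hF : left_hom F.
  split=> [a z z'|x z].
    rewrite [F z]/F [F z']/F; case: cid => w Sw; case: cid => w' Sw' /=.
    by rewrite -psD; apply: Fe; rewrite psD; case: sS => _; exact.
  rewrite [F z]/F; case: cid => w Sw /=.
  by rewrite -psx; apply: Fe; rewrite psx; apply: Sx.
have [v Fv] := left_hom_pure M0 schM hF.
exists v; last by move=> m; rewrite -Fv.
apply: contra_neq u0 => v0; rewrite pu -(Fe p.1); last by rewrite -pu.
by rewrite Fv v0 tens0r.
Qed.

End LeftAction.

Section TensorModules.
Variables (K : fieldType) (L : lieAlgType K).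
Implicit Types (M N : lieModule L).

(** The finite form of density that interpolation provides. Two pairs of modules occur because a map
    from M (x) N to M' (x) N' has to be tested on source and target with the same [x']. *)
Definition decoupled M M' N N' : Prop :=
  forall (x : L) (s : seq N) (s' : seq N'), exists x' : L,
    [/\ forall m : M, act x' m = act x m, forall m : M', act x' m = act x m,
        forall n, n \in s -> act x' n = 0 & forall n, n \in s' -> act x' n = 0].

Lemma act_tens M N (x : L) (m : M) (n : N) :
  act x (tens m n : tensorModule M N) = tens (act x m) n + tens m (act x n).
Proof. exact: tensor_act_tens. Qed.

Lemma lact_decoupled M N (x x' : L) (s : seq (M * N)) :
  (forall m : M, act x' m = act x m) ->
  (forall n, n \in [seq p.2 | p <- s] -> act x' n = 0) ->
  act x' (\sum_(p <- s) tens p.1 p.2 : tensorModule M N)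
  = lact x (\sum_(p <- s) tens p.1 p.2).
Proof.
move=> xM xN; rewrite (linear_sum_fun (@act_linearr K L (tensorModule M N) x')).
rewrite (linear_sum_fun (lact_linear x)) [LHS]big_seq [RHS]big_seq.
apply: eq_bigr => p ps; rewrite act_tens lact_tens xM xN ?tens0r ?addr0 //.
exact: map_f.
Qed.

(** Elements that kill the right factors make a submodule stable under the action on [M] alone, so
    by [left_stable_pure] it contains M (x) v for some nonzero [v]. Subtracting (x m) (x) n from x
    (m (x) n) shows that the [n] with M (x) n inside it form a submodule of [N], which is then all
    of [N]. *)
Lemma tensor_irreducible M N : irreducible M -> schur M -> irreducible N ->
  decoupled M M N N -> irreducible (tensorModule M N).
Proof.
move=> irrM schM [[n0 n00] irrN] dec; have [[m0 m00] _] := irrM; split.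
  by exists (tens m0 n0); apply: tens_neq0.
move=> S sS; case: (nonzero_submodule sS) => [|[u Su u0]]; [by left|right].
have [S0 Sl Sx] := sS.
have [s us] := tensor_sum_tens u.
pose l := [seq p.2 | p <- s].
pose S' := [set v | S v /\ exists2 t : seq (M * N),
  {subset [seq p.2 | p <- t] <= l} & v = \sum_(p <- t) tens p.1 p.2].
have [|x v [Sv [t tl vt]]||v v0 Sv] := @left_stable_pure K L M N S' irrM schM.
- split; first by split=> //; exists [::]; rewrite ?big_nil.
  move=> a v w [Sv [t tl vt]] [Sw [t' tl' wt]]; split; first exact: Sl.
  exists ([seq (a *: p.1, p.2) | p <- t] ++ t').
    move=> n; rewrite map_cat mem_cat -map_comp => /orP[] //.
      exact: tl.
    exact: tl'.
  rewrite big_cat big_map vt wt scaler_sumr /=; congr (_ + _).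
  by apply: eq_bigr => p _; rewrite (linZ (tens_linearl _)).
- have [x' [xM _ xl _]] := dec x l [::].
  have e : act x' (v : tensorModule M N) = lact x v.
    by rewrite vt; apply: lact_decoupled => // n /tl; apply: xl.
  split; first by rewrite -e; apply: Sx.
  exists [seq (act x p.1, p.2) | p <- t].
    by move=> n; rewrite -map_comp => /tl.
  rewrite vt (linear_sum_fun (lact_linear x)) big_map.
  by apply: eq_bigr => p _; rewrite lact_tens.
- by exists u => //; split=> //; exists s.
have sT : submodule [set n : N | forall m, S (tens m n)].
  split=> [m|a n n' Sn Sn' m|x n Sn m].
  - by rewrite tens0r.
  - by rewrite tens_linearr; apply: Sl.
  - have := Sl (-1) _ _ (Sn (act x m)) (Sx x _ (Sn m)).
    by rewrite act_tens scaleN1r addKr.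
have ST n : forall m, S (tens m n).
  case: (irrN _ sT) => [T0|TT]; last by have : [set: N] n by []; rewrite -TT.
  have : [set n : N | forall m, S (tens m n)] v by move=> m; case: (Sv m).
  by rewrite T0 /= => v00; rewrite v00 eqxx in v0.
apply/seteqP; split=> // w _; elim/pmod_ind: w => [//|[m n]|a w w' ? ?].
  exact: ST.
exact: Sl.
Qed.

Section Hom.
Variables (M M' N N' : lieModule L).
Hypothesis dec : decoupled M M' N N'.
Variable f : tensor M N -> tensor M' N'.
Hypothesis hf : @module_hom K L (tensorModule M N) (tensorModule M' N') f.

(** Only [n] and the finitely many right factors of f (m (x) n) have to be killed, so a single [x']
    acts on the first factor at both ends. *)
Lemma tensor_left_hom n : left_hom (fun m => f (tens m n)).
Proof.
have [lf fx] := hf; split=> [a u v|x m]; first by rewrite tens_linearl lf.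
have [s fs] := tensor_sum_tens (f (tens m n)).
have [x' [xM xM' xN xN']] := dec x [:: n] [seq p.2 | p <- s].
rewrite fs -(lact_decoupled xM' xN') -fs -fx act_tens xM.
by rewrite (xN n) ?tens0r ?addr0 // inE.
Qed.

Lemma tensor_hom_left : (exists u, f u != 0) ->
  exists2 h : M -> M', module_hom h & exists m, h m != 0.
Proof.
have [lf fx] := hf; move=> [u fu].
have [[m [n mn]]|no] := pselect (exists m n, f (tens m n) != 0); last first.
  case/eqP: fu; elim/pmod_ind: u => [|[m n]|a u v IHu IHv].
  - exact: lin0 lf.
  - by apply: contrapT => /eqP mn; apply: no; exists m, n.
  - by rewrite lf IHu IHv scaler0 addr0.
have [phi [lphi phi0]] :
    exists phi : N' -> K^o, exists lphi : linear phi, contr lphi (f (tens m n)) != 0.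
  apply: contrapT => no; case/eqP: mn; apply: tensor_separated => phi lphi.
  by apply: contrapT => /eqP c0; apply: no; exists phi, lphi.
exists (contr lphi \o (fun m => f (tens m n))); last by exists m.
exact: left_hom_contr (tensor_left_hom n).
Qed.

End Hom.

(** [left_hom_pure] yields [psi n] for each [n]. Since y -> m0 (x) y is injective, linearity and
    equivariance of [f] pass to [psi] after cancelling the terms in which [x] acts on [m0]. *)
Lemma tensor_hom_right M N N' (f : tensor M N -> tensor M N') :
  (exists m : M, m != 0) -> schur M -> decoupled M M N N' ->
  @module_hom K L (tensorModule M N) (tensorModule M N') f ->
  exists2 psi : N -> N', module_hom psi & forall m n, f (tens m n) = tens m (psi n).
Proof.
move=> M0 schM dec hf; have [lf fx] := hf; have [m0 m00] := M0.
have ex n := left_hom_pure M0 schM (tensor_left_hom dec hf n).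
pose psi n := proj1_sig (cid (ex n)).
have fpsi m n : f (tens m n) = tens m (psi n) by rewrite /psi; case: cid.
have inj (p q : N') : tens m0 p = tens m0 q -> p = q.
  move=> e; apply/eqP; rewrite -subr_eq0; apply: contraT => pq.
  have := tens_neq0 m00 pq.
  by rewrite (linD (tens_linearr m0)) (linN (tens_linearr m0)) e subrr eqxx.
exists psi => //; split=> [a u v|x n]; apply: inj.
  by rewrite tens_linearr -!fpsi tens_linearr lf.
have := fx x (tens m0 n); rewrite act_tens (linD lf) !fpsi act_tens.
by move/addrI.
Qed.

Lemma tensor_schur M N : (exists m : M, m != 0) -> schur M -> schur N ->
  decoupled M M N N -> schur (tensorModule M N).
Proof.
move=> M0 schM schN dec f hf; have [lf _] := hf.
have [psi hpsi fpsi] := tensor_hom_right M0 schM dec hf.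
have [c hc] := schN _ hpsi; exists c.
elim/pmod_ind=> [|[m n]|a u v IHu IHv].
- by rewrite scaler0 (lin0 lf).
- by rewrite [LHS]fpsi hc (linZ (tens_linearr m)).
- by rewrite lf IHu IHv scalerDr !scalerA mulrC.
Qed.

Lemma tensor_hom_map M M' N N' (f : M -> M') (g : N -> N')
  (hf : module_hom f) (hg : module_hom g) :
  @module_hom K L (tensorModule M N) (tensorModule M' N')
    (tmap (proj1 hf) (proj1 hg)).
Proof.
split=> [|x]; first exact: tmap_linear.
elim/pmod_ind=> [|[m n]|a u v IHu IHv].
- by rewrite (lin0 (tmap_linear _ _)) !act_linear0 (lin0 (tmap_linear _ _)).
- rewrite [act x _]act_tens (linD (tmap_linear _ _)) [tmap _ _ (pgen _ _)]tmap_tens.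
  by rewrite !tmap_tens act_tens (proj2 hf) (proj2 hg).
- by rewrite act_linearr !tmap_linear IHu IHv act_linearr.
Qed.

Lemma tensor_iso M M' N N' : lieModule_iso M M' -> lieModule_iso N N' ->
  lieModule_iso (tensorModule M N) (tensorModule M' N').
Proof.
move=> /hom_of_iso [f [f' [hf hf' fK f'K]]] /hom_of_iso [g [g' [hg hg' gK g'K]]].
apply: (@iso_of_hom K L (tensorModule M N) (tensorModule M' N') _
  (tmap (proj1 hf') (proj1 hg')) (tensor_hom_map hf hg)).
- elim/pmod_ind=> [|[m n]|a u v IHu IHv].
  + by rewrite !(lin0 (tmap_linear _ _)).
  + by rewrite [tmap _ _ (pgen _ _)]tmap_tens tmap_tens fK gK.
  + by rewrite !tmap_linear IHu IHv.
- elim/pmod_ind=> [|[m n]|a u v IHu IHv].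
  + by rewrite !(lin0 (tmap_linear _ _)).
  + by rewrite [tmap _ _ (pgen _ _)]tmap_tens tmap_tens f'K g'K.
  + by rewrite !tmap_linear IHu IHv.
Qed.

Lemma lieModule_iso_trans M N P : lieModule_iso M N -> lieModule_iso N P ->
  lieModule_iso M P.
Proof.
move=> /hom_of_iso [f [f' [[lf fx] hf' fK f'K]]].
move=> /hom_of_iso [g [g' [[lg gx] hg' gK g'K]]].
have hgf : module_hom (g \o f).
  by split=> [a u v|x u] /=; rewrite ?lf ?lg ?fx ?gx.
by apply: (iso_of_hom hgf (g := f' \o g')) => u /=; rewrite ?gK ?fK ?f'K ?g'K.
Qed.

Lemma lieModule_iso_refl M : lieModule_iso M M.
Proof. by apply: (@iso_of_hom K L M M id id). Qed.

(** A nonzero contraction of the isomorphism gives M ~ M'. Once M' is replaced by M, Schur's lemma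
    for [M] alone puts the isomorphism in the form id (x) psi. *)
Lemma tensor_iso_cancel M M' N N' :
  irreducible M -> irreducible M' -> irreducible N -> irreducible N' ->
  schur M -> decoupled M M' N N' -> decoupled M M N N' ->
  lieModule_iso (tensorModule M N) (tensorModule M' N') ->
  lieModule_iso M M' /\ lieModule_iso N N'.
Proof.
move=> irrM irrM' irrN irrN' schM decMM' decM iso.
have [[m0 m00] _] := irrM; have [[n0 n00] _] := irrN.
have inj0 (A B : lieModule L) (f : A -> B) (g : B -> A) : @module_hom K L B A g -> cancel f g ->
    forall u, u != 0 -> f u != 0.
  move=> [lg _] fK u; apply: contra_neq => fu0.
  by rewrite -[u]fK fu0 (lin0 lg).
have isoM : lieModule_iso M M'.
  have [f [g [hf hg fK gK]]] := hom_of_iso iso.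
  have [|h hh h0] := tensor_hom_left decMM' hf.
    by exists (tens m0 n0); apply: (inj0 _ _ _ _ hg fK); apply: tens_neq0.
  exact: iso_of_irreducible hh h0.
split=> //.
have {}iso : lieModule_iso (tensorModule M N) (tensorModule M N').
  apply: lieModule_iso_trans iso _.
  exact: tensor_iso (lieModule_iso_sym isoM) (lieModule_iso_refl N').
have [f [g [hf hg fK gK]]] := hom_of_iso iso.
have [|psi hpsi fpsi] := tensor_hom_right _ schM decM hf; first by exists m0.
apply: iso_of_irreducible hpsi _ => //; exists n0.
have := inj0 _ _ _ _ hg fK _ (tens_neq0 m00 n00); rewrite fpsi.
by apply: contra_neq => ->; rewrite tens0r.
Qed.

End TensorModules.

(** * The induced module M[d] *)

Section HatGenerators.
Variables (K : fieldType) (g : finLieAlgType K).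

Definition hmon (x : g) (k : int) : hat g := (lmon x k, 0).
Definition hcen (c : K) : hat g := (0, c).

Lemma hmon_linear k : linear (hmon^~ k).
Proof. by move=> a x y; congr pair; rewrite /= ?lmon_linear // scaler0 addr0. Qed.

Lemma hcen_linear : linear (hcen : K^o -> hat g).
Proof. by move=> a c d; congr pair; rewrite /= scaler0 addr0. Qed.

Lemma hat_span (P : set (hat g)) : subspace P ->
  (forall x k, P (hmon x k)) -> P (hcen 1) -> forall u, P u.
Proof.
move=> sP Pm Pc [f c].
have -> : (f, c) = (f, 0) + (c : K) *: hcen 1 :> hat g.
  by congr pair; rewrite /= ?scaler0 ?addr0 // add0r /GRing.scale /= mulr1.
apply: subspaceD => //; last exact: subspaceZ.
elim/loop_ind: f => [||a f f' Pf Pf']; [exact: (subspace0 sP)|exact: Pm|].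
have -> : (a *: f + f', 0) = a *: (f, 0) + (f', 0) :> hat g.
  by congr pair; rewrite /= scaler0 addr0.
by case: sP => _; exact.
Qed.

Lemma lie_hcenl c (u : hat g) : lie (hcen c) u = 0.
Proof.
congr pair; first exact: (lin0 (loop_lie_linearl _)).
exact: (lin0 (cocycle_linearl _)).
Qed.

Lemma lie_hcenr c (u : hat g) : lie u (hcen c) = 0.
Proof. by rewrite lieC lie_hcenl oppr0. Qed.

Lemma lie_hmon x y k l : lie (hmon x k) (hmon y l)
  = hmon (lie x y) (k + l) + hcen (if k + l == 0 then k%:~R * killing x y else 0).
Proof.
have -> : lie (hmon x k) (hmon y l)
    = (loop_lie (lmon x k) (lmon y l), cocycle (lmon x k) (lmon y l)) by [].
by rewrite loop_lie_lmon cocycle_lmon; congr pair; rewrite /= ?addr0 ?add0r.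
Qed.

Lemma lie_hmon_neq0 x y k l : k + l != 0 ->
  lie (hmon x k) (hmon y l) = hmon (lie x y) (k + l).
Proof.
move=> /negPf kl; rewrite lie_hmon kl.
by rewrite [hcen 0](lin0 hcen_linear) addr0.
Qed.

Lemma hat_degree_linear : linear (@hat_degree K g).
Proof.
by move=> a u v; congr pair; rewrite /= ?linearP // scaler0 addr0.
Qed.

Lemma hat_degree_hmon x k : hat_degree (hmon x k) = k%:~R *: hmon x k.
Proof. by congr pair; rewrite /= ?degree_lmon // scaler0. Qed.

Lemma hat_degree_hcen c : hat_degree (hcen c) = 0.
Proof. by congr pair; rewrite /= linear0. Qed.

Lemma hat_degree_lie (u v : hat g) :
  hat_degree (lie u v) = lie (hat_degree u) v + lie u (hat_degree v).
Proof.
congr pair; rewrite /=; first exact: degree_lie.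
by rewrite cocycle_degree.
Qed.

Definition hdeg k (u : hat g) : Prop :=
  exists x c, u = hmon x k + hcen c /\ (k != 0 -> c = 0).

Lemma hdeg_hmon x k : hdeg k (hmon x k).
Proof. by exists x, 0; rewrite [hcen 0](lin0 hcen_linear) addr0. Qed.

Lemma hdeg_hcen c : hdeg 0 (hcen c).
Proof. by exists 0, c; rewrite [hmon 0 0](lin0 (hmon_linear _)) add0r. Qed.

Lemma hdeg_lie k l u v : hdeg k u -> hdeg l v -> hdeg (k + l) (lie u v).
Proof.
move=> [x [c [-> _]]] [y [d [-> _]]].
rewrite lieDl !(linD (lie_linearr _)) !(lie_hcenl, lie_hcenr) !addr0 lie_hmon.
by eexists; eexists; split; first by []; move=> /negPf ->.
Qed.

Lemma hat_degree_hdeg k u : hdeg k u -> hat_degree u = k%:~R *: u.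
Proof.
move=> [x [c [-> kc]]]; rewrite (linD hat_degree_linear) hat_degree_hmon.
rewrite hat_degree_hcen addr0 scalerDr; have [->|/kc ->] := eqVneq k 0.
  by rewrite !scale0r addr0.
by rewrite [hcen 0](lin0 hcen_linear) scaler0 addr0.
Qed.

Lemma hdeg_span (P : set (hat g)) : subspace P ->
  (forall k u, hdeg k u -> P u) -> forall u, P u.
Proof.
move=> sP Ph; apply: hat_span => // [x k|].
  exact: Ph (hdeg_hmon _ _).
exact: Ph (hdeg_hcen _).
Qed.

Definition tder : tilde g := (0, 1).

Lemma tilde_span (P : set (tilde g)) : subspace P ->
  (forall k u, hdeg k u -> P (hat_to_tilde u)) -> P tder -> forall u, P u.
Proof.
move=> sP Ph Pd [u b].
have -> : (u, b) = hat_to_tilde u + (b : K) *: tder.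
  by congr pair; rewrite /= ?scaler0 ?addr0 // add0r /GRing.scale /= mulr1.
apply: subspaceD => //; last exact: subspaceZ.
apply: (@hdeg_span [set u | P (hat_to_tilde u)]) => //.
split; first by rewrite /= linear0; apply: subspace0.
by move=> a v w Pv Pw; rewrite /= linearP; case: sP => _; exact.
Qed.

Lemma lie_tderl (u : hat g) : lie tder (hat_to_tilde u) = hat_to_tilde (hat_degree u).
Proof.
have -> : lie tder (hat_to_tilde u) = tilde_lie tder (hat_to_tilde u) by [].
rewrite /tilde_lie /= scale0r subr0 scale1r.
rewrite [loop_lie 0 _](lin0 (loop_lie_linearl _)) add0r.
by rewrite [cocycle 0 _](lin0 (cocycle_linearl _)).
Qed.

End HatGenerators.

(** [int -> M] with [(x t^k F)(z) = x t^k (F (z - k))] and [(d F)(z) = z (F z)];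
    the element [f(d) (x) m] of M[d] is represented by [z |-> f(z) m], and the
    translations of [int] commute with [hat g]. *)
Section FunctionModule.
Variables (K : fieldType) (g : finLieAlgType K) (M : lieModule (hat g)).
Implicit Types (F : int -> M).

Definition shift_loop_gen F (p : g * int) : int -> M :=
  fun z => act (hmon p.1 p.2) (F (z - p.2)).

Lemma shift_loop_rel F u v : loop_rel u v ->
  leval (shift_loop_gen F) u = leval (shift_loop_gen F) v.
Proof.
case=> a x y k /=; apply: funext => z.
by rewrite [RHS]/= /shift_loop_gen /= hmon_linear act_linearl.
Qed.

Definition shift_act (u : hat g) F : int -> M :=
  plift (shift_loop_rel F) u.1 + (fun z => act (hcen g u.2) (F z)).

Lemma shift_act_linearl F : linear (shift_act^~ F).
Proof.
move=> a u v; rewrite /shift_act /= linearP; apply: funext => z.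
rewrite !fctE /= hcen_linear act_linearl.
by rewrite scalerDr addrACA.
Qed.

Lemma shift_act_hdeg k u F z : hdeg k u -> shift_act u F z = act u (F (z - k)).
Proof.
move=> [x [c [-> kc]]]; rewrite (linD (shift_act_linearl F)) addrfctE.
have -> : shift_act (hmon x k) F z = act (hmon x k) (F (z - k)).
  rewrite /shift_act [plift _ _]plift_gen !fctE /shift_loop_gen /=.
  by rewrite [hcen g 0](lin0 (hcen_linear g)) act0l addr0.
rewrite actDl; congr (_ + _).
rewrite /shift_act (linear0 (plift _)) add0r /=.
by have [->|/kc ->] := eqVneq k 0; rewrite ?subr0 // [hcen g 0](lin0 (hcen_linear g)) !act0l.
Qed.

Lemma shift_act_linearr u : linear (shift_act u).
Proof.
move=> a F G; pose P := [set u | shift_act u (a *: F + G) = a *: shift_act u F + shift_act u G].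
suff: P u by []; move: u; apply: hdeg_span => [|k u uk].
  split; first by rewrite /P /= !(lin0 (shift_act_linearl _)) scaler0 addr0.
  move=> b u v Pu Pv; rewrite /P /= !shift_act_linearl Pu Pv.
  by rewrite !scalerDr !scalerA mulrC addrACA.
by apply: funext => z; rewrite !fctE !(shift_act_hdeg _ _ uk) act_linearr.
Qed.

Definition fun_act (u : tilde g) F : int -> M :=
  shift_act u.1 F + (u.2 : K) *: (fun z => z%:~R *: F z).

Lemma fun_act_linearl F : linear (fun_act^~ F).
Proof.
move=> a u v; rewrite /fun_act /= shift_act_linearl scalerDl [in RHS]scalerDr.
by rewrite scalerA addrACA.
Qed.

Lemma fun_act_linearr u : linear (fun_act u).
Proof.
move=> a F G; rewrite /fun_act shift_act_linearr [in RHS]scalerDr addrACA; congr (_ + _).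
apply: funext => z; rewrite !fctE !scalerDr !scalerA.
by rewrite [_ * a]mulrC !mulrA.
Qed.

Lemma fun_act_hat u F : fun_act (hat_to_tilde u) F = shift_act u F.
Proof. by rewrite /fun_act /= scale0r addr0. Qed.

Lemma fun_act_der F : fun_act (tder g) F = fun z => z%:~R *: F z.
Proof.
by rewrite /fun_act /= (lin0 (shift_act_linearl _)) scale1r add0r.
Qed.

Lemma fun_act_lie u v F :
  fun_act (lie u v) F = fun_act u (fun_act v F) - fun_act v (fun_act u F).
Proof.
pose P u v := fun_act (lie u v) F = fun_act u (fun_act v F) - fun_act v (fun_act u F).
have sl w : subspace [set u | P u w].
  split=> [|a p q]; rewrite /P /= ?lie0l ?lieZl.
    by rewrite !(lin0 (fun_act_linearl _)) (lin0 (fun_act_linearr _)) subrr.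
  rewrite lie_linearl !fun_act_linearl fun_act_linearr => -> ->.
  move: (fun_act p (fun_act w F)) (fun_act w (fun_act p F)) => A B.
  move: (fun_act q (fun_act w F)) (fun_act w (fun_act q F)) => C E.
  by rewrite scalerBr addrACA opprD.
have sr w : subspace [set u | P w u].
  split=> [|a p q]; rewrite /P /= ?(lin0 (lie_linearr _)).
    by rewrite !(lin0 (fun_act_linearl _)) (lin0 (fun_act_linearr _)) subrr.
  rewrite lie_linearr !fun_act_linearl fun_act_linearr => -> ->.
  move: (fun_act p (fun_act w F)) (fun_act w (fun_act p F)) => A B.
  move: (fun_act q (fun_act w F)) (fun_act w (fun_act q F)) => C E.
  by rewrite scalerBr addrACA opprD.
have dh k w : hdeg k w -> P (tder g) (hat_to_tilde w).
  move=> wk; rewrite /P lie_tderl !fun_act_hat !fun_act_der (hat_degree_hdeg wk).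
  rewrite (linZ (shift_act_linearl F)); apply: funext => z.
  rewrite !fctE !(shift_act_hdeg _ _ wk) (linZ (act_linearr w)) -scalerBl -intrB.
  by rewrite subKr.
have Psym p q : P p q -> P q p.
  rewrite /P => e; rewrite lieC (linN (fun_act_linearl F)) e opprB //.
move: u; apply: (tilde_span (sl v)) => [k u uk|]; move: v.
- apply: (tilde_span (sr _)) => [l v vl|]; last by apply: Psym; apply: dh uk.
  rewrite /P /= -(lieHom_lie (hat_tilde g)) !fun_act_hat; apply: funext => z.
  rewrite !fctE (shift_act_hdeg _ _ (hdeg_lie uk vl)) (shift_act_hdeg _ _ uk).
  rewrite (shift_act_hdeg _ _ vl) (shift_act_hdeg _ _ vl) (shift_act_hdeg _ _ uk).
  by rewrite act_lie opprD addrA [_ - l - k]addrAC.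
- apply: (tilde_span (sr _)) => [l v vl|]; first exact: dh vl.
  by rewrite /P /= liexx (lin0 (fun_act_linearl _)) subrr.
Qed.

Definition funModule : lieModule (tilde g) :=
  LieModule fun_act_linearl fun_act_linearr fun_act_lie.

Definition fdiff F : int -> M := fun z => F (z + 1) - F z.

Lemma fdiff_linear : linear fdiff.
Proof.
move=> a F G; apply: funext => z; rewrite !fctE /fdiff scalerBr.
by rewrite opprD addrACA.
Qed.

Lemma fdiff_shift_act u F : fdiff (shift_act u F) = shift_act u (fdiff F).
Proof.
pose P := [set u | fdiff (shift_act u F) = shift_act u (fdiff F)].
suff: P u by []; move: u; apply: hdeg_span => [|k u uk].
  split; first by rewrite /P /= !(lin0 (shift_act_linearl _)) (lin0 fdiff_linear).
  by move=> b u v Pu Pv; rewrite /P /= !shift_act_linearl fdiff_linear Pu Pv.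
apply: funext => z; rewrite /fdiff !(shift_act_hdeg _ _ uk).
by rewrite (linD (act_linearr u)) (linN (act_linearr u)) addrAC.
Qed.

Lemma iter_fdiff_linear n : linear (iter n fdiff).
Proof. by elim: n => [//|n IH] a F G; rewrite [LHS]/= IH fdiff_linear. Qed.

Lemma iter_fdiff_shift_act n u F :
  iter n fdiff (shift_act u F) = shift_act u (iter n fdiff F).
Proof. by elim: n => //= n ->; rewrite fdiff_shift_act. Qed.

Lemma iter_fdiff0 p q F : (p <= q)%N -> iter p fdiff F = 0 -> iter q fdiff F = 0.
Proof.
by move=> /subnK <- e; rewrite iterD e; apply: lin0 (iter_fdiff_linear _).
Qed.

(** Leibniz rule: the difference of z F is z times the difference of F plus a translate of F.
    Multiplication by z thus behaves like raising the degree of a polynomial by one. *)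
Lemma iter_fdiff_der n F : iter n fdiff F = 0 ->
  iter n.+1 fdiff (fun z => z%:~R *: F z) = 0.
Proof.
have dd G : fdiff (fun z => z%:~R *: G z) = (fun z => z%:~R *: fdiff G z) + (fun z => G (z + 1)).
  apply: funext => z; rewrite !fctE /fdiff intrD scalerDl scale1r scalerBr.
  by rewrite addrAC.
have ds k G : iter k fdiff (fun z => G (z + 1)) = (fun z => iter k fdiff G (z + 1)).
  elim: k => //= k ->; apply: funext => z; by rewrite /fdiff.
elim: n F => [|n IH] F e.
  rewrite /= in e *; rewrite e dd; apply: funext => z.
  by rewrite !fctE /fdiff subrr scaler0 addr0.
rewrite iterSr dd (linD (iter_fdiff_linear _)) IH ?add0r; last by rewrite -iterSr.
by rewrite ds e.
Qed.

Definition fconst (m : M) : int -> M := fun=> m.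

Lemma shift_act_const u m : shift_act u (fconst m) = fconst (act u m).
Proof.
pose P := [set u | shift_act u (fconst m) = fconst (act u m)].
suff: P u by []; move: u; apply: hdeg_span => [|k u uk].
  by split=> [|b u v Pu Pv]; rewrite /P /= ?(lin0 (shift_act_linearl _)) ?act0l //
    shift_act_linearl Pu Pv act_linearl.
by apply: funext => z; rewrite (shift_act_hdeg _ _ uk).
Qed.

End FunctionModule.

Section EnvelopingModule.
Variables (K : fieldType) (L : lieAlgType K).

Lemma uact_submodule (P : lieModule L) (S : set P) p (u : uea L) :
  submodule S -> S p -> S (uact u p).
Proof.
move=> [S0 Sl Sx]; elim/uea_ind: u p => [||x|a u v IHu IHv|u v IHu IHv] p Sp.
- by rewrite (lin0 (uact_linearl p)).
- by rewrite uact1.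
- by rewrite uact_gen; apply: Sx.
- by rewrite (uact_linearl p); apply: Sl; [apply: IHu|apply: IHv].
- by rewrite uactM; apply/IHu/IHv.
Qed.

Lemma uact_hom (P Q : lieModule L) (f : P -> Q) u p :
  module_hom f -> f (uact u p) = uact u (f p).
Proof.
move=> [lf fx]; elim/uea_ind: u p => [||x|a u v IHu IHv|u v IHu IHv] p.
- by rewrite !(lin0 (uact_linearl _)) (lin0 lf).
- by rewrite !uact1.
- by rewrite !uact_gen.
- by rewrite !uact_linearl lf IHu IHv.
- by rewrite !uactM IHu IHv.
Qed.

End EnvelopingModule.

(** * Comparison of M[d] with functions on the integers *)

Section Dind.
Variables (K : fieldType) (g : finLieAlgType K).
Implicit Types (M N : lieModule (hat g)).

Lemma uact_itens M (u w : uea (tilde g)) (m : M) :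
  uact u (itens (hat_tilde g) w m : dind M) = itens (hat_tilde g) (u * w) m.
Proof.
elim/uea_ind: u w => [||x|a u v IHu IHv|u v IHu IHv] w.
- by rewrite (lin0 (uact_linearl _)) mul0r (lin0 (itens_linearl _ m)).
- by rewrite uact1 mul1r.
- by rewrite uact_gen; apply: induced_act_itens.
- by rewrite uact_linearl IHu IHv mulrDl -scalerAl itens_linearl.
- by rewrite uactM IHv IHu mulrA.
Qed.

Lemma dind_act_hat M x (m : M) :
  act (hat_to_tilde x) (itens (hat_tilde g) 1 m : dind M)
  = itens (hat_tilde g) 1 (act x m).
Proof.
rewrite [LHS]induced_act_itens mulr1 -(umap_gen (hat_tilde g)).
by rewrite -[umap _ _]mul1r itens_bal uact_gen.
Qed.

(** The element 1 (x) m goes to the constant function m, and [tilde g]-linearity dictates the rest.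
    Balancing holds because constant functions form a copy of M under [hat g]. *)
Definition dind_fun_gen M (p : uea (tilde g) * M) : funModule M :=
  uact p.1 (fconst p.2 : funModule M).

Lemma dind_fun_rel M u v : induced_rel (hat_tilde g) u v ->
  leval (@dind_fun_gen M) u = leval (@dind_fun_gen M) v.
Proof.
case=> [a {}u {}v m|{}u a m n|{}u w m]; rewrite /= /dind_fun_gen /=.
- exact: (uact_linearl (fconst m : funModule M) a u v).
- exact: (@uact_linearr _ _ (funModule M) u a (fconst m) (fconst n)).
rewrite uactM; suff -> : uact (umap (hat_tilde g) w) (fconst m : funModule M)
  = fconst (uact w m) by [].
elim/uea_ind: w m => [||x|a w w' IHw IHw'|w w' IHw IHw'] m.
- by rewrite (lin0 (umap_linear _)) !(lin0 (uact_linearl _)).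
- by rewrite umap1 !uact1.
- by rewrite umap_gen !uact_gen [LHS]fun_act_hat shift_act_const.
- by rewrite umap_linear !uact_linearl IHw IHw'.
- by rewrite umapM !uactM IHw' IHw.
Qed.

Definition dind_fun M : dind M -> funModule M := plift (@dind_fun_rel M).

Lemma dind_fun_itens M u (m : M) :
  dind_fun (itens (hat_tilde g) u m) = uact u (fconst m : funModule M).
Proof. exact: plift_gen. Qed.

Lemma dind_fun_hom M : module_hom (@dind_fun M).
Proof.
split=> [|x]; first exact: linearP.
elim/pmod_ind=> [|[u m]|a p q IHp IHq].
- by rewrite act_linear0 /dind_fun linear0 act_linear0.
- rewrite [act x _]induced_act_itens !dind_fun_itens.
  by rewrite uactM uact_gen.
- have lf : linear (@dind_fun M) by exact: linearP.
  by rewrite act_linearr !lf IHp IHq act_linearr.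
Qed.

(** The values are polynomial in z: functions killed by some power of [fdiff] form a
    [tilde g]-submodule, and it contains the constants. *)
Lemma dind_fun_nilpotent M (q : dind M) : exists n, iter n (@fdiff K g M) (dind_fun q) = 0.
Proof.
pose S := [set F : funModule M | exists n, iter n (@fdiff K g M) F = 0].
have sub : subspace S.
  split=> [|a F G [p Fp] [r Gr]]; first by exists 0%N.
  exists (maxn p r); rewrite iter_fdiff_linear (iter_fdiff0 (leq_maxl _ _) Fp).
  by rewrite (iter_fdiff0 (leq_maxr _ _) Gr) scaler0 addr0.
have sS : submodule S.
  split; [exact: subspace0|by case: sub|move=> x F [p Fp]].
  rewrite [act x F]/act /= /fun_act; apply: subspaceD => //.
    exists p; rewrite iter_fdiff_shift_act Fp; exact: (lin0 (shift_act_linearr _)).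
  by apply: subspaceZ => //; exists p.+1; apply: iter_fdiff_der.
suff: S (dind_fun q) by [].
elim/pmod_ind: q => [|[u m]|a p q IHp IHq].
- by rewrite /dind_fun linear0; apply: subspace0.
- rewrite [dind_fun _]dind_fun_itens; apply: uact_submodule => //.
  by exists 1%N; apply: funext => z; rewrite /= /fdiff subrr.
- by rewrite (proj1 (dind_fun_hom M)); case: sub => _; exact.
Qed.

Lemma dind_iso_irreducible M N : irreducible M -> irreducible N ->
  lieModule_iso (dind M) (dind N) -> lieModule_iso M N.
Proof.
move=> irrM irrN /hom_of_iso [f [f' [hf hf' fK f'K]]].
have hG : module_hom (@dind_fun N \o f).
  have [lf fx] := hf; have [ld dx] := dind_fun_hom N.
  by split=> [a u v|x u]; rewrite /= ?lf ?ld ?fx ?dx.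
pose th (m : M) : int -> N := dind_fun (f (itens (hat_tilde g) 1 m)).
have lth : linear th.
  by move=> a m n; rewrite /th itens_linearr (proj1 hf) (proj1 (dind_fun_hom N)).
have thx x m : th (act x m) = shift_act x (th m).
  rewrite /th -dind_act_hat (proj2 hf) (proj2 (dind_fun_hom N)).
  exact: fun_act_hat.
(* The elements 1 (x) m generate M[d], so otherwise [dind_fun] would vanish on the image of [f],
   which is everything; but it sends 1 (x) n0 to the constant n0. *)
have [m0 m00] : exists m, th m <> 0.
  apply: contrapT => no; have [[n0 n00] _] := irrN.
  have z (q : dind M) : dind_fun (f q) = 0.
    elim/pmod_ind: q => [|[u m]|a p q IHp IHq]; first exact: (lin0 (proj1 hG)).
      have -> : pgen _ (u, m) = uact u (itens (hat_tilde g) 1 m : dind M).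
        by rewrite uact_itens mulr1.
      rewrite [LHS](uact_hom u _ hG) /= -/(th m).
      have -> : th m = 0 by apply: contrapT => m0; apply: no; exists m.
      exact: (lin0 (@uact_linearr _ _ (funModule N) u)).
    by rewrite (proj1 hf) (proj1 (dind_fun_hom N)) IHp IHq scaler0 addr0.
  have := z (f' (itens (hat_tilde g) 1 n0)); rewrite f'K dind_fun_itens uact1.
  by move=> /(congr1 (fun F => F 0)) /= n0E; rewrite [n0]n0E eqxx in n00.
pose D := @fdiff K g N.
have ex : exists n, `[< iter n D (th m0) = 0 >].
  by have [n hn] := dind_fun_nilpotent (f (itens (hat_tilde g) 1 m0)); exists n; apply/asboolP.
have [[|n] /asboolP n0 nmin] := ex_minnP ex; first by case: m00.
have n1 : iter n D (th m0) <> 0.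
  by move=> e; have := nmin n; rewrite ltnn => /(_ (asboolT e)).
(* The order found at [m0] is uniform: the vectors whose difference of order n + 1 vanishes form a
   submodule of the irreducible [M], and [m0] lies in it. *)
have all0 m : iter n.+1 D (th m) = 0.
  have sk : submodule [set m | iter n.+1 D (th m) = 0].
    split=> [|a u v|x u u0].
    - by rewrite /mkset (lin0 lth); apply: (lin0 (@iter_fdiff_linear K g N n.+1)).
    - by rewrite /mkset => u0 v0; rewrite lth [LHS](@iter_fdiff_linear K g N n.+1) u0 v0 scaler0 addr0.
    - rewrite /mkset thx iter_fdiff_shift_act -/D u0.
      exact: (lin0 (shift_act_linearr _)).
  case: (irrM.2 _ sk) => [k0|kT]; last by have : [set: M] m by []; rewrite -kT.
  have : [set m | iter n.+1 D (th m) = 0] m0 by [].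
  by rewrite k0 /= => e; case: m00; rewrite e (lin0 lth).
pose h m := iter n D (th m) 0.
have hc m : iter n D (th m) = fconst (h m).
  have st z : iter n D (th m) (z + 1) = iter n D (th m) z.
    have /(congr1 (fun F => F z)) /eqP := all0 m.
    by rewrite [iter n.+1 D _]iterS /D /fdiff subr_eq0 => /eqP.
  apply: funext => z; rewrite /fconst /h; elim/int_ind: z => // k IH.
    by rewrite -addn1 PoszD st IH.
  by rewrite -IH -(st (- k.+1%:Z)) -addn1 PoszD opprD subrK.
apply: (iso_of_irreducible irrM irrN (f := h)).
  split=> [a u v|x u]; first by rewrite /h lth iter_fdiff_linear.
  by rewrite {1}/h thx iter_fdiff_shift_act -/D hc shift_act_const.
by exists m0; apply/eqP => e; apply: n1; rewrite hc e.
Qed.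

Lemma dind_iso M N : lieModule_iso M N -> lieModule_iso (dind M) (dind N).
Proof.
move=> /hom_of_iso [f [f' [hf hf' fK f'K]]].
have rel (P Q : lieModule (hat g)) (h : P -> Q) : module_hom h ->
    forall u v, induced_rel (hat_tilde g) u v ->
    leval (fun p : uea (tilde g) * P => itens (hat_tilde g) p.1 (h p.2)) u
    = leval (fun p => itens (hat_tilde g) p.1 (h p.2)) v.
  move=> hh u v; case=> [a {}u {}v m|{}u a m n|{}u w m] /=.
  - exact: itens_linearl.
  - by rewrite (proj1 hh) itens_linearr.
  - by rewrite itens_bal (uact_hom _ _ hh).
have mapE (P Q : lieModule (hat g)) (h : P -> Q) (hh : module_hom h) u m :
    plift (rel _ _ _ hh) (itens (hat_tilde g) u m) = itens (hat_tilde g) u (h m).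
  exact: plift_gen.
have can (P Q : lieModule (hat g)) (h : P -> Q) (h' : Q -> P) (hh : module_hom h) (hh' : module_hom h') :
    cancel h h' -> cancel (plift (rel _ _ _ hh)) (plift (rel _ _ _ hh')).
  move=> hK; elim/pmod_ind=> [|[u m]|a p q IHp IHq]; rewrite ?linear0 //.
    by rewrite [plift _ (pgen _ _)]mapE mapE hK.
  have l1 : linear (plift (rel _ _ _ hh)) by exact: linearP.
  have l2 : linear (plift (rel _ _ _ hh')) by exact: linearP.
  by rewrite l1 l2 IHp IHq.
apply: (@iso_of_hom _ _ (dind M) (dind N) (plift (rel _ _ _ hf)) (plift (rel _ _ _ hf'))).
- split=> [|x]; first exact: linearP.
  elim/pmod_ind=> [|[u m]|a p q IHp IHq].
  + by rewrite act_linear0 linear0 act_linear0.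
  + rewrite [act x _]induced_act_itens mapE [plift _ _]mapE.
    by rewrite [RHS]induced_act_itens.
  + have lf : linear (plift (rel _ _ _ hf)) by exact: linearP.
    by rewrite act_linearr !lf IHp IHq act_linearr.
- exact: can fK.
- exact: can f'K.
Qed.

End Dind.

(** * Evaluation modules *)

Section LoopPoly.
Variables (K : fieldType) (g : finLieAlgType K).

Definition loop_poly_gen (p : {poly K}) (q : g * int) : loop g :=
  \sum_(i < size p) p`_i *: lmon q.1 (q.2 + i%:Z).

Lemma loop_poly_rel p u v : loop_rel u v ->
  leval (loop_poly_gen p) u = leval (loop_poly_gen p) v.
Proof.
case=> a x y k /=; rewrite /loop_poly_gen scaler_sumr -big_split /=.
by apply: eq_bigr => i _; rewrite lmon_linear scalerDr !scalerA mulrC.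
Qed.

(** The operator [f |-> p(t) f]. *)
Definition loop_poly p : loop g -> loop g := plift (loop_poly_rel p).

Lemma loop_poly_linear p : linear (loop_poly p).
Proof. exact: linearP. Qed.

Lemma loop_poly_lmon p x k :
  loop_poly p (lmon x k) = \sum_(i < size p) p`_i *: lmon x (k + i%:Z).
Proof. exact: plift_gen. Qed.

Lemma ev_loop_poly p c f : c != 0 -> ev c (loop_poly p f) = p.[c] *: ev c f.
Proof.
move=> c0; elim/loop_ind: f => [|x k|b f f' IHf IHf'].
- by rewrite (lin0 (loop_poly_linear p)) (lin0 (ev_linear c)) scaler0.
- rewrite loop_poly_lmon (linear_sum_fun (@ev_linear K g c)) ev_lmon horner_coef.
  rewrite scalerA mulr_suml scaler_suml; apply: eq_bigr => i _.
  rewrite (linZ (ev_linear c)) ev_lmon scalerA expfzDr //.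
  by rewrite -mulrA [c ^ k * _]mulrC.
- by rewrite loop_poly_linear !ev_linear IHf IHf' scalerDr !scalerA mulrC.
Qed.

Lemma poly_delta (s : seq K) c : c \notin s ->
  exists p : {poly K}, p.[c] = 1 /\ forall d, d \in s -> p.[d] = 0.
Proof.
move=> cs; pose q : {poly K} := \prod_(d <- s) ('X - d%:P).
have rq d : root q d = (d \in s) by rewrite root_prod_XsubC.
exists (q.[c]^-1 *: q); split=> [|d]; rewrite hornerZ.
  by rewrite mulVf // -/(root q c) rq.
by rewrite -rq => /rootP ->; rewrite mulr0.
Qed.

(** With q equal to 1 at 0 and to 0 on [s], the polynomial 1 - q is divisible by X and equals 1 on
    [s]; its power J serves. Multiplying a loop by it keeps the values at [s] and removes all low
    powers of t. *)
Lemma poly_one (s : seq K) J : (forall c, c \in s -> c != 0) ->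
  exists p : {poly K}, 'X^J %| p /\ forall c, c \in s -> p.[c] = 1.
Proof.
move=> s0; have [|q [q1 qs]] := @poly_delta s 0.
  by apply/negP => /s0; rewrite eqxx.
exists ((1 - q) ^+ J); split=> [|c cs].
  apply: dvdp_exp2r; rewrite -['X]subr0 -[0]polyC0 dvdp_XsubCl.
  by apply/rootP; rewrite hornerD hornerN hornerC q1 subrr.
by rewrite horner_exp hornerD hornerN hornerC qs // subr0 expr1n.
Qed.

Definition smooth (N : lieModule (hat g)) : Prop :=
  forall n : N, exists R : nat, forall (x : g) (k : nat), (R <= k)%N ->
    act (hmon x k%:Z) n = 0.

Lemma smooth_seq (N : lieModule (hat g)) (s : seq N) : smooth N -> exists R : nat,
  forall n, n \in s -> forall (x : g) (k : nat), (R <= k)%N -> act (hmon x k%:Z) n = 0.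
Proof.
move=> smN; elim: s => [|n s [R IH]]; first by exists 0%N.
have [R' hR'] := smN n; exists (maxn R R') => m.
rewrite inE => /orP[/eqP ->|ms] x k; rewrite geq_max => /andP[Rk R'k].
  exact: hR'.
exact: IH.
Qed.

Lemma smooth_loop_poly (N : lieModule (hat g)) (s : seq N) (f : loop g) : smooth N -> exists J : nat,
  forall p : {poly K}, 'X^J %| p -> forall n, n \in s ->
    act ((loop_poly p f, 0) : hat g) n = 0.
Proof.
move=> smN; have [R hR] := smooth_seq s smN.
have lh p (n : N) : linear (fun f => act ((loop_poly p f, 0) : hat g) n).
  move=> a u v; rewrite -act_linearl; congr act; congr pair => /=.
    by rewrite loop_poly_linear.
  by rewrite scaler0 addr0.
elim/loop_ind: f => [|x k|a f f' [J hJ] [J' hJ']].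
- by exists 0%N => p _ n _; apply: lin0 (lh p n).
(* The summand [|k|] offsets a negative power of t: from the index R + |k| on, k + i is a natural
   number at least [R]. *)
- exists (R + `|k|)%N => p /dvdpP [q ->] n ns.
  rewrite loop_poly_lmon.
  have -> : (\sum_(i < size (q * 'X^(R + `|k|))) (q * 'X^(R + `|k|))`_i *: lmon x (k + i%:Z), 0)
      = \sum_(i < size (q * 'X^(R + `|k|))) (q * 'X^(R + `|k|))`_i *: hmon x (k + i%:Z) :> hat g.
    elim/big_rec2: _ => // i y z _ <-.
    by congr pair; rewrite /= scaler0 add0r.
  rewrite (linear_sum_fun (act_linearl n)) big1 // => i _.
  rewrite actZl coefMXn; case: ltnP => [_|Ri]; first by rewrite scale0r.
  have [j kj] : exists j : nat, k + i%:Z = j%:Z by exists (absz (k + i%:Z)%R); lia.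
  by rewrite kj hR ?scaler0 //; lia.
- exists (maxn J J') => p Jp n ns; rewrite (lh p n).
  rewrite hJ ?hJ' ?scaler0 ?addr0 //; apply: dvdp_trans Jp; apply: dvdp_exp2l.
    exact: leq_maxr.
  exact: leq_maxl.
Qed.

End LoopPoly.

(** * Splitting the first factor off a multiple tensor product *)

Section MultitensorSplit.
Variables (K : fieldType) (n : nat) (M : 'I_n.+1 -> lmodType K).
Let T (j : 'I_n) : lmodType K := M (lift ord0 j).

Definition dtail (v : forall i, M i) : forall j, T j := fun j => v (lift ord0 j).

(** The type of the value depends on the index, so the case analysis on [unliftP] leaves casts; the
    lemmas below remove them by uniqueness of equality proofs on ordinals. *)
Definition dcons (x : M ord0) (w : forall j, T j) : forall i, M i.
Proof. by move=> i; case: (unliftP ord0 i) => [j ->|->]; [exact: w|exact: x]. Defined.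

Lemma dcons0 x w : dcons x w ord0 = x.
Proof.
rewrite /dcons; case: (unliftP ord0 ord0) => [j|] e; last first.
  by rewrite (eq_irrelevance e (erefl _)).
by exfalso; have := neq_lift ord0 j; rewrite -e eqxx.
Qed.

Lemma dcons_lift x w j : dcons x w (lift ord0 j) = w j.
Proof.
rewrite /dcons; case: (unliftP ord0 (lift ord0 j)) => [k|] e; last first.
  by exfalso; have := neq_lift ord0 j; rewrite e eqxx.
have kj : j = k by apply: lift_inj e.
by move: e; rewrite -kj => e; rewrite (eq_irrelevance e (erefl _)).
Qed.

Lemma dcons_eq x w (v : forall i, M i) :
  v ord0 = x -> (forall j, v (lift ord0 j) = w j) -> dcons x w = v.
Proof.
move=> v0 vl; apply: functional_extensionality_dep => i.
by case: (unliftP ord0 i) => [j ->|->]; rewrite ?dcons0 ?dcons_lift.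
Qed.

Lemma dtail_cons x w : dtail (dcons x w) = w.
Proof. by apply: functional_extensionality_dep => j; apply: dcons_lift. Qed.

Lemma dcons_tail (v : forall i, M i) : dcons (v ord0) (dtail v) = v.
Proof. exact: dcons_eq. Qed.

Lemma dtail_with_lift (v : forall i, M i) j (x : T j) :
  dtail (dfwith v (x : M (lift ord0 j))) = dfwith (dtail v) x.
Proof.
apply: functional_extensionality_dep => k; rewrite /dtail.
have [<-|jk] := eqVneq j k; first by rewrite !dfwith_in.
by rewrite !dfwith_out // (inj_eq lift_inj).
Qed.

Lemma dtail_with0 (v : forall i, M i) (x : M ord0) : dtail (dfwith v x) = dtail v.
Proof.
by apply: functional_extensionality_dep => k; rewrite /dtail dfwith_out ?neq_lift.
Qed.

Definition msplit_gen (v : forall i, M i) : tensor (M ord0) (multitensor T) :=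
  tens (v ord0) (mtens (dtail v)).

Lemma msplit_rel u v : multitensor_rel u v ->
  leval msplit_gen u = leval msplit_gen v.
Proof.
case=> {}v i a x y /=; rewrite /msplit_gen.
case: (unliftP ord0 i) x y => [j ->|->] x y.
  rewrite !dtail_with_lift !dfwith_out 1?eq_sym ?neq_lift //.
  by rewrite (mtens_linear (M := T)) tens_linearr.
by rewrite !dtail_with0 !dfwith_in tens_linearl.
Qed.

Definition msplit : multitensor M -> tensor (M ord0) (multitensor T) :=
  plift msplit_rel.

Lemma msplit_mtens (v : forall i, M i) : msplit (mtens v) = tens (v ord0) (mtens (dtail v)).
Proof. exact: plift_gen. Qed.

Lemma mjoin_rel0 x u v : multitensor_rel (M := T) u v ->
  leval (fun w => mtens (dcons x w)) u = leval (fun w => mtens (dcons x w)) v.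
Proof.
case=> {}v j a p q /=.
have e (z : T j) : dcons x (dfwith v z) = dfwith (dcons x v) (z : M (lift ord0 j)).
  apply: dcons_eq; first by rewrite dfwith_out ?dcons0 // eq_sym neq_lift.
  move=> k; have [<-|jk] := eqVneq j k; first by rewrite !dfwith_in.
  by rewrite !dfwith_out ?dcons_lift // (inj_eq lift_inj).
by rewrite !e mtens_linear.
Qed.

Definition mjoin0 x : multitensor T -> multitensor M := plift (mjoin_rel0 x).

Lemma mjoin0_mtens x w : mjoin0 x (mtens w) = mtens (dcons x w).
Proof. exact: plift_gen. Qed.

Lemma mjoin0_linear x : linear (mjoin0 x).
Proof. exact: linearP. Qed.

Lemma mjoin0_linearl t : linear (mjoin0^~ t).
Proof.
move=> a x y; elim/pmod_ind: t => [|w|b u v IHu IHv].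
- by rewrite !(lin0 (mjoin0_linear _)) scaler0 addr0.
- rewrite !mjoin0_mtens.
  have e z : dcons z w = dfwith (dcons x w) (z : M ord0).
    apply: dcons_eq; first by rewrite dfwith_in.
    by move=> j; rewrite dfwith_out ?neq_lift // dcons_lift.
  by rewrite (e (a *: x + y)) (e y) mtens_linear -(e x).
- by rewrite !mjoin0_linear IHu IHv !scalerDr !scalerA mulrC addrACA.
Qed.

Lemma mjoin_rel u v : tensor_rel u v ->
  leval (fun p : M ord0 * multitensor T => mjoin0 p.1 p.2) u
  = leval (fun p => mjoin0 p.1 p.2) v.
Proof.
case=> [a x y t|x a t t'] /=; [exact: mjoin0_linearl|exact: mjoin0_linear].
Qed.

Definition mjoin : tensor (M ord0) (multitensor T) -> multitensor M :=
  plift mjoin_rel.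

Lemma mjoin_tens x w : mjoin (tens x (mtens w)) = mtens (dcons x w).
Proof. by rewrite -mjoin0_mtens; apply: plift_gen. Qed.

Lemma msplit_linear : linear msplit.
Proof. exact: linearP. Qed.

Lemma mjoin_linear : linear mjoin.
Proof. exact: linearP. Qed.

Lemma msplitK : cancel msplit mjoin.
Proof.
elim/pmod_ind=> [|v|a u v IHu IHv].
- by rewrite (lin0 msplit_linear) (lin0 mjoin_linear).
- by rewrite msplit_mtens mjoin_tens dcons_tail.
- by rewrite msplit_linear mjoin_linear IHu IHv.
Qed.

Lemma mjoinK : cancel mjoin msplit.
Proof.
elim/pmod_ind=> [|[x t]|a u v IHu IHv].
- by rewrite (lin0 mjoin_linear) (lin0 msplit_linear).
- change (msplit (mjoin (tens x t)) = tens x t).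
  elim/pmod_ind: t => [|w|a u v IHu IHv].
  + by rewrite tens0r (lin0 mjoin_linear) (lin0 msplit_linear).
  + by rewrite mjoin_tens msplit_mtens dcons0 dtail_cons.
  + by rewrite tens_linearr mjoin_linear msplit_linear IHu IHv.
- by rewrite mjoin_linear msplit_linear IHu IHv.
Qed.

End MultitensorSplit.

(** * Irreducibility and Schur's lemma for evaluation tensor products *)

Section EvaluationTensor.
Variables (K : fieldType) (g : finLieAlgType K).

Lemma multitensor_split_iso (n : nat) (L : lieAlgType K) (M : 'I_n.+1 -> lieModule L) :
  lieModule_iso (multitensorModule M)
    (tensorModule (M ord0) (multitensorModule (fun j => M (lift ord0 j)))).
Proof.
pose M' i : lmodType K := M i.
apply: (@iso_of_hom _ _ (multitensorModule M)
  (tensorModule (M ord0) (multitensorModule (fun j => M (lift ord0 j))))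
  (@msplit _ _ M') (@mjoin _ _ M')); last 2 first.
- exact: msplitK.
- exact: mjoinK.
have lm := msplit_linear (M := M'); split=> // x.
elim/pmod_ind=> [|v|a u v IHu IHv].
- by rewrite act_linear0 (lin0 lm) act_linear0.
- rewrite [act x _]multitensor_act_mtens [msplit (pgen _ v)]msplit_mtens.
  rewrite act_tens [X in _ + tens _ X]multitensor_act_mtens big_ord_recl (linD lm).
  rewrite (linear_sum_fun lm) msplit_mtens dfwith_in dtail_with0; congr (_ + _).
  rewrite (linear_sum_fun (tens_linearr _)); apply: eq_bigr => j _.
  rewrite msplit_mtens dfwith_out 1?eq_sym ?neq_lift //; congr tens; congr mtens.
  exact: (dtail_with_lift (M := M')).
- by rewrite act_linearr !lm IHu IHv act_linearr.
Qed.

Lemma evTensor_ext n (a : 'I_n -> K) (a0 : forall i, a i != 0)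
  (M : 'I_n -> lieModule g) (u u' : hat g) :
  (forall i, ev (a i) u.1 = ev (a i) u'.1) ->
  forall e : evTensor a0 M, act u e = act u' e.
Proof.
move=> uu'; elim/pmod_ind=> [|v|b p q IHp IHq].
- by rewrite !act_linear0.
- rewrite [LHS]multitensor_act_mtens [RHS]multitensor_act_mtens.
  apply: eq_bigr => i _; congr mtens; congr dfwith.
  by rewrite /act /= /ev_act uu'.
- by rewrite !act_linearr IHp IHq.
Qed.

Section EvModule.
Variables (a : K) (a0 : a != 0) (M : lieModule g).

Lemma ev_hmon0 (x : g) (m : M) : act (hmon x 0) (m : evModule a0 M) = act x m.
Proof. by rewrite /act /= /ev_act ev_lmon expr0z scale1r. Qed.

Lemma evModule_irreducible : irreducible M -> irreducible (evModule a0 M).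
Proof.
move=> [M0 irrM]; split=> // S [S0 Sl Sx]; apply: irrM; split=> // x u Su.
by rewrite -ev_hmon0; apply: Sx.
Qed.

Lemma evModule_schur : schur M -> schur (evModule a0 M).
Proof.
move=> schM f [lf fx]; apply: schM; split=> // x u.
by rewrite -!ev_hmon0 fx.
Qed.

End EvModule.

(** The empty tensor product is the ground field; this starts the induction on the number of
    factors. *)
Lemma evTensor0 (a : 'I_0 -> K) (a0 : forall i, a i != 0)
  (M : 'I_0 -> lieModule g) :
  irreducible (evTensor a0 M) /\ schur (evTensor a0 M).
Proof.
have v0 : forall i : 'I_0, M i by case.
have all1 (e : evTensor a0 M) : exists c : K, e = c *: mtens v0.
  elim/pmod_ind: e => [|v|b p q [c ->] [d ->]].
  - by exists 0; rewrite scale0r.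
  - exists 1; rewrite scale1r; congr mtens.
    by apply: functional_extensionality_dep; case.
  - by exists (b * c + d); rewrite scalerDl scalerA.
(* With no index there is no relation, so the form that is 1 on every pure tensor is well defined;
   it shows that the generator is nonzero. *)
have rel u v : multitensor_rel (M := fun i : 'I_0 => M i : lmodType K) u v ->
    leval (fun=> 1 : K^o) u = leval (fun=> 1) v by case=> ? [].
have v00 : mtens v0 != 0 :> evTensor a0 M.
  apply/eqP => /(congr1 (plift rel)); rewrite linear0 [plift _ _]plift_gen.
  by move/eqP; rewrite oner_eq0.
split; last first.
  move=> f [lf _]; have [c fc] := all1 (f (mtens v0)); exists c => e.
  by have [b ->] := all1 e; rewrite (linZ lf) fc !scalerA mulrC.
split; first by exists (mtens v0).
move=> S sS; case: (nonzero_submodule sS) => [->|[e Se e0]]; [by left|right].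
have [S0 Sl Sx] := sS; apply/seteqP; split=> // e' _.
have [c ec] := all1 e; have [d ->] := all1 e'.
have c0 : c != 0 by apply: contra_neq e0 => c0; rewrite ec c0 scale0r.
rewrite -[d](divfK c0) -scalerA -ec -[_ *: e]addr0; exact: Sl.
Qed.

(** The first factor is split off. A polynomial equal to 1 at its point and to 0 at the other
    points, which are distinct from it, gives elements that act as prescribed on this factor and
    kill the whole remaining product. *)
Lemma evTensor_irreducible_schur n (a : 'I_n -> K) (a0 : forall i, a i != 0)
  (a_inj : injective a) (M : 'I_n -> lieModule g) :
  (forall i, irreducible (M i)) -> (forall i, schur (M i)) ->
  irreducible (evTensor a0 M) /\ schur (evTensor a0 M).
Proof.
elim: n a a0 a_inj M => [|n IH] a a0 a_inj M irrM schM; first exact: evTensor0.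
pose a' j := a (lift ord0 j).
pose a'0 j := a0 (lift ord0 j).
pose E' := evTensor a'0 (fun j => M (lift ord0 j)).
have [irrE schE] : irreducible E' /\ schur E'.
  by apply: IH => // i j /a_inj /lift_inj.
have iso := lieModule_iso_sym (multitensor_split_iso (fun i => evModule (a0 i) (M i))).
have irr0 := evModule_irreducible (a0 ord0) (irrM ord0).
have sch0 := evModule_schur (a0 := a0 ord0) (schM ord0).
have dec : decoupled (evModule (a0 ord0) (M ord0)) (evModule (a0 ord0) (M ord0)) E' E'.
  move=> x s s'.
  have [|p [p1 p0]] := @poly_delta K [seq a' j | j <- enum 'I_n] (a ord0).
    apply/negP => /mapP [j _ /a_inj e].
    by have := neq_lift ord0 j; rewrite -e eqxx.
  have kill (e : E') : act ((loop_poly p x.1, 0) : hat g) e = 0.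
    rewrite -[RHS](act0l e); apply: evTensor_ext => j /=.
    rewrite ev_loop_poly ?a'0 // (p0 (a' j)) ?scale0r; last exact/map_f/mem_enum.
    by rewrite (lin0 (ev_linear _)).
  exists (loop_poly p x.1, 0); split=> // m;
    by rewrite /act /= /ev_act /= ev_loop_poly // p1 scale1r.
split; first by apply: (iso_irreducible iso); apply: tensor_irreducible.
by apply: (iso_schur iso); apply: tensor_schur => //; case: irr0.
Qed.

Lemma evTensor_decoupled n n' (a : 'I_n -> K) (a0 : forall i, a i != 0)
  (a' : 'I_n' -> K) (a'0 : forall i, a' i != 0)
  (M : 'I_n -> lieModule g) (M' : 'I_n' -> lieModule g) (N N' : lieModule (hat g)) :
  smooth N -> smooth N' -> decoupled (evTensor a0 M) (evTensor a'0 M') N N'.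
Proof.
move=> smN smN' x s s'.
have [J hJ] := smooth_loop_poly s x.1 smN.
have [J' hJ'] := smooth_loop_poly s' x.1 smN'.
(* Interpolating at the points of both modules together lets one element serve for source and
   target. *)
pose cs := [seq a i | i <- enum 'I_n] ++ [seq a' i | i <- enum 'I_n'].
have [|p [Jp p1]] := @poly_one K cs (maxn J J').
  by move=> c; rewrite mem_cat => /orP[] /mapP [i _ ->].
exists (loop_poly p x.1, 0); split.
- apply: evTensor_ext => i /=; rewrite ev_loop_poly // p1 ?scale1r //.
  by rewrite mem_cat map_f ?mem_enum.
- apply: evTensor_ext => i /=; rewrite ev_loop_poly // p1 ?scale1r //.
  by rewrite mem_cat orbC map_f ?mem_enum.
- by apply: hJ; apply: dvdp_trans Jp; apply: dvdp_exp2l; apply: leq_maxl.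
- by apply: hJ'; apply: dvdp_trans Jp; apply: dvdp_exp2l; apply: leq_maxr.
Qed.

End EvaluationTensor.

(** * Graded highest weight modules *)

Section GeneralizedEigenvectors.
Variables (K : fieldType) (V : lmodType K) (T : V -> V).
Hypothesis lT : linear T.

Definition op_sub (c : K) (x : V) : V := T x - c *: x.

Lemma op_sub_linear c : linear (op_sub c).
Proof.
move=> a x y; rewrite /op_sub lT scalerBr scalerDr !scalerA [c * a]mulrC.
by rewrite opprD addrACA.
Qed.

Lemma iter_op_sub_linear c n : linear (iter n (op_sub c)).
Proof. by elim: n => [//|n IH] a x y; rewrite [LHS]/= IH op_sub_linear. Qed.

Definition gen_eigen (c : K) (x : V) : Prop := exists n, iter n (op_sub c) x = 0.

Lemma iter_op_sub0 c p q x : (p <= q)%N ->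
  iter p (op_sub c) x = 0 -> iter q (op_sub c) x = 0.
Proof.
by move=> /subnK <- e; rewrite iterD e; apply: lin0 (iter_op_sub_linear _ _).
Qed.

Lemma gen_eigen_subspace c : subspace (gen_eigen c).
Proof.
split=> [|a x y [p px] [q qy]]; first by exists 0%N.
exists (maxn p q); rewrite iter_op_sub_linear (iter_op_sub0 (leq_maxl _ _) px).
by rewrite (iter_op_sub0 (leq_maxr _ _) qy) scaler0 addr0.
Qed.

Lemma eigen_gen c x : T x = c *: x -> gen_eigen c x.
Proof. by move=> Tx; exists 1%N; rewrite /= /op_sub Tx subrr. Qed.

Lemma op_subC c d x : op_sub c (op_sub d x) = op_sub d (op_sub c x).
Proof.
rewrite /op_sub !(linD lT) !(linN lT) !(linZ lT) !scalerBr !scalerA [d * c]mulrC.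
by rewrite !opprB addrACA [RHS]addrACA; congr (_ + _); rewrite addrC.
Qed.

Lemma gen_eigen_op_sub c d x : gen_eigen c x -> gen_eigen c (op_sub d x).
Proof.
move=> [n xn]; exists n; have -> : iter n (op_sub c) (op_sub d x) = op_sub d (iter n (op_sub c) x).
  by elim: n {xn} => //= n ->; rewrite op_subC.
by rewrite xn; apply: lin0 (op_sub_linear d).
Qed.

Lemma gen_eigen_inj c d x : c != d -> gen_eigen c x -> op_sub d x = 0 -> x = 0.
Proof.
move=> cd [n xn] /eqP; rewrite subr_eq0 => /eqP Tx.
have e k : iter k (op_sub c) x = (d - c) ^+ k *: x.
  elim: k => [|k IH] /=; first by rewrite expr0 scale1r.
  rewrite IH /op_sub (linZ lT) Tx !scalerA -scalerBl exprS; congr (_ *: _).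
  by rewrite mulrBl [d * _]mulrC.
move: xn; rewrite e => /eqP; rewrite scaler_eq0 expf_eq0 subr_eq0 eq_sym.
by rewrite (negPf cd) andbF => /eqP.
Qed.

Lemma gen_eigen_disjoint c d x : c != d -> gen_eigen c x -> gen_eigen d x -> x = 0.
Proof.
move=> cd cx [n]; elim: n x cx => [//|n IH] x cx; rewrite iterSr => xn.
apply: (gen_eigen_inj cd cx); apply: IH => //; exact: gen_eigen_op_sub.
Qed.

(** A power of T - c_j that kills [f j] shortens the sum. By induction it kills every other [f i]
    too, which are then generalized eigenvectors for two eigenvalues. *)
Lemma gen_eigen_indep (I : eqType) (s : seq I) (c : I -> K) (f : I -> V) :
  uniq s -> {in s &, injective c} -> (forall i, i \in s -> gen_eigen (c i) (f i)) ->
  \sum_(i <- s) f i = 0 -> forall i, i \in s -> f i = 0.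
Proof.
elim: s f => [//|j s IH] f /= /andP[js us] cI fg.
have cI' : {in s &, injective c}.
  by move=> x y xs ys; apply: cI; rewrite inE ?xs ?ys orbT.
rewrite big_cons => e.
have [n fj] := fg j (mem_head _ _).
have fs i : i \in s -> f i = 0.
  move=> si; have ci : c i != c j.
    apply: contraNneq js => /cI; rewrite !inE si eqxx orbT => /(_ isT isT) <-.
    exact: si.
  apply: (gen_eigen_disjoint ci); first by apply: fg; rewrite inE si orbT.
  exists n; apply: (IH (fun i => iter n (op_sub (c j)) (f i)) us cI' _ _ i si).
    move=> k ks; elim: (n) => [|r IHr] /=; first by apply: fg; rewrite inE ks orbT.
    exact: gen_eigen_op_sub.
  rewrite -(linear_sum_fun (iter_op_sub_linear (c j) n)).
  have := congr1 (iter n (op_sub (c j))) e.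
  by rewrite (linD (iter_op_sub_linear _ _)) fj add0r (lin0 (iter_op_sub_linear _ _)).
move=> i; rewrite inE => /orP[/eqP ->|]; last exact: fs.
by rewrite -e big_seq big1 ?addr0.
Qed.

Lemma eigen_indep_nat (c : nat -> K) (f : nat -> V) R :
  injective c -> (forall i, T (f i) = c i *: f i) -> \sum_(i < R) f i = 0 ->
  forall i, (i < R)%N -> f i = 0.
Proof.
move=> cI Tf e i iR; apply: (@gen_eigen_indep _ (iota 0 R) c f (iota_uniq 0 R)).
- by move=> x y _ _; apply: cI.
- by move=> k _; apply: eigen_gen.
- by move: e; rewrite -(big_mkord xpredT f) /index_iota subn0.
- by rewrite mem_iota add0n.
Qed.

End GeneralizedEigenvectors.

(** * Words in homogeneous elements and singular vectors *)

Section GradedHighestWeight.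
Variables (K : numFieldType) (L : lieAlgType K) (hom : int -> L -> Prop).
Hypothesis hom_lie : forall k l x y, hom k x -> hom l y -> hom (k + l) (lie x y).
Hypothesis hom_span : forall P : set L, subspace P ->
  (forall k x, hom k x -> P x) -> forall x, P x.
Variable M : lieModule L.
Implicit Types (v m : M) (l : seq (int * L)).

(** Letters carry their degree because [hom] is only a relation and need not determine it. The
    section serves twice: for [g] graded by height and for [hat g] with its principal grading. *)
Definition prod_act l m : M := foldr (fun p => act p.2) m l.

Definition degree_of l : int := \sum_(p <- l) p.1.

Fixpoint homs l : Prop := if l is p :: l' then hom p.1 p.2 /\ homs l' else True.

Lemma homs_cat l l' : homs (l ++ l') <-> homs l /\ homs l'.
Proof. by elim: l => /= [|p l IH]; split=> [|[]]; tauto. Qed.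

Lemma prod_act_cat l l' m : prod_act (l ++ l') m = prod_act l (prod_act l' m).
Proof. exact: foldr_cat. Qed.

Lemma prod_act_linear l : linear (prod_act l).
Proof. by elim: l => [//|p l IH] a u v; rewrite [LHS]/= IH act_linearr. Qed.

Lemma degree_of_cat l l' : degree_of (l ++ l') = degree_of l + degree_of l'.
Proof. exact: big_cat. Qed.

Lemma degree_of_cons p l : degree_of (p :: l) = p.1 + degree_of l.
Proof. exact: big_cons. Qed.

Lemma degree_of_nil : degree_of [::] = 0.
Proof. exact: big_nil. Qed.

(** Moving the last factor of a product to the front only costs products with
    one factor fewer and the same degree. *)
Lemma prod_act_rotate (Q : set M) v n d : subspace Q ->
  (forall l, homs l -> size l = n -> degree_of l = d -> Q (prod_act l v)) ->
  forall l p x, homs p -> homs l -> hom x.1 x.2 -> size (p ++ l) = n ->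
    degree_of (p ++ x :: l) = d ->
    Q (prod_act (p ++ x :: l) v) -> Q (prod_act (p ++ rcons l x) v).
Proof.
move=> sQ Qn; elim=> [//|b l IH] p x hp /= [hb hl] hx sz dg Ql.
rewrite -cat_rcons; apply: IH => //.
- by rewrite -cats1; apply/homs_cat; split.
- by rewrite cat_rcons -sz !size_cat /= addnS.
- by rewrite -dg cat_rcons !(degree_of_cat, degree_of_cons) [b.1 + _]addrCA.
rewrite cat_rcons.
have -> : prod_act (p ++ b :: x :: l) v =
    prod_act (p ++ x :: b :: l) v + prod_act (p ++ (b.1 + x.1, lie b.2 x.2) :: l) v.
  rewrite !prod_act_cat -(linD (prod_act_linear p)) /= act_lie; congr prod_act.
  by rewrite addrC subrK.
apply: subspaceD => //; apply: Qn.
- by apply/homs_cat; split=> //=; split=> //; apply: hom_lie.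
- by rewrite -sz !size_cat.
- rewrite -dg !(degree_of_cat, degree_of_cons) /=; congr (_ + _).
  by rewrite [b.1 + x.1]addrC addrA.
Qed.

Definition singular v : Prop := forall k x, hom k x -> 0 < k -> act x v = 0.

(** Induction on the length. A last letter of positive degree kills [v]; any other last letter is
    rotated to the front, behind which a shorter word of positive degree remains. *)
Lemma prod_act_pos v : singular v ->
  forall l, homs l -> 0 < degree_of l -> prod_act l v = 0.
Proof.
move=> sv l; have [n] := ubnP (size l).
elim: n l => // n IH l; case/lastP: l => [|l x]; first by rewrite degree_of_nil.
rewrite size_rcons ltnS => ln.
rewrite -cats1 homs_cat degree_of_cat degree_of_cons degree_of_nil addr0 /=.
move=> [hl [hx _]] dpos.
have [x0|x0] := ltP 0 x.1.
  by rewrite prod_act_cat /= (sv _ _ hx x0) (lin0 (prod_act_linear l)).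
rewrite cats1; apply: (@prod_act_rotate [set 0] v (size l) (degree_of (x :: l)) _ _ l [::] x) => //.
- by split=> // a u w -> ->; rewrite scaler0 addr0.
- move=> l' hl' sz dg; apply: IH => //; first by rewrite sz.
  by rewrite dg degree_of_cons addrC.
- rewrite /= IH //; [exact: act_linear0|].
  by lia.
Qed.

(** The same rotation: a last letter of negative degree leaves a word of positive degree behind it,
    and one of degree zero only rescales [v]. *)
Lemma prod_act_zero v : singular v ->
  (forall x, hom 0 x -> exists c, act x v = c *: v) ->
  forall l, homs l -> degree_of l = 0 -> exists c, prod_act l v = c *: v.
Proof.
move=> sv v0 l; have [n] := ubnP (size l).
elim: n l => // n IH l; case/lastP: l => [|l x].
  by move=> _ _ _; exists 1; rewrite scale1r.
rewrite size_rcons ltnS => ln.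
rewrite -cats1 homs_cat degree_of_cat degree_of_cons degree_of_nil addr0 /=.
move=> [hl [hx _]] d0.
have [x0|x0|x0] := ltgtP x.1 0.
- rewrite cats1.
  apply: (@prod_act_rotate [set m | exists c, m = c *: v] v (size l) (degree_of (x :: l)) _ _ l [::] x) => //.
  + split=> [|a _ _ [c ->] [d ->]]; first by exists 0; rewrite scale0r.
    by exists (a * c + d); rewrite scalerDl scalerA.
  + move=> l' hl' sz dg; apply: IH => //; first by rewrite sz.
    by rewrite dg degree_of_cons addrC.
  + exists 0; rewrite scale0r /= prod_act_pos //; [exact: act_linear0|lia].
- by exists 0; rewrite prod_act_cat /= (sv _ _ hx x0) (lin0 (prod_act_linear l)) scale0r.
- rewrite x0 in hx; have [c xv] := v0 _ hx.
  have [|d ld] := IH l ln hl; first by lia.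
  by exists (c * d); rewrite prod_act_cat /= xv (linZ (prod_act_linear l)) ld scalerA.
Qed.

Definition gen_by v : set M := [set m | forall S, submodule S -> S v -> S m].

Lemma gen_by_submodule v : submodule (gen_by v).
Proof.
split=> [S [] //|a m m' Pm Pm' S sS Sv|x m Pm S sS Sv].
- by case: (sS) => _ Sl _; apply: Sl; [apply: Pm|apply: Pm'].
- by case: (sS) => _ _ Sx; apply: Sx; apply: Pm.
Qed.

Lemma gen_by_self v : gen_by v v.
Proof. by move=> S _. Qed.

Lemma gen_by_prod v m (P : set M) : gen_by v m -> subspace P ->
  (forall l, homs l -> P (prod_act l v)) -> P m.
Proof.
move=> gm; pose S := [set m : M | forall P : set M, subspace P ->
  (forall l, homs l -> P (prod_act l v)) -> P m].
suff /gm : submodule S by move=> /(_ (fun P _ h => h [::] I)); apply.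
split=> [Q sQ _|a p q Sp Sq Q sQ Ql|x p Sp Q sQ Ql]; first exact: subspace0.
  by case: (sQ) => _; apply; [apply: Sp|apply: Sq].
apply: (Sp [set m | Q (act x m)]).
  split=> [|a u w Qu Qw]; first by rewrite /= act_linear0; apply: subspace0.
  by rewrite /= act_linearr; case: sQ => _; apply.
move=> l hl; apply: (@hom_span [set x | Q (act x (prod_act l v))]).
  split=> [|a u w Qu Qw]; first by rewrite /= act0l; apply: subspace0.
  by rewrite /= act_linearl; case: sQ => _; apply.
by move=> k y hy; apply: (Ql ((k, y) :: l)).
Qed.

(** For [v] the bound is 1. Acting with an element of degree [k] shifts the bound by [-k], since
    that element can be counted as one more letter of the word. *)
Lemma singular_locally_nilpotent v m : singular v -> gen_by v m ->
  exists B : int, forall l, homs l -> B <= degree_of l -> prod_act l m = 0.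
Proof.
move=> sv gm; apply: (gm [set m | exists B : int, forall l, homs l -> B <= degree_of l -> prod_act l m = 0]); last first.
  by exists 1 => l hl dl; apply: prod_act_pos => //; lia.
split=> [|a p q [B Bp] [C Cq]|x p [B Bp]].
- by exists 0 => l _ _; apply: lin0 (prod_act_linear l).
- exists (`|B| + `|C|) => l hl dl; rewrite (prod_act_linear l) Bp ?Cq //; [|lia|lia].
  by rewrite scaler0 addr0.
apply: (@hom_span [set x | exists B : int, forall l, homs l -> B <= degree_of l -> prod_act l (act x p) = 0]).
  split=> [|a u w [C Cu] [D Dw]].
    by exists 0 => l _ _; rewrite act0l; apply: lin0 (prod_act_linear l).
  exists (`|C| + `|D|) => l hl dl; rewrite act_linearl (prod_act_linear l) Cu ?Dw //; [|lia|lia].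
  by rewrite scaler0 addr0.
move=> k y hy; exists (B - k) => l hl dl.
have -> : prod_act l (act y p) = prod_act (l ++ [:: (k, y)]) p by rewrite prod_act_cat.
apply: Bp; first by apply/homs_cat; split.
by rewrite degree_of_cat degree_of_cons degree_of_nil /=; lia.
Qed.

(** The powers of [x] have unbounded degrees, so one of them kills [m]. *)
Lemma singular_no_eigenvalue v m k x c : singular v -> gen_by v m -> m != 0 ->
  hom k x -> 0 < k -> act x m = c *: m -> c = 0.
Proof.
move=> sv gm m0 hx k0 xm; have [B hB] := singular_locally_nilpotent sv gm.
have e n : prod_act (nseq n (k, x)) m = c ^+ n *: m.
  elim: n => [|n IH] /=; first by rewrite expr0 scale1r.
  by rewrite IH (linZ (act_linearr x)) xm scalerA exprSr.
have hn n : homs (nseq n (k, x)) by elim: n => //=.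
have dn n : degree_of (nseq n (k, x)) = k * n%:Z.
  elim: n => [|n IH]; first by rewrite degree_of_nil mulr0.
  by rewrite degree_of_cons IH /= intS mulrDr mulr1.
have := hB (nseq (absz B) (k, x)) (hn _); rewrite e dn.
have -> : B <= k * (absz B)%:Z by nia.
move=> /(_ isT) /eqP; rewrite scaler_eq0 (negPf m0) orbF expf_eq0.
by case/andP => _ /eqP.
Qed.

Section DegreeOperator.
Variable T : M -> M.
Hypothesis lT : linear T.
Hypothesis T_act : forall k x m, hom k x -> T (act x m) = k%:~R *: act x m + act x (T m).

Lemma degree_op_prod v a l : T v = a *: v -> homs l ->
  T (prod_act l v) = ((degree_of l)%:~R + a) *: prod_act l v.
Proof.
move=> Tv; elim: l => [|p l IH] /=; first by rewrite degree_of_nil add0r.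
move=> [hp hl]; rewrite (T_act _ hp) IH // (linZ (act_linearr _)) -scalerDl.
by rewrite degree_of_cons intrD addrA.
Qed.

(** Words of degree -j applied to [v] are eigenvectors for a - j, and words of positive degree
    vanish. Asking for the sum at every [R'] beyond [R] lets decompositions of different lengths be
    added. *)
Lemma degree_op_decomp v a m : T v = a *: v -> singular v -> gen_by v m ->
  exists R (f : nat -> M), [/\ forall R', (R <= R')%N -> m = \sum_(j < R') f j,
    forall j, T (f j) = (a - j%:R) *: f j &
    (forall x, hom 0 x -> exists c, act x v = c *: v) -> exists c, f 0%N = c *: v].
Proof.
move=> Tv sv gm.
apply: (@gen_by_prod v m [set m | exists R (f : nat -> M),
  [/\ forall R', (R <= R')%N -> m = \sum_(j < R') f j,
    forall j, T (f j) = (a - j%:R) *: f j &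
    (forall x, hom 0 x -> exists c, act x v = c *: v) -> exists c, f 0%N = c *: v]]) => //.
- split=> [|b p q [R [f [fp fT f0]]] [S [h [hq hT h0]]]].
    exists 0%N, (fun=> 0); split=> [R _|j|_]; first by rewrite big1.
      by rewrite (lin0 lT) scaler0.
    by exists 0; rewrite scale0r.
  exists (maxn R S), (fun j => b *: f j + h j); split=> [R'|j|v0].
  + rewrite geq_max => /andP[RR' SR']; rewrite (fp _ RR') (hq _ SR').
    by rewrite scaler_sumr -big_split.
  + by rewrite lT fT hT scalerDr !scalerA mulrC.
  + have [c fc] := f0 v0; have [d hd] := h0 v0.
    by exists (b * c + d); rewrite fc hd scalerDl scalerA.
- move=> l hl; have [dl|dl] := ltP 0 (degree_of l).
    rewrite prod_act_pos //; exists 0%N, (fun=> 0); split=> [R _|j|_]; first by rewrite big1.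
      by rewrite (lin0 lT) scaler0.
    by exists 0; rewrite scale0r.
  pose d := absz (degree_of l).
  exists d.+1, (fun j => if j == d then prod_act l v else 0); split=> [R' dR|j|v0].
  + rewrite (bigD1 (Ordinal dR)) //= eqxx big1 ?addr0 // => i.
    by rewrite -val_eqE /= => /negPf ->.
  + case: eqP => [->|_]; last by rewrite (lin0 lT) scaler0.
    have dE : degree_of l = - d%:Z by rewrite /d; lia.
    by rewrite (degree_op_prod Tv hl) dE mulrNz -pmulrn addrC.
  + case: eqP => [d0|_]; last by exists 0; rewrite scale0r.
    by apply: prod_act_zero => //; move: d0; rewrite /d; lia.
Qed.

Lemma sub_nat_inj (a : K) : injective (fun j : nat => a - j%:R).
Proof. by move=> i j /addrI /oppr_inj /eqP; rewrite eqr_nat => /eqP. Qed.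

(** The eigenvalues -j are distinct in characteristic zero, so only the component at j = 0
    survives. *)
Lemma degree_op_kernel v m : T v = 0 -> singular v ->
  (forall x, hom 0 x -> exists c, act x v = c *: v) ->
  gen_by v m -> T m = 0 -> exists c, m = c *: v.
Proof.
move=> Tv sv v0 gm Tm; have Tv' : T v = 0 *: v by rewrite scale0r.
have [R [f [fm fT f0]]] := degree_op_decomp Tv' sv gm.
have [c fc] := f0 v0; exists c; rewrite -fc (fm R.+1) // big_ord_recl big1 ?addr0 // => i _.
have e : \sum_(j < R.+1) T (f j) = 0.
  by rewrite -(linear_sum_fun lT) -fm.
have TT j : T (T (f j)) = (0 - j%:R) *: T (f j) by rewrite fT (linZ lT) fT.
have /eqP := eigen_indep_nat lT (@sub_nat_inj 0) (f := T \o f) TT e (ltn_ord (lift ord0 i)).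
by rewrite /= fT scaler_eq0 sub0r oppr_eq0 pnatr_eq0 /= => /eqP.
Qed.

(** The components of a singular vector under [T] are singular. A nonzero one of eigenvalue -i with
    i > 0 would generate [M], and [v] would be a sum of eigenvectors of eigenvalues at most -i,
    contradicting [T v = 0]. *)
Lemma irreducible_singular v w : irreducible M -> T v = 0 -> v != 0 -> singular v ->
  (forall x, hom 0 x -> exists c, act x v = c *: v) ->
  singular w -> exists c, w = c *: v.
Proof.
move=> [_ irr] Tv vn0 sv v0 sw; have Tv' : T v = 0 *: v by rewrite scale0r.
have all_gen u m : u != 0 -> gen_by u m.
  move=> u0; case: (irr _ (gen_by_submodule u)) => e.
    by have := gen_by_self (v := u); rewrite e => /= uz; rewrite uz eqxx in u0.
  by have : [set: M] m by []; rewrite -e.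
have [R [f [fw fT f0]]] := degree_op_decomp Tv' sv (all_gen v w vn0).
have sf j : (j < R.+1)%N -> singular (f j).
  move=> jR k x hx k0.
  apply: (eigen_indep_nat lT (@sub_nat_inj k%:~R) (f := fun j => act x (f j)) (R := R.+1)) => //.
    move=> i; rewrite (T_act _ hx) fT (linZ (act_linearr x)) -scalerDl.
    by rewrite sub0r.
  rewrite -(linear_sum_fun (act_linearr x)) -fw //; exact: sw hx k0.
have [c fc] := f0 v0; exists c; rewrite -fc (fw R.+1) // big_ord_recl big1 ?addr0 // => i _.
apply: contrapT => /eqP fi0.
have [S [h [hv hT _]]] := degree_op_decomp (fT (lift ord0 i)) (sf _ (ltn_ord _)) (all_gen _ v fi0).
have e : \sum_(j < S) T (h j) = 0 by rewrite -(linear_sum_fun lT) -hv.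
case/eqP: vn0; rewrite (hv S) // big1 // => j _.
have lam j' : T (h j') = (0 - ((lift ord0 i : nat) + j')%:R) *: h j'.
  by rewrite hT natrD opprD addrA.
have TT j' : T (T (h j')) = (0 - ((lift ord0 i : nat) + j')%:R) *: T (h j').
  by rewrite lam (linZ lT) lam.
have cI : injective (fun j' : nat => 0 - ((lift ord0 i : nat) + j')%:R : K).
  by move=> p q /sub_nat_inj /addnI.
have /eqP := eigen_indep_nat lT cI (f := T \o h) TT e (ltn_ord j).
by rewrite /= lam scaler_eq0 sub0r oppr_eq0 pnatr_eq0 /= => /eqP.
Qed.

End DegreeOperator.
End GradedHighestWeight.

(** * Linear operators over a closed field *)

Section FiniteDimension.
Variable K : fieldType.

Lemma linear_inj_surj (U V : vectType K) (f : U -> V) : linear f ->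
  (forall u, f u = 0 -> u = 0) -> \dim {:U} = \dim {:V} ->
  forall v, exists u, f u = v.
Proof.
move=> lf fI dUV v.
pose f' : {linear U -> V} := HB.pack f (GRing.isLinear.Build K U V *:%R f lf).
have fE u : linfun f' u = f u by rewrite lfunE.
have k0 : lker (linfun f') = 0%VS.
  apply/eqP; rewrite -subv0; apply/subvP => u; rewrite memv_ker fE => /eqP /fI ->.
  exact: mem0v.
have := limg_ker_dim (linfun f') fullv; rewrite k0 capv0 dimv0 add0n dUV => e.
have imT : (linfun f' @: fullv)%VS = fullv.
  by apply/eqP; rewrite eqEdim subvf e leqnn.
have : v \in (linfun f' @: fullv)%VS by rewrite imT memvf.
by case/memv_imgP => u _ ->; exists u; rewrite fE.
Qed.

Lemma subspace_vspace (V : vectType K) (S : set V) : subspace S ->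
  exists W : {vspace V}, forall x, x \in W <-> S x.
Proof.
move=> sS; pose P n := `[< exists2 W : {vspace V}, (forall x, x \in W -> S x) & \dim W = n >].
have exP : exists n, P n.
  exists 0%N; apply/asboolP; exists 0%VS; last exact: dimv0.
  by move=> x; rewrite memv0 => /eqP ->; apply: subspace0.
have leP n : P n -> (n <= \dim {:V})%N.
  by move=> /asboolP [W _ <-]; apply: dimvS (subvf W).
have [n /asboolP [W WS dW] nmax] := ex_maxnP exP leP.
exists W => x; split=> [/WS //|Sx].
have : (n >= \dim (W + <[x]>)%VS)%N.
  apply: nmax; apply/asboolP; exists (W + <[x]>)%VS => // y.
  case/memv_addP => w wW [z /vlineP [c ->] ->]; apply: subspaceD => //.
    exact: WS.
  exact: subspaceZ.
rewrite -dW => le.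
have /eqP -> : W == (W + <[x]>)%VS by rewrite eqEdim addvSl le.
exact: (subvP (addvSr _ _) _ (memv_line x)).
Qed.

End FiniteDimension.

(** * Generalized eigenspaces and traces over a closed field *)

Section ClosedField.
Variable K : numClosedFieldType.

Lemma mx_kill n (A : 'M[K]_n) : exists rs : seq K,
  foldr (fun r B => B *m (A - r%:M)) 1%:M rs = 0.
Proof.
case: n A => [|n] A; first by exists [::]; apply: flatmx0.
have [rs rsE] := closed_field_poly_normal (char_poly A).
exists rs; have {1}<- := Cayley_Hamilton A.
rewrite rsE (monicP (char_poly_monic A)) scale1r.
elim: rs {rsE} => [|r rs IH] /=; first by rewrite big_nil [RHS]rmorph1.
have hM p q : horner_mx A (p * q) = horner_mx A p *m horner_mx A q by exact: rmorphM.
have hX : horner_mx A ('X - r%:P) = A - r%:M.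
  by rewrite rmorphB /= horner_mx_X horner_mx_C.
by rewrite big_cons mulrC hM -IH hX.
Qed.

(** On this space T - r is the nonzero scalar c - r plus the locally nilpotent T - c; the induction
    sums the geometric series of the inverse. *)
Lemma gen_eigen_solve (V : lmodType K) (T : V -> V) (lT : linear T) c r y :
  c != r -> gen_eigen T c y -> exists2 z, gen_eigen T c z & op_sub T r z = y.
Proof.
move=> cr [n]; elim: n y => [|n IH] y yn.
  exists 0; first by apply: subspace0; apply: gen_eigen_subspace.
  by rewrite (lin0 (op_sub_linear lT r)); rewrite /= in yn; rewrite yn.
rewrite iterSr in yn; have [z gz ze] := IH _ yn.
have gy : gen_eigen T c y by exists n.+1; rewrite iterSr.
exists ((c - r)^-1 *: (y - z)).
  by apply: subspaceZ; [exact: gen_eigen_subspace|apply: subspaceB => //; exact: gen_eigen_subspace].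
rewrite (linZ (op_sub_linear lT r)) (linD (op_sub_linear lT r)).
rewrite (linN (op_sub_linear lT r)) ze /op_sub opprB [_ + (c *: y - _)]addrC addrA subrK.
by rewrite -scalerBl scalerA mulVf ?scale1r // subr_eq0.
Qed.

(** From a decomposition of (T - r) x, the parts with c different from r are lifted through T - r.
    What is left of [x] is sent to the part at r, so it is a generalized eigenvector for r. *)
Lemma gen_eigen_decomp0 (V : lmodType K) (T : V -> V) (lT : linear T)
    (s rs : seq K) x : uniq s -> {subset rs <= s} -> foldr (op_sub T) x rs = 0 ->
  exists f : K -> V, (forall c, gen_eigen T c (f c)) /\ x = \sum_(c <- s) f c.
Proof.
move=> us; elim: rs x => [|r rs IH] x sub /= xe.
  exists (fun=> 0); split=> [c|]; last by rewrite big1.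
  by apply: subspace0; apply: gen_eigen_subspace.
have rs_s : r \in s by apply: sub; rewrite inE eqxx.
have [||f [fg fx]] := IH (op_sub T r x); first by move=> c cr; apply: sub; rewrite inE cr orbT.
  by rewrite -[RHS]xe; elim: (rs) => //= c l ->; rewrite op_subC.
have ex c : exists z, gen_eigen T c z /\ (c != r -> op_sub T r z = f c).
  have [cr|cr] := eqVneq c r.
    by exists 0; split=> //; apply: subspace0; apply: gen_eigen_subspace.
  by have [z gz ze] := gen_eigen_solve lT cr (fg c); exists z.
pose z c := proj1_sig (cid (ex c)).
have zg c : gen_eigen T c (z c) by rewrite /z; case: cid => ? [].
have ze c : c != r -> op_sub T r (z c) = f c by rewrite /z; case: cid => ? [].
pose y := x - \sum_(c <- s | c != r) z c.
have gy : gen_eigen T r y.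
  have [n fn] := fg r; exists n.+1; rewrite iterSr.
  have -> : op_sub T r y = f r; last exact: fn.
  rewrite (linD (op_sub_linear lT r)) (linN (op_sub_linear lT r)) fx.
  rewrite (linear_sum_fun (op_sub_linear lT r)) (bigD1_seq r) //=.
  by rewrite (eq_bigr _ ze) addrK.
exists (fun c => if c == r then y else z c); split=> [c|].
  by case: eqP => [->|].
rewrite (bigD1_seq r) //= eqxx (eq_bigr z) ?subrK // => c /negPf -> //.
Qed.

Lemma gen_eigen_decomp (V : vectType K) (T : V -> V) : linear T ->
  exists2 s : seq K, uniq s & forall x, exists f : K -> V,
    (forall c, gen_eigen T c (f c)) /\ x = \sum_(c <- s) f c.
Proof.
move=> lT.
pose T' : {linear V -> V} := HB.pack T (GRing.isLinear.Build K V V *:%R T lT).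
pose e := vbasis {:V}; have eb : basis_of {:V} e := vbasisP _.
pose A := mxof e e (linfun T').
have TA x : rVof e (T x) = rVof e x *m A by rewrite -rVof_app // lfunE.
have [rs rs0] := mx_kill A; exists (undup rs); first exact: undup_uniq.
move=> x; apply: (gen_eigen_decomp0 lT (rs := rs)); first exact: undup_uniq.
  by move=> c; rewrite mem_undup.
apply/eqP; rewrite -(rVof_eq0 eb).
have -> : rVof e (foldr (op_sub T) x rs)
    = rVof e x *m foldr (fun r B => B *m (A - r%:M)) 1%:M rs.
  elim: (rs) => [|r l IH] /=; first by rewrite mulmx1.
  rewrite mulmxA -IH mulmxBr -TA mul_mx_scalar /op_sub.
  by rewrite linearB linearZ.
by rewrite rs0 mulmx0.
Qed.

Lemma gen_eigen_mem (V : vectType K) (T : V -> V) (lT : linear T) (s : seq K) :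
  uniq s -> (forall x, exists f : K -> V,
    (forall c, gen_eigen T c (f c)) /\ x = \sum_(c <- s) f c) ->
  forall c x, gen_eigen T c x -> x != 0 -> c \in s.
Proof.
move=> us dec c x gx; apply: contraNT => cs; apply/eqP.
have [f [fg fx]] := dec x; have gs d := gen_eigen_subspace lT d.
pose h d := if d == c then x else - f d.
have := @gen_eigen_indep K V T lT _ (c :: s) id h _ _ _ _ c; rewrite /h eqxx.
apply => //=; [by rewrite cs us|move=> d _|..].
- by case: eqP => [->//|_]; apply: subspaceN.
- rewrite big_cons eqxx big_seq (eq_bigr (fun d => - f d)) => [|d ds].
    by rewrite -big_seq sumrN -fx subrr.
  by case: eqP => // dc; rewrite -dc ds in cs.
- exact: mem_head.
Qed.

(** [S] multiplies each generalized eigencomponent by its eigenvalue. The components are chosen, but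
    their uniqueness makes [S] linear. *)
Lemma semisimple_part (V : vectType K) (T : V -> V) : linear T ->
  exists2 S : V -> V, linear S & forall c x, gen_eigen T c x -> S x = c *: x.
Proof.
move=> lT; have [s us dec] := gen_eigen_decomp lT.
pose f x := proj1_sig (cid (dec x)).
have fg x c : gen_eigen T c (f x c) by rewrite /f; case: cid => ? [].
have fx x : x = \sum_(c <- s) f x c by rewrite {1}/f; case: cid => ? [].
have indep h : (forall c, gen_eigen T c (h c)) -> \sum_(c <- s) h c = 0 ->
    forall c, c \in s -> h c = 0.
  by move=> hg; apply: (gen_eigen_indep lT us (c := id)).
have gs c := gen_eigen_subspace lT c.
exists (fun x => \sum_(c <- s) c *: f x c).
  move=> a x y; rewrite scaler_sumr -big_split /= big_seq [RHS]big_seq.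
  apply: eq_bigr => c cs.
  have e : f (a *: x + y) c - (a *: f x c + f y c) = 0.
    apply: (indep (fun c => f (a *: x + y) c - (a *: f x c + f y c))) => // [d|].
      by apply: subspaceB => //; case: (gs d) => _; apply.
    by rewrite big_split /= sumrN big_split /= -scaler_sumr -!fx subrr.
  by move/eqP: e; rewrite subr_eq0 => /eqP ->; rewrite scalerDr !scalerA mulrC.
move=> c x gx; have [cs|cs] := boolP (c \in s).
  have e d : d \in s -> f x d = if d == c then x else 0.
    move=> ds; apply/eqP; rewrite -subr_eq0; apply/eqP.
    apply: (indep (fun d => f x d - if d == c then x else 0)) ds => [d'|].
      by apply: subspaceB => //; case: eqP => [->//|_]; apply: subspace0.
    by rewrite sumrB -fx -big_mkcond -big_filter filter_pred1_uniq // big_seq1 subrr.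
  rewrite big_seq (eq_bigr (fun d => if d == c then c *: x else 0)); last first.
    by move=> d /e ->; case: eqP => [->|_]; rewrite ?scaler0.
  by rewrite -big_seq -big_mkcond -big_filter filter_pred1_uniq // big_seq1.
have -> : x = 0 by apply/eqP; apply: contraNT cs; exact: (gen_eigen_mem lT us dec gx).
rewrite scaler0 big_seq big1 // => d ds.
by rewrite (indep (f 0)) ?scaler0 // -fx.
Qed.

(** After unitary triangularisation the trace is the sum of the squares of the diagonal entries.
    These are integers, so the squares are nonnegative and cannot cancel. *)
Lemma mx_trace_sq_neq0 n (A : 'M[K]_n) :
  (forall c, eigenvalue A c -> exists k : int, c = k%:~R) ->
  (exists2 c, c != 0 & eigenvalue A c) -> \tr (A *m A) != 0.
Proof.
move=> Aint [c c0 cA].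
have n0 : (0 < n)%N.
  by case: n A Aint cA => // A _ /eigenvalueP [v _]; rewrite thinmx0 eqxx.
have [P Pu PT'] := Schur A n0.
have Pinv := unitarymx_unit Pu.
pose T := conjmx P A; have PT : is_trig_mx T by exact: PT'.
have TE : T = P *m A *m invmx P by rewrite /T conjumx.
clearbody T.
have AE : A = invmx P *m T *m P by rewrite TE !mulmxA mulVmx // mul1mx mulmxKV.
have trE : \tr (A *m A) = \sum_i T i i ^+ 2.
  have -> : A *m A = invmx P *m (T *m T) *m P.
    by rewrite {1 2}AE !mulmxA mulmxK.
  rewrite mxtrace_mulC !mulmxA mulmxV // mul1mx.
  apply: eq_bigr => i _; rewrite mxE (bigD1 i) //= big1 ?addr0 // => j ji.
  have /is_trig_mxP Tt := PT.
  move: ji; rewrite -val_eqE neq_ltn => /orP[ji|ij].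
    by rewrite (Tt j i) // mulr0.
  by rewrite (Tt i j) // mul0r.
have evT d : eigenvalue T d = eigenvalue A d.
  apply/eigenvalueP/eigenvalueP => -[v vd v0].
    exists (v *m P); last by apply: contra_neq v0 => vP; rewrite -[v](mulmxK Pinv) vP mul0mx.
    by rewrite AE !mulmxA mulmxK // vd scalemxAl.
  exists (v *m invmx P).
    by rewrite TE !mulmxA mulmxKV // vd scalemxAl.
  by apply: contra_neq v0 => vP; rewrite -[v](mulmxKV Pinv) vP mul0mx.
have rootT d : eigenvalue T d <-> exists i, d = T i i.
  rewrite eigenvalue_root_char (char_poly_trig PT).
  rewrite -(big_map (fun i => T i i) predT (fun x => 'X - x%:P)) root_prod_XsubC.
  by split=> [/mapP [i _ ->]|[i ->]]; [exists i|apply/map_f/mem_index_enum].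
rewrite trE; apply/eqP => /eqP; rewrite psumr_eq0 => [/allP z|i _].
  move: cA; rewrite -evT => /rootT [i cE].
  by have := z i (mem_index_enum i); rewrite -cE /= expf_eq0 (negPf c0).
have [|k ->] := Aint (T i i); first by rewrite -evT; apply/rootT; exists i.
by rewrite -rmorphXn /= ler0z sqr_ge0.
Qed.

Section StableSubspace.
Variables (V : vectType K) (P : {vspace V}).
Hypothesis P0 : P != 0%VS.

Definition restr (T : V -> V) (u : subvs_of P) : subvs_of P := vsproj P (T (vsval u)).

Lemma restr_linear T : linear T -> linear (restr T).
Proof. by move=> lT a u v; rewrite /restr linearP lT linearP. Qed.

Let e := vbasis {:subvs_of P}.

Lemma restr_mx T : linear T -> exists A : 'M[K]_(\dim {:subvs_of P}),
  forall u, rVof e (restr T u) = rVof e u *m A.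
Proof.
move=> lT; pose T' : {linear subvs_of P -> subvs_of P} :=
  HB.pack (restr T) (GRing.isLinear.Build K _ _ *:%R _ (restr_linear lT)).
exists (mxof e e (linfun T')) => u.
by rewrite -rVof_app ?vbasisP // lfunE.
Qed.

Lemma dim_subvs_gt0 : (0 < \dim {:subvs_of P})%N.
Proof. by rewrite dimvf /dim /= lt0n dimv_eq0. Qed.

Lemma stable_eigenvector (T : V -> V) : linear T -> (forall x, x \in P -> T x \in P) ->
  exists c v, [/\ v \in P, v != 0 & T v = c *: v].
Proof.
move=> lT TP; have [A AE] := restr_mx lT.
have [c /eigenvalueP [v vc v0]] := eigenvalue_closed A dim_subvs_gt0.
have eb : basis_of {:subvs_of P} e := vbasisP _.
exists c, (vsval (vecof e v)); split; first exact: subvsP.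
  apply: contra_neq v0 => e0; apply/eqP; rewrite -(vecof_eq0 eb).
  by apply/eqP/subvs_inj; rewrite e0 linear0.
have := AE (vecof e v); rewrite vecofK // vc -[v in c *: v](vecofK eb) -linearZ.
move/(can_inj (rVofK eb)) => /(congr1 vsval).
by rewrite /restr vsprojK ?linearZ //; apply/TP/subvsP.
Qed.

Lemma stable_commutator (T1 T2 : V -> V) c : linear T1 -> linear T2 ->
  (forall x, x \in P -> T1 x \in P) -> (forall x, x \in P -> T2 x \in P) ->
  (forall x, x \in P -> T1 (T2 x) - T2 (T1 x) = c *: x) -> c = 0.
Proof.
move=> l1 l2 p1 p2 com; have [A AE] := restr_mx l1; have [B BE] := restr_mx l2.
have eb : basis_of {:subvs_of P} e := vbasisP _.
have : B *m A - A *m B = c%:M.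
  apply/row_matrixP => i; rewrite !rowE; set v := delta_mx _ _.
  rewrite mulmxBr !mulmxA -[v](vecofK eb) -!(AE, BE) -linearB mul_mx_scalar -linearZ.
  congr rVof; apply: (@subvs_inj _ _ _); rewrite linearB linearZ /= /restr.
  by rewrite !vsprojK ?com //; do ?[apply: p1|apply: p2|apply: subvsP].
move/(congr1 mxtrace); rewrite linearB /= mxtrace_mulC subrr mxtrace_scalar.
move/esym/eqP; rewrite -mulr_natr mulf_eq0 pnatr_eq0.
by rewrite eqn0Ngt dim_subvs_gt0 orbF => /eqP.
Qed.

End StableSubspace.
End ClosedField.

(** * Structure of g *)

Section LieStructure.
Variables (K : numClosedFieldType) (g : finLieAlgType K).
Implicit Types (x y z : g) (P Q h : {vspace g}).

Lemma mem_lie_prod (U V : {vspace g}) x y : x \in U -> y \in V ->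
  lie x y \in lie_prod U V.
Proof.
move=> xU yV; rewrite (coord_vbasis xU) (coord_vbasis yV).
rewrite (linear_sum_fun (lie_linearl _)); apply: memv_suml => i _.
rewrite lieZl (linear_sum_fun (lie_linearr _)); apply: memvZ.
apply: memv_suml => j _; rewrite (linZ (lie_linearr _)); apply: memvZ.
apply: memv_span; apply/allpairsP; exists ((vbasis U)`_i, (vbasis V)`_j).
by split=> //=; apply: mem_nth; rewrite size_tuple.
Qed.

Lemma lie_prod_sub (U V W : {vspace g}) :
  (forall x y, x \in U -> y \in V -> lie x y \in W) -> (lie_prod U V <= W)%VS.
Proof.
move=> UVW; apply/span_subvP => z /allpairsP [[x y] [/= xU yV ->]].
by apply: UVW; apply: vbasis_mem.
Qed.

(** Brackets span an ideal, nonzero because a simple algebra is not abelian; hence [g, g] = g. *)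
Lemma simple_bracket_span (g_simple : simple g) (P : set g) : subspace P ->
  (forall x y, P (lie x y)) -> forall x, P x.
Proof.
move=> sP Pl; have [[x [y xy]] ideals] := g_simple.
have sub z : z \in lie_prod fullv fullv -> P z.
  have [W WP] := subspace_vspace sP.
  move=> zin; apply/WP; apply: (subvP _ _ zin); apply: lie_prod_sub => u v _ _.
  exact/WP.
have [|e|e] := ideals (lie_prod fullv fullv).
- by move=> u v _; apply: mem_lie_prod; apply: memvf.
- have := mem_lie_prod (memvf x) (memvf y).
  by rewrite e memv0 (negPf xy).
- by move=> z; apply: sub; rewrite e memvf.
Qed.

(** By the Leibniz rule ad y - (a + b) acts on the bracket as (ad y - a) on one entry plus (ad y -
    b) on the other; the induction is on the sum of the two exponents. *)
Lemma gen_eigen_lie y a b x z : gen_eigen (lie y) a x -> gen_eigen (lie y) b z ->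
  gen_eigen (lie y) (a + b) (lie x z).
Proof.
move=> [p xp] [q zq]; have [n] := ubnP (p + q)%N.
elim: n p q x z xp zq => // n IH [|p] [|q] x z xp zq; rewrite ?ltnS => pq.
- by rewrite /= in xp; exists 0%N; rewrite /= xp lie0l.
- by rewrite /= in xp; exists 0%N; rewrite /= xp lie0l.
- by rewrite /= in zq; exists 0%N; rewrite /= zq (lin0 (lie_linearr x)).
have e : op_sub (lie y) (a + b) (lie x z)
    = lie (op_sub (lie y) a x) z + lie x (op_sub (lie y) b z).
  rewrite /op_sub lieDl -[- (a *: x)]scaleNr lieZl (linD (lie_linearr x)).
  rewrite -[- (b *: z)]scaleNr (linZ (lie_linearr x)).
  by rewrite [RHS]addrACA -scalerDl -opprD scaleNr (lieA y x z) subrK.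
have [||r hr] := IH p q.+1 (op_sub (lie y) a x) z _ zq; first by rewrite -iterSr.
  by move: pq; rewrite addSn.
have [||s hs] := IH p.+1 q x (op_sub (lie y) b z) xp; first by rewrite -iterSr.
  by move: pq; rewrite addnS.
have lin := iter_op_sub_linear (lie_linearr y) (a + b).
exists (maxn r s).+1; rewrite iterSr e (linD (lin _)).
rewrite (iter_op_sub0 (lie_linearr y) (leq_maxl r s) hr).
by rewrite (iter_op_sub0 (lie_linearr y) (leq_maxr r s) hs) addr0.
Qed.

Section Cartan.
Variable h : {vspace g}.
Hypothesis h_cartan : cartan_subalgebra h.

Let h_lie x y : x \in h -> y \in h -> lie x y \in h.
Proof. by case: h_cartan => hl _ _; apply: hl. Qed.

Lemma cartan_series_sub n : (iter n (lie_prod h) h <= h)%VS.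
Proof.
elim: n => [|n IH] //=; apply: lie_prod_sub => x y xh /(subvP IH); exact: h_lie.
Qed.

Lemma cartan_gen_eigen x y : x \in h -> y \in h -> gen_eigen (lie x) 0 y.
Proof.
move=> xh yh; have [_ [n hn] _] := h_cartan; exists n.
have -> : iter n (op_sub (lie x) 0) y = iter n (lie x) y.
  by elim: n {hn} => //= n ->; rewrite /op_sub scale0r subr0.
apply/eqP; rewrite -memv0 -hn; elim: n {hn} => //= n IH; exact: mem_lie_prod.
Qed.

(** On a minimal [h]-stable subspace the terms of the lower central series of [h]
    act by scalars, from the last term up: a commutator that acts by a scalar has
    trace zero, so an element of the next term commutes with [h] there, and its
    eigenspaces are [h]-stable. *)
Lemma joint_eigenvector Q : Q != 0%VS ->
  (forall x y, x \in h -> y \in Q -> lie x y \in Q) ->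
  exists z, [/\ z \in Q, z != 0 & exists mu : dual h, root_space mu z].
Proof.
move=> Q0 hQ.
pose good P := [/\ (P <= Q)%VS, P != 0%VS & forall x y, x \in h -> y \in P -> lie x y \in P].
have ex : exists n, `[< exists2 P, good P & \dim P = n >].
  by exists (\dim Q); apply/asboolP; exists Q.
have [n /asboolP [P [PQ P0 hP] dP] nmin] := ex_minnP ex.
have small P' : (P' <= P)%VS -> P' != 0%VS ->
    (forall x y, x \in h -> y \in P' -> lie x y \in P') -> P' = P.
  move=> P'P P'0 hP'; apply/eqP; rewrite eqEdim P'P dP /=; apply: nmin.
  by apply/asboolP; exists P' => //; split=> //; apply: subv_trans P'P PQ.
have scal k x : x \in iter k (lie_prod h) h -> exists c, forall p, p \in P -> lie x p = c *: p.
  have [_ [N hN] _] := h_cartan.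
  have [j] := ubnP (N - k)%N; elim: j k x => // j IH k x jk xk.
  have [Nk|kN] := leqP N k.
    have x0 : x = 0.
      apply/eqP; rewrite -memv0 -hN; apply: (subvP _ _ xk).
      rewrite -(subnK Nk) addnC; elim: (k - N)%N => [|i IHi]; first by rewrite addn0.
      rewrite addnS; apply: subv_trans IHi => /=.
      elim: (N + i)%N => [|i' IHi'] /=; first by apply: lie_prod_sub; apply: h_lie.
      apply: lie_prod_sub => u v uh /(subvP IHi') vin; exact: mem_lie_prod.
    by exists 0 => p _; rewrite x0 lie0l scale0r.
  have xh : x \in h := subvP (cartan_series_sub k) _ xk.
  have com y p : y \in h -> p \in P -> lie y (lie x p) = lie x (lie y p).
    move=> yh; have [||c hc] := IH k.+1 (lie y x); first by lia.
      exact: mem_lie_prod.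
    have c0 : c = 0.
      apply: (stable_commutator P0 (lie_linearr y) (lie_linearr x)) => q qP; try exact: hP.
      by rewrite -lieA hc.
    move=> pP; have := hc _ pP; rewrite c0 scale0r lieA => /eqP.
    by rewrite subr_eq0 => /eqP.
  have [c [v [vP v0 xv]]] := stable_eigenvector P0 (lie_linearr x) (fun p => hP x p xh).
  pose P' := (P :&: lker (ad x - c *: \1%VF))%VS.
  have inP' p : p \in P' = (p \in P) && (lie x p == c *: p).
    rewrite memv_cap memv_ker add_lfunE opp_lfunE scale_lfunE id_lfunE adE.
    by rewrite subr_eq0.
  have P'P : P' = P.
    apply: small; first exact: capvSl.
      by apply: contraNneq v0 => P'0; rewrite -memv0 -P'0 inP' vP xv eqxx.
    move=> y p yh; rewrite !inP' => /andP[pP /eqP xp]; rewrite hP //=.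
    by rewrite -com // xp (linZ (lie_linearr y)).
  exists c => p pP; have : p \in P' by rewrite P'P.
  by rewrite inP' => /andP[_ /eqP].
pose z := vpick P; have zP : z \in P := memv_pick P.
have z0 : z != 0 by rewrite vpick0.
exists z; split=> //; first exact: (subvP PQ).
have ex1 (y : subvs_of h) : exists c : K, lie (vsval y) z = c *: z.
  by have [c hc] := scal 0%N _ (subvsP y); exists c; apply: hc.
pose m (y : subvs_of h) : K^o := proj1_sig (cid (ex1 y)).
have mE (y : subvs_of h) : lie (vsval y) z = (m y : K) *: z by rewrite /m; case: cid.
have lm : linear m.
  move=> a u v; apply/eqP; rewrite -subr_eq0; apply/eqP.
  have : (m (a *: u + v) - (a *: m u + m v) : K) *: z = 0.
    rewrite scalerBl scalerDl -mE linearP lie_linearl !mE scalerA.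
    by rewrite subrr.
  by move/eqP; rewrite scaler_eq0 (negPf z0) orbF => /eqP.
pose m' : {linear subvs_of h -> K^o} := HB.pack m (GRing.isLinear.Build K _ _ *:%R m lm).
by exists (linfun m') => y; rewrite lfunE mE.
Qed.

Variable D : seq (dual h).
Hypothesis D_base : root_base D.

Lemma dual_eq0 (y : subvs_of h) : (forall i : nat, (i < size D)%N -> D`_i y = 0) -> y = 0.
Proof.
move=> Dy; apply: contrapT => /eqP /nonzero_functional [phi lphi phi1].
pose phi' : {linear subvs_of h -> K^o} := HB.pack phi (GRing.isLinear.Build K _ _ *:%R phi lphi).
have : (linfun phi' : dual h) y = 0.
  have [Db _ _] := D_base.
  have : (linfun phi' : dual h) \in <<D>>%VS by rewrite (span_basis Db) memvf.
  have -> : D = in_tuple D by [].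
  move=> /coord_span ->; rewrite sum_lfunE big1 // => i _.
  by rewrite scale_lfunE Dy // scaler0.
by rewrite lfunE /= phi1 => /eqP; rewrite oner_eq0.
Qed.

Lemma dim_Hom (U V : vectType K) : \dim {:'Hom(U, V)} = (\dim {:U} * \dim {:V})%N.
Proof. by rewrite !dimvf. Qed.

Lemma base_dual_exists (r : 'I_(size D) -> K) : exists y : subvs_of h,
  forall i : 'I_(size D), D`_i y = r i.
Proof.
pose f (y : subvs_of h) : 'rV[K]_(size D) := \row_i (D`_i y : K).
have lf : linear f by move=> a u v; apply/rowP => i; rewrite !mxE linearP.
have [||y fy] := @linear_inj_surj K _ _ f lf _ _ (\row_i r i).
- move=> y /rowP fy; apply: dual_eq0 => i iD.
  by have := fy (Ordinal iD); rewrite !mxE.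
- have [/andP[/eqP spD frD] _ _] := D_base; rewrite [RHS]dimvf /dim /= mul1n.
  rewrite -(eqP frD) spD; have := dim_Hom (subvs_of h) K^o.
  by rewrite (dimvf K^o) /dim /= muln1 => ->.
- by exists y => i; have /rowP /(_ i) := fy; rewrite !mxE.
Qed.

(** This [y0] is the sum of the fundamental coweights: a root takes its height as value there. *)
Lemma height_exists : exists y0 : subvs_of h, forall i : 'I_(size D), D`_i y0 = 1.
Proof. exact: base_dual_exists. Qed.

Section Height.
Variable y0 : subvs_of h.
Hypothesis y0D : forall i : 'I_(size D), D`_i y0 = 1.

Lemma nonneg_comb_height mu : nonneg_comb D mu -> exists k : nat,
  mu y0 = k%:R /\ (k = 0%N -> mu = 0).
Proof.
move=> [c ->]; exists (\sum_i c i)%N; split.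
  rewrite sum_lfunE natr_sum; apply: eq_bigr => i _.
  have -> : (D`_i *+ c i) y0 = D`_i y0 *+ c i.
    by elim: (c i) => [|n IH]; rewrite ?mulr0n ?zero_lfunE // !mulrS add_lfunE IH.
  by rewrite y0D.
move/eqP; rewrite sum_nat_eq0 => /forallP c0; apply: big1 => i _.
by have /eqP -> := c0 i; rewrite mulr0n.
Qed.

(** A nonzero weight is a root, hence a combination of the base with coefficients of one sign, and
    this sign is visible in its value at [y0]. *)
Lemma weight_height mu z : root_space mu z -> z != 0 -> exists k : int,
  [/\ mu y0 = k%:~R, k = 0 -> mu = 0 & 0 < k -> is_root mu /\ nonneg_comb D mu].
Proof.
move=> muz z0; have [mu0|mu0] := eqVneq mu 0.
  by exists 0; rewrite mu0 zero_lfunE; split.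
have rmu : is_root mu by split=> //; exists z.
have [_ _ Dpm] := D_base; case: (Dpm _ rmu) => c.
  by have [k [ke k0]] := nonneg_comb_height c; exists k; split=> // [] [/k0].
have [k [ke k0]] := nonneg_comb_height c; exists (- k%:Z); split.
- by rewrite mulrNz -pmulrn -ke opp_lfunE opprK.
- move=> k00; rewrite -[mu]opprK k0 ?oppr0 //; lia.
- by lia.
Qed.

Lemma height_gen_eigen c z : gen_eigen (lie (vsval y0)) c z -> z != 0 ->
  exists k : int, c = k%:~R.
Proof.
move=> cz z0; have ly := lie_linearr (vsval y0).
have [Q QE] := subspace_vspace (gen_eigen_subspace ly c).
have [||u [uQ u0 [mu muu]]] := @joint_eigenvector Q.
- by apply: contraNneq z0 => Q0; rewrite -memv0 -Q0; apply/QE.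
- move=> x u xh /QE uQ; apply/QE; rewrite -[c]add0r; apply: gen_eigen_lie => //.
  by apply: cartan_gen_eigen => //; apply: subvsP.
have [k [ke _ _]] := weight_height muu u0; exists k; rewrite -ke.
apply: contrapT => /eqP ne; case/eqP: u0.
apply: (gen_eigen_disjoint ly ne ((QE u).1 uQ)).
by apply: eigen_gen; apply: muu.
Qed.

End Height.

Hypothesis g_simple : simple g.

(** An empty base means h = 0, whose normaliser is all of [g], against self-normalisation. *)
Lemma cartan_base_neq0 : (0 < size D)%N.
Proof.
rewrite lt0n; apply/eqP => D0; have [[x [y xy]] _] := g_simple.
have h0 z : z \in h -> z = 0.
  move=> zh; rewrite -[z](vsprojK zh) (@dual_eq0 (vsproj h z)) ?linear0 // => i.
  by rewrite D0.
have [_ _ self] := h_cartan; case/eqP: xy.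
have -> : x = 0; last by rewrite lie0l.
apply: (h0); apply: self => u /h0 ->.
by rewrite (lin0 (lie_linearr _)) mem0v.
Qed.

(** [ad y0] has integer eigenvalues, not all zero, so [killing y0 y0 > 0], while
    the radical of the Killing form is an ideal. *)
Lemma killing_nondegenerate x : (forall z, killing x z = 0) -> x = 0.
Proof.
have [y0 y0D] := height_exists.
have y0n : killing (vsval y0) (vsval y0) != 0.
  have eb := vbasisP {:g}; rewrite /killing (mxof_comp _ _ eb).
  have eigE c : eigenvalue (mxof (vbasis {:g}) (vbasis {:g}) (ad (vsval y0))) c <->
      exists2 z, z != 0 & lie (vsval y0) z = c *: z.
    split=> [/eigenvalueP [v vc v0]|[z z0 zc]].
      exists (vecof (vbasis {:g}) v); first by rewrite vecof_eq0.
      apply: (can_inj (rVofK eb)); rewrite -adE (rVof_app _ eb) vecofK // vc.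
      by rewrite linearZ /= vecofK.
    apply/eigenvalueP; exists (rVof (vbasis {:g}) z); last by rewrite rVof_eq0.
    by rewrite -(rVof_app _ eb) adE zc linearZ.
  apply: mx_trace_sq_neq0 => [c /eigE [z z0 zc]|].
    exact: (height_gen_eigen y0D (eigen_gen zc)) z0.
  exists 1; first exact: oner_neq0.
  have [_ Droot _] := D_base; have D0 := cartan_base_neq0.
  have [_ [z z0 rz]] := Droot _ (mem_nth 0 D0).
  by apply/eigE; exists z => //; rewrite rz (y0D (Ordinal D0)).
have sR : subspace [set x | forall z, killing x z = 0].
  split=> [z|a u v uz vz z] /=; first exact: (lin0 (killing_linearl z)).
  by rewrite killing_linearl uz vz scaler0 addr0.
have [R RE] := subspace_vspace sR.
have [_ ideals] := g_simple.
have [|R0|RT] := ideals R.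
- move=> u v /RE vR; apply/RE => z.
  by rewrite killingC -killing_lie killingC vR.
- by move=> xR; apply/eqP; rewrite -memv0 -R0; apply/RE.
- have /RE z : vsval y0 \in R by rewrite RT memvf.
  by rewrite z eqxx in y0n.
Qed.

Lemma killing_represent (phi : g -> K^o) : linear phi ->
  exists z, forall x, killing z x = phi x.
Proof.
move=> lphi.
pose phi' : {linear g -> K^o} := HB.pack phi (GRing.isLinear.Build K g K^o *:%R phi lphi).
pose kl z : {linear g -> K^o} :=
  HB.pack (killing z : g -> K^o) (GRing.isLinear.Build K g K^o *:%R _ (killing_linearr z)).
have klE z x : (linfun (kl z) : 'Hom(g, K^o)) x = killing z x by rewrite lfunE.
have [|z0 z||z hz] := @linear_inj_surj K g 'Hom(g, K^o) (fun z => linfun (kl z)) _ _ _ (linfun phi').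
- move=> a u v; apply/lfunP => x.
  by rewrite add_lfunE scale_lfunE !klE killing_linearl.
- by apply: killing_nondegenerate => x; rewrite -klE z zero_lfunE.
- by rewrite dim_Hom (dimvf K^o) /dim /= muln1.
- by exists z => x; rewrite -klE hz lfunE.
Qed.

Definition endo_trace (f : 'End(g)) : K := \tr (mxof (vbasis {:g}) (vbasis {:g}) f).

Lemma endo_trace_linear : linear (endo_trace : 'End(g) -> K^o).
Proof. by move=> a u v; rewrite /endo_trace !linearP. Qed.

Lemma endo_traceC (u v : 'End(g)) : endo_trace (u \o v)%VF = endo_trace (v \o u)%VF.
Proof.
have eb := vbasisP {:g}.
by rewrite /endo_trace !(mxof_comp _ _ eb) mxtrace_mulC.
Qed.

(** Let [z] represent the form x -> tr (S ad x). For E = S - ad z all traces tr (E ad u) vanish and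
    ad (E x) = [E, ad x]. Hence [killing (E x) y] equals tr (E [ad x, ad y]) = 0. *)
Lemma derivation_inner (S : g -> g) : linear S ->
  (forall x y, S (lie x y) = lie (S x) y + lie x (S y)) ->
  exists z, forall x, S x = lie z x.
Proof.
move=> lS dS.
pose S' : {linear g -> g} := HB.pack S (GRing.isLinear.Build K g g *:%R S lS).
have [|z hz] := @killing_represent (fun x => endo_trace (linfun S' \o ad x)%VF).
  move=> a u v; rewrite ad_linear comp_lfunDr -comp_lfunZr.
  exact: endo_trace_linear.
exists z => x; apply/eqP; rewrite -subr_eq0; apply/eqP/killing_nondegenerate => y.
pose E := linfun S' - ad z.
have EE u : E u = S u - lie z u by rewrite add_lfunE opp_lfunE lfunE adE.
have trE u : endo_trace (E \o ad u)%VF = 0.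
  rewrite comp_lfunDl comp_lfunNl (linD endo_trace_linear) (linN endo_trace_linear).
  by rewrite -hz subrr.
have adE' : ad (E x) = (E \o ad x)%VF - (ad x \o E)%VF.
  apply/lfunP => u; rewrite add_lfunE opp_lfunE !comp_lfunE !adE !EE.
  rewrite dS lieDl (linN (lie_linearl u)) (linD (lie_linearr x)) (linN (lie_linearr x)).
  rewrite (lieA z x u) !opprB.
  move: (lie (S x) u) (lie x (S u)) (lie z (lie x u)) (lie x (lie z u)) => p q r t.
  by rewrite -[RHS]addrA [- r + _]addrA [RHS]addrACA subrr addr0 [- r + t]addrC.
rewrite -EE /killing -/(endo_trace _) adE' comp_lfunDl comp_lfunNl.
rewrite (linD endo_trace_linear) (linN endo_trace_linear).
rewrite -!comp_lfunA (endo_traceC (ad x)) -!comp_lfunA.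
rewrite -(linN endo_trace_linear) -(linD endo_trace_linear).
by rewrite -comp_lfunNr -comp_lfunDr -ad_lie trE.
Qed.

(** The semisimple part of [ad y] is a derivation, hence [ad z] for some [z]; it
    vanishes on [h], so [z] is in [h], and [z] and [y] have the same values under
    the roots of the base, so [z = y]. *)
Lemma cartan_semisimple y c x : y \in h -> gen_eigen (lie y) c x -> lie y x = c *: x.
Proof.
move=> yh; have ly := lie_linearr y.
have [S lS Sgen] := semisimple_part ly; have [s us dec] := gen_eigen_decomp ly.
have [|z Sz] := derivation_inner lS.
  move=> u v; have [f [fg ->]] := dec u; have [k [kg ->]] := dec v.
  have E1 (w : g) : S (lie (\sum_(c <- s) f c) w) = \sum_(c <- s) S (lie (f c) w).
    by rewrite (linear_sum_fun (lie_linearl w)) (linear_sum_fun lS).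
  rewrite E1 (linear_sum_fun lS) (linear_sum_fun (lie_linearl _)).
  rewrite [X in _ = _ + X](linear_sum_fun (lie_linearl _)) -big_split /=.
  apply: eq_bigr => a _.
  rewrite !(linear_sum_fun (lie_linearr _)) (linear_sum_fun lS).
  rewrite (linear_sum_fun lS) (linear_sum_fun (lie_linearr _)) -big_split /=.
  apply: eq_bigr => b _.
  rewrite (Sgen _ _ (gen_eigen_lie (fg a) (kg b))) (Sgen _ _ (fg a)) (Sgen _ _ (kg b)).
  by rewrite lieZl (linZ (lie_linearr _)) scalerDl.
have zh : z \in h.
  have [_ _ self] := h_cartan; apply: self => u uh; rewrite -Sz.
  by rewrite (Sgen 0) ?scale0r ?mem0v //; apply: cartan_gen_eigen.
have zy : vsproj h z = vsproj h y.
  apply/eqP; rewrite -subr_eq0; apply/eqP; apply: dual_eq0 => i iD.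
  have [_ Droot _] := D_base; have [_ [e e0 re]] := Droot _ (mem_nth 0 iD).
  have yz := re (vsproj h y); have zz := re (vsproj h z).
  rewrite !vsprojK // in yz zz.
  have := Sgen _ _ (eigen_gen yz); rewrite Sz zz => /eqP.
  rewrite -subr_eq0 -scalerBl scaler_eq0 (negPf e0) orbF => /eqP zy.
  by rewrite linearB.
have {}zy : z = y by rewrite -(vsprojK zh) zy vsprojK.
by move=> gx; rewrite -zy -Sz; apply: Sgen.
Qed.

(** The elements of a basis of [h] are diagonalised one after another. Splitting a vector under a
    new one keeps the eigenvalues already found, because the other elements preserve the generalized
    eigenspaces and components are unique. *)
Lemma weight_span (P : set g) : subspace P ->
  (forall (mu : dual h) z, root_space mu z -> P z) -> forall x, P x.
Proof.
move=> sP Pz.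
have joint (l : seq g) : (forall y, y \in l -> y \in h) -> forall Q : set g, subspace Q ->
    (forall z, (forall y, y \in l -> exists a, lie y z = a *: z) -> Q z) -> forall x, Q x.
  elim: l => [_ Q sQ Qz x|y l IH lh Q sQ Qz]; first by apply: Qz.
  have yh : y \in h by apply: lh; rewrite mem_head.
  have lh' u : u \in l -> u \in h by move=> ul; apply: lh; rewrite inE ul orbT.
  have ly := lie_linearr y; have [s us dec] := gen_eigen_decomp ly.
  apply: (IH lh' Q sQ) => z jz.
  have [f [fg zf]] := dec z; rewrite zf big_seq; apply: subspace_sum => // c cs.
  apply: Qz => u; rewrite inE => /orP[/eqP ->|ul].
    by exists c; apply: cartan_semisimple.
  have [a ua] := jz u ul; exists a; apply/eqP; rewrite -subr_eq0; apply/eqP.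
  apply: (gen_eigen_indep ly (c := id) (f := fun c => lie u (f c) - a *: f c) us) cs => //.
    move=> d _; apply: subspaceB; first exact: gen_eigen_subspace.
      by have := gen_eigen_lie (cartan_gen_eigen yh (lh' _ ul)) (fg d); rewrite add0r.
    by apply: subspaceZ => //; apply: gen_eigen_subspace.
  by rewrite sumrB -scaler_sumr -(linear_sum_fun (lie_linearr u)) -zf ua subrr.
apply: (joint (vbasis h)) => // [y|z jz]; first exact: vbasis_mem.
have [->|z0] := eqVneq z 0; first exact: subspace0.
(* The line of [z] is stable under [h]; [joint_eigenvector] turns the separate eigenvalues into a
   linear weight. *)
have [||u [/vlineP [c uc] u0 [mu muu]]] := @joint_eigenvector <[z]>%VS.
- by rewrite -subv0; apply: contraNN z0 => /subvP /(_ z (memv_line z)); rewrite memv0.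
- move=> x _ xh /vlineP [c ->]; rewrite (linZ (lie_linearr x)); apply: memvZ.
  rewrite (coord_vbasis xh) (linear_sum_fun (lie_linearl z)); apply: memv_suml => i _.
  rewrite lieZl; have [|a ->] := jz (vbasis h)`_i.
    by apply: mem_nth; rewrite size_tuple.
  by rewrite scalerA; apply: memvZ; apply: memv_line.
have c0 : c != 0 by apply: contra_neq u0 => c0; rewrite uc c0 scale0r.
have -> : z = c^-1 *: u by rewrite uc scalerA mulVf // scale1r.
by apply: subspaceZ => //; apply: Pz muu.
Qed.

Lemma weight_zero z : root_space (0 : dual h) z -> z \in h.
Proof.
move=> z0; have [_ _ self] := h_cartan; apply: self => y yh.
have := z0 (vsproj h y); rewrite vsprojK // zero_lfunE scale0r => yz.
by rewrite lieC yz oppr0 mem0v.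
Qed.

Lemma root_space_lie (mu nu : dual h) x z : root_space mu x -> root_space nu z ->
  root_space (mu + nu) (lie x z).
Proof.
move=> mx nz y; rewrite -[lie (vsval y) _](subrK (lie x (lie (vsval y) z))) -lieA.
by rewrite mx nz lieZl (linZ (lie_linearr x)) add_lfunE -scalerDl.
Qed.

Lemma killing_root_space (mu nu : dual h) x z : root_space mu x -> root_space nu z ->
  killing x z != 0 -> mu + nu = 0.
Proof.
move=> mx nz k0; apply/lfunP => y; rewrite add_lfunE zero_lfunE.
have := killing_lie x (vsval y) z; rewrite nz lieC mx.
rewrite (linN (killing_linearl z)) (linZ (killing_linearl z)) (linZ (killing_linearr x)).
move/esym/eqP; rewrite -subr_eq0 opprK -mulrDl mulf_eq0 (negPf k0) orbF addrC.
by move/eqP.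
Qed.

End Cartan.
End LieStructure.

(** * Gradings of g and of the affine algebra *)

Section DirectSum.
Variables (K : fieldType) (L : lieAlgType K) (M N : lieModule L).

Definition dsum_act (x : L) (p : M * N) : (M * N)%type := (act x p.1, act x p.2).

Lemma dsum_act_linearl p : linear (dsum_act^~ p).
Proof. by move=> a x y; rewrite /dsum_act !act_linearl. Qed.

Lemma dsum_act_linearr x : linear (dsum_act x).
Proof. by move=> a p q; rewrite /dsum_act /= !act_linearr. Qed.

Lemma dsum_act_lie x y p :
  dsum_act (lie x y) p = dsum_act x (dsum_act y p) - dsum_act y (dsum_act x p).
Proof. by rewrite /dsum_act /= !act_lie. Qed.

Definition dsumModule : lieModule L :=
  LieModule dsum_act_linearl dsum_act_linearr dsum_act_lie.

End DirectSum.

Section LspanFacts.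
Variables (K : fieldType) (V : lmodType K).

Lemma lspan_ind (A P : set V) : subspace P -> (forall x, A x -> P x) ->
  forall x, lspan A x -> P x.
Proof.
move=> sP AP x [n [c [v [Av ->]]]]; apply: subspace_sum => // i _.
by apply: subspaceZ => //; apply: AP.
Qed.

Lemma lspan0 (A : set V) : lspan A 0.
Proof.
by exists 0%N, (fun=> 0), (fun=> 0); split; [case|rewrite big_ord0].
Qed.

Lemma lspan_mem (A : set V) x : A x -> lspan A x.
Proof.
move=> Ax; exists 1%N, (fun=> 1), (fun=> x); split=> //.
by rewrite big_ord1 scale1r.
Qed.

End LspanFacts.

Lemma act_kernel_subspace (K : fieldType) (L : lieAlgType K) (M : lieModule L) (m : M) :
  subspace [set x : L | act x m = 0].
Proof.
split=> [|a x y /= x0 y0]; first exact: act0l.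
by rewrite /= act_linearl x0 y0 scaler0 addr0.
Qed.

Lemma eqhom_submodule (K : fieldType) (L : lieAlgType K) (M : lieModule L)
  (f : M -> M) c : module_hom f -> submodule [set m | f m = c *: m].
Proof.
move=> [lf fx]; split=> [|a u v /= fu fv|x u /= fu].
- by rewrite /= (lin0 lf) scaler0.
- by rewrite /= lf fu fv scalerDr !scalerA mulrC.
- by rewrite /= fx fu (linZ (act_linearr x)).
Qed.

Section HatModules.
Variables (K : numFieldType) (g : finLieAlgType K).

Lemma hat_central_scalar (M : lieModule (hat g)) (v : M) c : generates v ->
  act (hcen g 1) v = c *: v -> forall b (m : M), act (hcen g b) m = (b * c) *: m.
Proof.
move=> gv vc b m.
have bE : hcen g b = b *: hcen g 1.
  by rewrite -(linZ (hcen_linear g)) /GRing.scale /= mulr1.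
have /gv /(_ vc) e : submodule [set m : M | act (hcen g 1) m = c *: m].
  apply: eqhom_submodule; split=> [|x u]; first exact: act_linearr.
  have := act_lie (hcen g 1) x u; rewrite lie_hcenl act0l => /esym/eqP.
  by rewrite subr_eq0 => /eqP.
have : [set: M] m by []; rewrite -e /= => mc.
by rewrite bE actZl mc scalerA.
Qed.

Lemma smooth_generated (M : lieModule (hat g)) (v : M) (R : nat) : generates v ->
  (forall (x : g) (k : nat), (R <= k)%N -> act (hmon x k%:Z) v = 0) -> smooth M.
Proof.
move=> gv vR.
suff e : [set m : M | exists R : nat, forall (x : g) (k : nat), (R <= k)%N ->
    act (hmon x k%:Z) m = 0] = setT by move=> m; have : [set: M] m by []; rewrite -e.
apply: gv; last by exists R.
split=> [|a u w [p up] [q wq]|y u [p up]].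
- by exists 0%N => x k _; apply: act_linear0.
- exists (maxn p q) => x k; rewrite geq_max => /andP[pk qk].
  by rewrite act_linearr up // wq // scaler0 addr0.
apply: (@hat_span _ _ [set y | exists R : nat, forall (x : g) (k : nat), (R <= k)%N ->
    act (hmon x k%:Z) (act y u) = 0]) => [|z l|].
- split=> [|a u' w [r ur] [s ws]].
    by exists 0%N => x k _; rewrite act0l; apply: act_linear0.
  exists (maxn r s) => x k; rewrite geq_max => /andP[rk sk].
  by rewrite act_linearl act_linearr ur // ws // scaler0 addr0.
(* With this bound k + l is at least [p], and the extra 1 keeps it nonzero, so the bracket has no
   central term. *)
- exists (p + absz l).+1 => x k pk.
  have [j kl] : exists j : nat, k%:Z + l = j%:Z by exists (absz (k%:Z + l)); lia.
  have := act_lie (hmon x k%:Z) (hmon z l) u.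
  rewrite lie_hmon_neq0; last by lia.
  rewrite kl up; last by lia.
  rewrite (up x k); last by lia.
  by rewrite act_linear0 subr0.
- exists p => x k pk; have := act_lie (hmon x k%:Z) (hcen g 1) u.
  by rewrite lie_hcenr act0l up // act_linear0 subr0.
Qed.

End HatModules.

(** * The height grading of g and the principal grading of the affine algebra *)

Section Gradings.
Variables (K : numClosedFieldType) (g : finLieAlgType K).
Hypothesis g_simple : simple g.
Variable h : {vspace g}.
Hypothesis h_cartan : cartan_subalgebra h.
Variable D : seq (dual h).
Hypothesis D_base : root_base D.
Variable y0 : subvs_of h.
Hypothesis y0D : forall i : 'I_(size D), D`_i y0 = 1.

(** Single weight vectors instead of all eigenvectors of ad y0: in positive degree they are zero or
    positive root vectors. *)
Definition ghom (k : int) (x : g) : Prop :=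
  exists2 mu : dual h, root_space mu x & mu y0 = k%:~R.

Lemma ghom0 : ghom 0 0.
Proof.
exists 0; last by rewrite zero_lfunE.
by move=> y; rewrite zero_lfunE scale0r (lin0 (lie_linearr _)).
Qed.

Lemma ghom_lie k l x y : ghom k x -> ghom l y -> ghom (k + l) (lie x y).
Proof.
move=> [mu mx mk] [nu ny nl]; exists (mu + nu); first exact: root_space_lie.
by rewrite add_lfunE mk nl intrD.
Qed.

Lemma ghom_span (P : set g) : subspace P -> (forall k x, ghom k x -> P x) -> forall x, P x.
Proof.
move=> sP Pk; apply: (weight_span h_cartan D_base g_simple sP) => mu z mz.
have [->|z0] := eqVneq z 0; first exact: subspace0.
have [k [ke _ _]] := weight_height D_base y0D mz z0.
by apply: (Pk k); exists mu.
Qed.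

Lemma ghom_height k x : ghom k x -> lie (vsval y0) x = k%:~R *: x.
Proof. by move=> [mu mx mk]; rewrite mx mk. Qed.

Lemma ghom_pos k x : ghom k x -> 0 < k -> nplus D x.
Proof.
move=> [mu mx mk] k0; have [->|x0] := eqVneq x 0; first exact: lspan0.
have [l [le _ lpos]] := weight_height D_base y0D mx x0.
have kl : k = l by apply: (@intr_inj K); rewrite -mk -le.
have [rmu nmu] : is_root mu /\ nonneg_comb D mu by apply: lpos; rewrite -kl.
by apply: lspan_mem; exists mu.
Qed.

Lemma ghom_zero x : ghom 0 x -> x \in h.
Proof.
move=> [mu mx mk]; have [->|x0] := eqVneq x 0; first exact: mem0v.
have [l [le l0 _]] := weight_height D_base y0D mx x0.
have l00 : l = 0 by apply: (@intr_inj K); rewrite -le mk.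
by apply: (weight_zero h_cartan); rewrite -(l0 l00).
Qed.

Lemma ghom_killing k l x y : ghom k x -> ghom l y -> killing x y != 0 -> k + l = 0.
Proof.
move=> [mu mx mk] [nu ny nl] k0; apply: (@intr_inj K).
have := killing_root_space mx ny k0 => /(congr1 (fun f : dual h => f y0)).
by rewrite add_lfunE zero_lfunE mk nl intrD.
Qed.

Lemma positive_root_height (al : dual h) x : is_root al -> nonneg_comb D al ->
  root_space al x -> exists2 k : int, 0 < k & ghom k x.
Proof.
move=> [al0 _] nal rx; have [k [ke k0]] := nonneg_comb_height y0D nal.
exists k%:Z; last by exists al.
rewrite ltz_nat lt0n; apply: contra_neq al0 => k00; exact: k0.
Qed.

(** In infinite dimension an endomorphism need not have an eigenvalue a priori. But it sends the
    generator to a singular vector, hence to a multiple of the generator by [irreducible_singular];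
    the degree operator is [y0] minus its eigenvalue on [v]. *)
Lemma irreducible_highest_weight_schur lam (M : lieModule g) :
  irreducible M -> highest_weight D lam M -> schur M.
Proof.
move=> irrM [v [v0 gv vpos vlam]] f hf; have [lf fx] := hf.
pose T (m : M) : M := act (vsval y0) m - (lam y0 : K) *: m.
have lT : linear T.
  move=> a u w; rewrite /T act_linearr !scalerDr !scalerA [_ * a]mulrC.
  by rewrite scalerN scalerA opprD addrACA.
have TX k x m : ghom k x -> T (act x m) = k%:~R *: act x m + act x (T m).
  move=> kx; rewrite /T (linD (act_linearr x)) (linN (act_linearr x)).
  rewrite (linZ (act_linearr x)) addrA; congr (_ - _).
  by rewrite -actZl -(ghom_height kx) act_lie subrK.
have Tv : T v = 0 by rewrite /T vlam subrr.
have sv : singular ghom v by move=> k x kx k0; apply/vpos/(ghom_pos kx).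
have zv x : ghom 0 x -> exists c, act x v = c *: v.
  move=> /ghom_zero xh; exists (lam (vsproj h x)).
  by rewrite -vlam vsprojK.
have sfv : singular ghom (f v).
  by move=> k x kx k0; rewrite -fx (sv _ _ kx k0) (lin0 lf).
have [c fv] := irreducible_singular ghom_lie ghom_span lT TX irrM Tv v0 sv zv sfv.
exists c => m; have e := gv _ (eqhom_submodule c hf) fv.
by have : [set: M] m by []; rewrite -e.
Qed.

Lemma ghom_bounded : exists N : nat, forall k x, ghom k x -> x != 0 -> (absz k < N)%N.
Proof.
have ly := lie_linearr (vsval y0); have [s us dec] := gen_eigen_decomp ly.
have [N hN] : exists N : nat, forall k : int, k%:~R \in s -> (absz k < N)%N.
  elim: (s) => [|c l [N hN]]; first by exists 0%N.
  have [[k ck]|nk] := pselect (exists k : int, c = k%:~R).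
    exists (maxn N (absz k).+1) => j; rewrite inE ck eqr_int => /orP[/eqP ->|/hN jN].
      exact: leq_maxr.
    exact: leq_trans jN (leq_maxl _ _).
  by exists N => k; rewrite inE => /orP[/eqP ck|/hN //]; case: nk; exists k.
exists N => k x kx x0; apply/hN/(gen_eigen_mem ly us dec _ x0).
exact/eigen_gen/ghom_height.
Qed.

Section HatGrading.
Variable N : nat.
Hypothesis N_bound : forall k x, ghom k x -> x != 0 -> (absz k < N)%N.

(** The principal grading of [hat g], up to scale: [x t^k] with [x] of height
    [c] has degree [k N + c]. *)
Definition hhom (n : int) (u : hat g) : Prop :=
  exists x k c b, [/\ ghom c x, n = k * N%:Z + c, u = hmon x k + hcen g b &
    b = 0 \/ (k = 0 /\ c = 0)].

Lemma hcen0 : hcen g 0 = 0. Proof. exact: (lin0 (hcen_linear g)). Qed.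

Lemma hmon0 k : hmon (0 : g) k = 0. Proof. by have := lin0 (@hmon_linear _ g k). Qed.

Lemma hhom_hmon k c x : ghom c x -> hhom (k * N%:Z + c) (hmon x k).
Proof. by move=> cx; exists x, k, c, 0; split=> //; rewrite ?hcen0 ?addr0 //; left. Qed.

Lemma hhom_lie n n' u v : hhom n u -> hhom n' v -> hhom (n + n') (lie u v).
Proof.
move=> [x [k [c [b [cx -> -> _]]]]] [y [l [d [b' [dy -> -> _]]]]].
exists (lie x y), (k + l), (c + d), (if k + l == 0 then k%:~R * killing x y else 0).
split.
- exact: ghom_lie.
- by rewrite mulrDl addrACA.
- by rewrite lieDl !(linD (lie_linearr _)) !(lie_hcenl, lie_hcenr) !addr0 lie_hmon.
case: eqP => kl; last by left.
have [->|k0] := eqVneq (killing x y) 0; first by left; rewrite mulr0.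
by right; split=> //; apply: ghom_killing k0.
Qed.

Lemma hhom_span (P : set (hat g)) : subspace P -> (forall n u, hhom n u -> P u) ->
  forall u, P u.
Proof.
move=> sP Pn; apply: hat_span => // [x k|].
  apply: (@ghom_span [set x | P (hmon x k)]) => [|c z cz].
    split=> [|a u v Pu Pv] /=; first by rewrite hmon0; apply: subspace0.
    by rewrite hmon_linear; case: sP => _; apply.
  exact: Pn (hhom_hmon k cz).
apply: (Pn 0); exists 0, 0, 0, 1; split=> //; rewrite ?hmon0 ?add0r //.
  exact: ghom0.
by right.
Qed.

Lemma tilde_nplus_hmon x k : 0 < k -> tilde_nplus D (hmon x k).
Proof. by move=> k0; apply: lspan_mem; right; exists x, k. Qed.

(** Heights are below [N] in absolute value, so k N + c is positive exactly when k > 0, or k = 0 and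
    c > 0. *)
Lemma hhom_pos n u : hhom n u -> 0 < n -> tilde_nplus D u.
Proof.
move=> [x [k [c [b [cx nE -> kc]]]]] n0.
have -> : b = 0 by case: kc => // -[k0 c0]; move: n0; rewrite nE k0 c0; lia.
rewrite hcen0 addr0; have [->|x0] := eqVneq x 0; first by rewrite hmon0; apply: lspan0.
have cN := N_bound cx x0.
have [k0|k0|k0] := ltgtP k 0.
- by exfalso; nia.
- exact: tilde_nplus_hmon.
- apply: lspan_mem; left; exists x; last by rewrite k0.
  by apply: (ghom_pos cx); move: n0; rewrite nE k0; lia.
Qed.

Lemma hhom_zero u : hhom 0 u -> exists p : subvs_of h * K^o, u = hat_cartan p.
Proof.
move=> [x [k [c [b [cx nE uE _]]]]].
have [x0|x0] := eqVneq x 0.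
  exists (0, b); rewrite uE x0 hmon0 add0r.
  have -> : hat_cartan (0 : subvs_of h, b : K^o) = (lmon (vsval (0 : subvs_of h)) 0, b) by [].
  by rewrite (linear0 (@vsval _ _ h)) lmon0.
have cN := N_bound cx x0.
have k0 : k = 0 by nia.
have c0 : c = 0 by lia.
exists (vsproj h x, b); rewrite uE k0 /hat_cartan /= vsprojK; last first.
  by apply: ghom_zero; rewrite -c0.
by congr pair; rewrite /= ?addr0 ?add0r.
Qed.

Section HighestWeight.
Variables (gam : hat_dual h) (M : lieModule (hat g)) (v : M).
Hypothesis v_hw : hat_highest_weight_vector D gam v.

Lemma hw_singular : singular hhom v.
Proof.
by case: v_hw => _ _ vpos _ n u nu n0; apply/vpos/(hhom_pos nu).
Qed.

Lemma hw_zero u : hhom 0 u -> exists c, act u v = c *: v.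
Proof.
case: v_hw => _ _ _ vgam /hhom_zero [p ->]; exists (gam p); exact: vgam.
Qed.

Lemma hw_gen_by m : gen_by v m.
Proof.
case: v_hw => _ gv _ _; have e := gv _ (gen_by_submodule v) (@gen_by_self _ _ _ v).
by have : [set: M] m by []; rewrite -e.
Qed.

Lemma hw_smooth : smooth M.
Proof.
case: v_hw => v0 gv vpos _; apply: (@smooth_generated _ _ M v 1) => // x k k0.
by apply/vpos/tilde_nplus_hmon; rewrite ltz_nat.
Qed.

(** Elements of positive principal degree span [tilde_nplus]. Each of them acts on [w] with
    eigenvalue 0, so [eta] would vanish. *)
Lemma hw_no_whittaker (eta : hat g -> K) (w : M) : whittaker_type D eta -> w != 0 ->
  ~ (forall u, tilde_nplus D u -> act u w = eta u *: w).
Proof.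
move=> [_ _ [u up un]] w0 wE; case/eqP: un.
have zero n z : hhom n z -> 0 < n -> act z w = 0.
  move=> nz n0; have zw := wE _ (hhom_pos nz n0).
  have := singular_no_eigenvalue hhom_lie hhom_span hw_singular (hw_gen_by w) w0 nz n0 zw.
  by rewrite zw => ->; rewrite scale0r.
have sk := act_kernel_subspace w.
have : act u w = 0.
  apply: (lspan_ind sk _ up) => z [[x xp <-]|[x [k [k0 ->]]]].
    have sk' : subspace [set x : g | act (hmon x 0) w = 0].
      split=> [|a p q /= pw qw]; first by rewrite /= hmon0 act0l.
      by rewrite /= hmon_linear act_linearl pw qw scaler0 addr0.
    apply: (lspan_ind sk' _ xp) => y [al [ral nal yal]].
    have [k k0 ky] := positive_root_height ral nal yal.
    by apply: (zero (0 * N%:Z + k)); [exact: hhom_hmon|rewrite mul0r add0r].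
  apply: (@ghom_span [set x : g | act (hmon x k) w = 0]) => [|c y cy].
    split=> [|a p q /= pw qw]; first by rewrite /= hmon0 act0l.
    by rewrite /= hmon_linear act_linearl pw qw scaler0 addr0.
  have [->|yn] := eqVneq y 0; first by rewrite /= hmon0 act0l.
  have cN := N_bound cy yn.
  by apply: (zero _ _ (hhom_hmon k cy)); nia.
rewrite (wE _ up) => /eqP; rewrite scaler_eq0 (negPf w0) orbF.
by move/eqP.
Qed.

(** The principal degree, [N] times the degree in t plus the height, normalised to be 0 on the
    highest weight vector. *)
Definition hw_degree (delta : M -> M) (m : M) : M :=
  N%:R *: delta m + (act (hmon (vsval y0) 0) m - (gam (y0, 0) : K) *: m).

Lemma hw_degree_op : graded_from v -> exists T : M -> M,
  [/\ linear T, T v = 0 & forall n u m, hhom n u ->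
    T (act u m) = n%:~R *: act u m + act u (T m)].
Proof.
move=> [delta [dx dv]]; exists (hw_degree delta); split.
- move=> a p q; rewrite /hw_degree linearP act_linearr.
  move: (act _ p) (act _ q) (delta p) (delta q) (gam _ : K) => yp yq dp dq c.
  have -> : a *: yp + yq - c *: (a *: p + q) = a *: (yp - c *: p) + (yq - c *: q).
    by rewrite scalerDr scalerBr !scalerA [c * a]mulrC opprD addrACA.
  by rewrite [a *: (_ + (_ - _))]scalerDr [N%:R *: _]scalerDr !scalerA [_ * a]mulrC addrACA.
- rewrite /hw_degree dv scaler0 add0r.
  case: v_hw => _ _ _ /(_ (y0, 0)); rewrite /hat_cartan /= => ->.
  by rewrite subrr.
move=> n u m [x [k [c [b [cx -> uE kc]]]]].
have du : hat_degree u = k%:~R *: u.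
  apply: hat_degree_hdeg; exists x, b; split=> // k0.
  by case: kc => // -[k00 _]; rewrite k00 eqxx in k0.
have yu : lie (hmon (vsval y0) 0) u = c%:~R *: u.
  rewrite uE (linD (lie_linearr _)) lie_hcenr addr0 lie_hmon add0r mul0r if_same.
  rewrite hcen0 addr0 (ghom_height cx) (linZ (@hmon_linear _ g k)) scalerDr.
  case: kc => [->|[_ ->]]; first by rewrite hcen0 scaler0 addr0.
  by rewrite !scale0r addr0.
rewrite /hw_degree dx du actZl !(linD (act_linearr u)) (linN (act_linearr u)).
rewrite !(linZ (act_linearr u)) intrD intrM !scalerDl scalerDr !scalerA.
have -> : act (hmon (vsval y0) 0) (act u m)
    = c%:~R *: act u m + act u (act (hmon (vsval y0) 0) m).
  by rewrite -actZl -yu act_lie subrK.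
rewrite [N%:R * _]mulrC -[(N%:Z)%:~R]pmulrn -!addrA; congr (_ + _).
by rewrite [LHS]addrCA.
Qed.

End HighestWeight.

Lemma hw_weight_unique gam gam' (M M' : lieModule (hat g)) (v : M) (v' : M') :
  hat_highest_weight_vector D gam v -> hat_highest_weight_vector D gam' v' ->
  irreducible M' -> graded_from v' -> lieModule_iso M M' -> gam = gam'.
Proof.
move=> hv hv' irr gr' /hom_of_iso [f [f' [[lf fx] [lf' _] fK _]]].
have [T [lT Tv TX]] := hw_degree_op hv' gr'.
have sf : singular hhom (f v).
  by move=> n u nu n0; rewrite -fx (hw_singular hv nu n0) (lin0 lf).
have [v0 _ _ vg] := hv; have [v'0 _ _ vg'] := hv'.
have [c fv] := irreducible_singular hhom_lie hhom_span lT TX irr Tv v'0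
  (hw_singular hv') (hw_zero hv') sf.
have c0 : c != 0.
  by apply: contra_neq v0 => c0; rewrite -[v]fK fv c0 scale0r (lin0 lf').
apply/lfunP => p; have := fx (hat_cartan p) v.
rewrite vg (linZ lf) fv (linZ (act_linearr _)) vg' !scalerA => /eqP.
rewrite -subr_eq0 -scalerBl scaler_eq0 (negPf v'0) orbF [_ * c]mulrC -mulrBr.
by rewrite mulf_eq0 (negPf c0) /= subr_eq0 => /eqP.
Qed.

Lemma hw_unique gam (M M' : lieModule (hat g)) (v : M) (v' : M') :
  hat_highest_weight_vector D gam v -> hat_highest_weight_vector D gam v' ->
  irreducible M -> irreducible M' -> graded_from v -> graded_from v' ->
  lieModule_iso M M'.
Proof.
move=> hv hv' [_ irr] [_ irr'] gr gr'.
have [T [lT Tv TX]] := hw_degree_op hv gr; have [T' [lT' Tv' TX']] := hw_degree_op hv' gr'.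
have [v0 gv _ vg] := hv; have [v'0 gv' _ vg'] := hv'.
pose S := dsumModule M M'; pose w : S := (v, v').
pose TS (p : S) : S := (T p.1, T' p.2).
have lTS : linear TS by move=> a p q; rewrite /TS /= lT lT'.
have TSX n u (p : S) : hhom n u -> TS (act u p) = n%:~R *: act u p + act u (TS p).
  by move=> nu; congr pair; rewrite /= ?(TX _ _ _ nu) ?(TX' _ _ _ nu).
have TSw : TS w = 0 by rewrite /TS /= Tv Tv'.
have sw : singular hhom w.
  move=> n u nu n0; congr pair; [exact: (hw_singular hv nu n0)|exact: (hw_singular hv' nu n0)].
have zw u : hhom 0 u -> exists c, act u w = c *: w.
  by move=> /hhom_zero [p ->]; exists (gam p); congr pair; [exact: vg|exact: vg'].
have sP := gen_by_submodule w; have Pw : gen_by w w := @gen_by_self _ _ _ w.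
have [P0 Pl Px] := sP.
have PlE a (p q : M) (p' q' : M') : gen_by w (p, p') -> gen_by w (q, q') ->
    gen_by w (a *: p + q, a *: p' + q') by exact: Pl.
have PxE x (p : M) (p' : M') : gen_by w (p, p') -> gen_by w (act x p, act x p').
  exact: Px.
have ker p : gen_by w p -> TS p = 0 -> exists c, p = c *: w.
  exact: (degree_op_kernel hhom_lie hhom_span lTS TSX TSw sw zw).
(* Otherwise irreducibility of [M] puts (v, 0) into the submodule. It has degree zero, so [ker]
   makes it a multiple of (v, v'), which is impossible. *)
have inj1 (m : M) : gen_by w (m, 0 : M') -> m = 0.
  have sub : submodule [set m : M | gen_by w (m, 0 : M')].
    split=> [//|a p q Pp Pq|x p Pp] /=.
      by have := PlE a _ _ _ _ Pp Pq; rewrite scaler0 addr0.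
    by have := PxE x _ _ Pp; rewrite act_linear0.
  case: (irr _ sub) => e.
    by move=> Pm; have : [set m : M | gen_by w (m, 0 : M')] m by []; rewrite e.
  have Pv : [set m : M | gen_by w (m, 0 : M')] v by rewrite e.
  have [|c [vc /esym v'c]] := ker _ Pv; first by rewrite /TS /= Tv (lin0 lT').
  move/eqP: v'c; rewrite scaler_eq0 (negPf v'0) orbF => /eqP c0.
  by move: v0; rewrite vc c0 scale0r eqxx.
have inj2 (m : M') : gen_by w (0 : M, m) -> m = 0.
  have sub : submodule [set m : M' | gen_by w (0 : M, m)].
    split=> [//|a p q Pp Pq|x p Pp] /=.
      by have := PlE a _ _ _ _ Pp Pq; rewrite scaler0 addr0.
    by have := PxE x _ _ Pp; rewrite act_linear0.
  case: (irr' _ sub) => e.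
    by move=> Pm; have : [set m : M' | gen_by w (0 : M, m)] m by []; rewrite e.
  have Pv : [set m : M' | gen_by w (0 : M, m)] v' by rewrite e.
  have [|c [/esym vc v'c]] := ker _ Pv; first by rewrite /TS /= Tv' (lin0 lT).
  move/eqP: vc; rewrite scaler_eq0 (negPf v0) orbF => /eqP c0.
  by move: v'0; rewrite v'c c0 scale0r eqxx.
have tot1 (m : M) : exists m' : M', gen_by w (m, m').
  have /gv e : submodule [set m : M | exists m' : M', gen_by w (m, m')].
    split=> [|a p q [p' Pp] [q' Pq]|x p [p' Pp]]; first by exists 0.
      by exists (a *: p' + q'); apply: PlE.
    by exists (act x p'); apply: PxE.
  have : [set: M] m by []; rewrite -e //; last by exists v'.
have tot2 (m' : M') : exists m : M, gen_by w (m, m').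
  have /gv' e : submodule [set m' : M' | exists m : M, gen_by w (m, m')].
    split=> [|a p q [p' Pp] [q' Pq]|x p [p' Pp]]; first by exists 0.
      by exists (a *: p' + q'); apply: PlE.
    by exists (act x p'); apply: PxE.
  have : [set: M'] m' by []; rewrite -e //; last by exists v.
have fun1 (m : M) (p q : M') : gen_by w (m, p) -> gen_by w (m, q) -> p = q.
  move=> Pp Pq; apply/eqP; rewrite -subr_eq0; apply/eqP/inj2.
  have := PlE (-1) _ _ _ _ Pq Pp; rewrite !scaleN1r addNr.
  by rewrite [- q + p]addrC.
pose f m := proj1_sig (cid (tot1 m)).
have fP m : gen_by w (m, f m) by rewrite /f; case: cid.
apply: (@iso_of_bij _ _ M M' f).
- split=> [a p q|x p]; first exact: (fun1 _ _ _ (fP _) (PlE a _ _ _ _ (fP p) (fP q))).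
  exact: (fun1 _ _ _ (fP _) (PxE x _ _ (fP p))).
- move=> p q e; apply/eqP; rewrite -subr_eq0; apply/eqP/inj1.
  have := PlE (-1) _ _ _ _ (fP q) (fP p); rewrite e !scaleN1r addNr.
  by rewrite [- q + p]addrC.
- by move=> m'; have [m Pm] := tot2 m'; exists m; apply: (fun1 m).
Qed.

End HatGrading.
End Gradings.

(** * The Sugawara operator *)

Section DegreeGenerated.
Variables (K : numClosedFieldType) (g : finLieAlgType K).
Hypothesis g_simple : simple g.
Variables (M : lieModule (hat g)) (k : K).
Hypothesis central : forall b (m : M), act (hcen g b) m = (b * k) *: m.
Variable d : M -> M.
Hypothesis ld : linear d.
Hypothesis d_pos : forall x m, d (act (hmon x 1) m) = act (hmon x 1) m + act (hmon x 1) (d m).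
Hypothesis d_neg : forall x m,
  d (act (hmon x (- 1)) m) = - act (hmon x (- 1)) m + act (hmon x (- 1)) (d m).

(** [hat g] is generated by [g t], [g t^-1] and the center. *)
Lemma hat_degree_generated u m : d (act u m) = act (hat_degree u) m + act u (d m).
Proof.
pose G := [set u | forall m, d (act u m) = act (hat_degree u) m + act u (d m)].
have sG : subspace G.
  split=> [n|a p q Gp Gq n].
    by rewrite !act0l (lin0 ld) (lin0 (@hat_degree_linear _ g)) act0l addr0.
  by rewrite (@hat_degree_linear _ g) !act_linearl ld Gp Gq scalerDr addrACA.
have lG p q : G p -> G q -> G (lie p q).
  move=> Gp Gq n; rewrite hat_degree_lie actDl !act_lie (linD ld) (linN ld).
  rewrite (Gp (act q n)) (Gq (act p n)) (Gp n) (Gq n) !(linD (act_linearr _)).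
  move: (act (hat_degree p) (act q n)) (act (hat_degree q) (act p n)) => r s.
  move: (act p (act (hat_degree q) n)) (act q (act (hat_degree p) n)) => r' s'.
  move: (act p (act q (d n))) (act q (act p (d n))) => r'' s''.
  rewrite !opprD !addrA; congr (_ - _).
  rewrite [RHS]addrAC [LHS]addrAC; congr (_ - _); rewrite [LHS]addrAC; congr (_ + _).
  exact: addrAC.
have Gc b : G (hcen g b).
  move=> n; rewrite !central (linZ ld) hat_degree_hcen act0l add0r.
  by [].
have G1 x : G (hmon x 1) by move=> n; rewrite hat_degree_hmon scale1r d_pos.
have GN x : G (hmon x (- 1)).
  by move=> n; rewrite hat_degree_hmon mulrN1z d_neg actZl scaleN1r.
have hE x y p q : hmon (lie x y) (p + q) = lie (hmon x p) (hmon y q)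
    + (- 1) *: hcen g (if p + q == 0 then p%:~R * killing x y else 0).
  by rewrite lie_hmon scaleN1r addrK.
have sGk p : subspace [set x | G (hmon x p)].
  split=> [|a x y Gx Gy] /=.
    by rewrite [hmon 0 p](lin0 (@hmon_linear _ g p)); apply: subspace0.
  by rewrite hmon_linear; case: sG => _; apply.
(* As [g] is spanned by brackets, degrees [p] and [q] together give degree p + q; the central
   correction already lies in [G]. *)
have Gk p q : (forall x, G (hmon x p)) -> (forall x, G (hmon x q)) ->
    forall x, G (hmon x (p + q)).
  move=> Gp Gq; apply: (simple_bracket_span g_simple (sGk _)) => x y /=.
  rewrite hE; apply: (subspaceD sG); first by apply: lG.
  exact: (subspaceZ sG).
suff GT v : G v by apply: GT.
apply: hat_span => // x p; elim/int_ind: p x => [|n IH|n IH] x.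
- by have := Gk _ _ G1 GN x; rewrite subrr.
- by rewrite -addn1 PoszD; apply: Gk.
- by rewrite -addn1 PoszD opprD; apply: Gk.
Qed.

End DegreeGenerated.

Section Sugawara.
Variables (K : numClosedFieldType) (g : finLieAlgType K).
Hypothesis g_simple : simple g.
Variable h : {vspace g}.
Hypothesis h_cartan : cartan_subalgebra h.
Variable D : seq (dual h).
Hypothesis D_base : root_base D.

Let nondeg := killing_nondegenerate h_cartan D_base g_simple.

(** Weight vectors are wanted so that in the Casimir sum each product of a basis vector with its
    dual has height zero; [hw_graded] relies on it. *)
Lemma weight_basis : exists2 u : (\dim {:g}).-tuple g, basis_of fullv u &
  forall i : 'I_(\dim {:g}), exists mu : dual h, root_space mu u`_i.
Proof.
pose wt (x : g) := exists mu : dual h, root_space mu x.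
pose P n := `[< exists s : seq g, [/\ free s, forall x, x \in s -> wt x & size s = n] >].
have exP : exists n, P n by exists 0%N; apply/asboolP; exists [::]; split=> //; apply: nil_free.
have leP n : P n -> (n <= \dim {:g})%N.
  by move=> /asboolP [s [fs _ <-]]; rewrite -(eqP fs) dimvS // subvf.
have [n /asboolP [s [fs ws sn]] nmax] := ex_maxnP exP leP.
have sT : <<s>>%VS = fullv.
  apply/vspaceP => x; rewrite memvf.
  apply: (@weight_span _ _ _ h_cartan _ D_base g_simple [set x | x \in <<s>>%VS]).
    split=> [|a y z ys zs]; first exact: mem0v.
    by apply: memvD zs; apply: memvZ.
  move=> mu z mz /=; apply: contraT => zs; have : (n.+1 <= n)%N.
    apply: nmax; apply/asboolP; exists (z :: s); split; rewrite /= ?sn //.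
      by rewrite free_cons zs.
    by move=> y; rewrite inE => /orP[/eqP ->|/ws //]; exists mu.
  by rewrite ltnn.
have sz : size s == \dim {:g} by rewrite -sT eq_sym.
exists (Tuple sz); first by rewrite /basis_of /= sT eqxx.
by move=> i; apply: ws; rewrite mem_nth //= (eqP sz).
Qed.

(** * Dual bases and the Casimir tensor *)

Section DualBases.
Variable u : (\dim {:g}).-tuple g.
Hypothesis u_basis : basis_of fullv u.

Lemma basis_killing x : (forall i : 'I_(\dim {:g}), killing x u`_i = 0) -> x = 0.
Proof.
move=> x0; apply: nondeg => z; rewrite (coord_basis u_basis (memvf z)).
rewrite (linear_sum_fun (killing_linearr x)) big1 // => i _.
by rewrite (linZ (killing_linearr x)) x0 scaler0.
Qed.

Lemma dual_basis_exists : exists w : 'I_(\dim {:g}) -> g,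
  forall i j : 'I_(\dim {:g}), killing (w i) u`_j = (i == j)%:R.
Proof.
pose f (x : g) : 'rV[K]_(\dim {:g}) := \row_i killing x u`_i.
have lf : linear f.
  by move=> a x y; apply/rowP => i; rewrite !mxE killing_linearl.
have ex i : exists x, f x = delta_mx 0 i.
  apply: (linear_inj_surj lf); last by rewrite [RHS]dimvf /dim /= mul1n.
  by move=> x /rowP fx; apply: basis_killing => j; have := fx j; rewrite !mxE.
exists (fun i => proj1_sig (cid (ex i))) => i j; case: cid => x /= /rowP /(_ j).
by rewrite !mxE eqxx eq_sym.
Qed.

Variable w : 'I_(\dim {:g}) -> g.
Hypothesis uw : forall i j : 'I_(\dim {:g}), killing (w i) u`_j = (i == j)%:R.

Lemma killing_basis_coord x i : killing x (w i) = coord u i x.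
Proof.
rewrite killingC {1}(coord_basis u_basis (memvf x)).
rewrite (linear_sum_fun (killing_linearr _)) (bigD1 i) //= big1 => [|j ji].
  by rewrite (linZ (killing_linearr _)) uw eqxx addr0 /GRing.scale /= mulr1.
by rewrite (linZ (killing_linearr _)) uw eq_sym (negPf ji) scaler0.
Qed.

Lemma basis_expand x : x = \sum_(i < \dim {:g}) killing x (w i) *: u`_i.
Proof.
rewrite {1}(coord_basis u_basis (memvf x)).
by apply: eq_bigr => i _; rewrite killing_basis_coord.
Qed.

Lemma dual_basis_expand x : x = \sum_(i < \dim {:g}) killing x u`_i *: w i.
Proof.
apply/eqP; rewrite -subr_eq0; apply/eqP/basis_killing => j.
rewrite (linD (killing_linearl _)) (linN (killing_linearl _)).
rewrite (linear_sum_fun (killing_linearl _)) (bigD1 j) //= big1 => [|i ij].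
  by rewrite (linZ (killing_linearl _)) uw eqxx addr0 /GRing.scale /= mulr1 subrr.
by rewrite (linZ (killing_linearl _)) uw (negPf ij) scaler0.
Qed.

Lemma endo_trace_basis (f : 'End(g)) : endo_trace f = \sum_(i < \dim {:g}) killing (w i) (f u`_i).
Proof.
have eb := vbasisP {:g}.
have -> : endo_trace f = \tr (mxof u u f).
  rewrite [in RHS](_ : f = ((\1 \o f) \o \1)%VF); last by rewrite comp_lfun1l comp_lfun1r.
  rewrite (mxof_comp _ _ eb) (mxof_comp _ _ eb) mxtrace_mulC -mulmxA.
  by rewrite -(mxof_comp _ _ u_basis) comp_lfun1l mxof1 ?(basis_free eb) // mulmx1.
apply: eq_bigr => i _; rewrite killingC killing_basis_coord !mxE /=.
by rewrite vecof_delta.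
Qed.

(** Paired with [y], the sum becomes tr (ad y ad x), the Killing form itself. So the Casimir element
    is 1 on the adjoint representation, which is the 1 in [1 + 2%:R * k]. *)
Lemma casimir_adjoint x : \sum_(i < \dim {:g}) lie (lie x u`_i) (w i) = x.
Proof.
apply/eqP; rewrite -subr_eq0; apply/eqP/nondeg => y.
rewrite (linD (killing_linearl _)) (linN (killing_linearl _)).
rewrite (linear_sum_fun (killing_linearl _)).
have -> : killing x y = \sum_(i < \dim {:g}) killing (w i) (lie y (lie x u`_i)).
  rewrite killingC /killing -/(endo_trace _) endo_trace_basis.
  by apply: eq_bigr => i _; rewrite comp_lfunE !adE.
apply/eqP; rewrite subr_eq0; apply/eqP/eq_bigr => i _.
by rewrite killing_lie -(killing_lie (w i)) killingC.
Qed.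

Lemma dual_root_space (mu : dual h) (i : 'I_(\dim {:g})) :
  (forall j : 'I_(\dim {:g}), exists nu : dual h, root_space nu u`_j) ->
  root_space mu u`_i -> root_space (- mu) (w i).
Proof.
move=> wt mui y; apply/eqP; rewrite -subr_eq0; apply/eqP/basis_killing => j.
rewrite (linD (killing_linearl _)) (linN (killing_linearl _)) (linZ (killing_linearl _)).
rewrite opp_lfunE lieC (linN (killing_linearl _)) killing_lie.
have [nu nuj] := wt j; rewrite nuj (linZ (killing_linearr _)) uw.
have [ij|ij] := eqVneq i j; last by rewrite !scaler0 oppr0 addr0.
have := mui y; rewrite ij nuj => /eqP; rewrite -subr_eq0 -scalerBl scaler_eq0.
have u0 : u`_j != 0.
  by apply: (free_not0 (basis_free u_basis)); rewrite mem_nth // size_tuple.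
rewrite (negPf u0) orbF subr_eq0 => /eqP ->.
by rewrite /GRing.scale /= !mulr1 opprK addNr.
Qed.

Section Bilinear.
Variables (V : lmodType K) (B : g -> g -> V).
Hypotheses (Bl : forall b, linear (B^~ b)) (Br : forall a, linear (B a)).

(** [B] stands in for the tensor product: this lemma and the next say that the Casimir tensor is
    symmetric and invariant. *)
Lemma dual_basis_swap : \sum_(i < \dim {:g}) B u`_i (w i) = \sum_(i < \dim {:g}) B (w i) u`_i.
Proof.
have E a (i : 'I_(\dim {:g})) : B a u`_i = \sum_(j < \dim {:g}) killing u`_i u`_j *: B a (w j).
  rewrite {1}(dual_basis_expand u`_i) (linear_sum_fun (Br a)).
  by apply: eq_bigr => j _; rewrite (linZ (Br a)).
have E' b (i : 'I_(\dim {:g})) : B u`_i b = \sum_(j < \dim {:g}) killing u`_i u`_j *: B (w j) b.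
  rewrite {1}(dual_basis_expand u`_i) (linear_sum_fun (Bl b)).
  by apply: eq_bigr => j _; rewrite (linZ (Bl b)).
under eq_bigr do rewrite E'; rewrite exchange_big /=.
by apply: eq_bigr => i _; rewrite E; apply: eq_bigr => j _; rewrite killingC.
Qed.

Lemma dual_basis_invariant x :
  \sum_(i < \dim {:g}) B (lie x u`_i) (w i) = - \sum_(i < \dim {:g}) B u`_i (lie x (w i)).
Proof.
have E (i : 'I_(\dim {:g})) : B (lie x u`_i) (w i) = \sum_(j < \dim {:g}) killing (lie x u`_i) (w j) *: B u`_j (w i).
  rewrite {1}(basis_expand (lie x u`_i)) (linear_sum_fun (Bl _)).
  by apply: eq_bigr => j _; rewrite (linZ (Bl _)).
have E' (i : 'I_(\dim {:g})) : B u`_i (lie x (w i)) = \sum_(j < \dim {:g}) killing (lie x (w i)) u`_j *: B u`_i (w j).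
  rewrite {1}(dual_basis_expand (lie x (w i))) (linear_sum_fun (Br _)).
  by apply: eq_bigr => j _; rewrite (linZ (Br _)).
under eq_bigr do rewrite E; rewrite exchange_big /= -sumrN.
apply: eq_bigr => i _; rewrite E' -sumrN; apply: eq_bigr => j _.
rewrite -scaleNr; congr (_ *: _).
by rewrite [lie x _]lieC (linN (killing_linearl _)) killing_lie killingC.
Qed.

End Bilinear.

Section Operator.
Variables (M : lieModule (hat g)) (k : K).
Hypothesis central : forall b (m : M), act (hcen g b) m = (b * k) *: m.
Hypothesis smM : smooth M.

Let X (x : g) (n : int) (m : M) : M := act (hmon x n) m.

Let X_linear x n : linear (X x n). Proof. exact: act_linearr. Qed.

Let X_linearl n m : linear (fun x => X x n m).
Proof. by move=> a x y; rewrite /X hmon_linear act_linearl. Qed.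

Let X_comm x y p q m : X x p (X y q m) = X y q (X x p m) + X (lie x y) (p + q) m
  + (if p + q == 0 then p%:~R * killing x y * k else 0) *: m.
Proof.
have := act_lie (hmon x p) (hmon y q) m; rewrite lie_hmon actDl central.
rewrite /X -addrA => E; rewrite [X in _ = _ + X](_ : _ =
  act (hmon x p) (act (hmon y q) m) - act (hmon y q) (act (hmon x p) m)).
  by rewrite addrC subrK.
by rewrite -E; case: eqP; rewrite ?mul0r.
Qed.

Definition sug_term (n : int) (m : M) : M := \sum_(i < \dim {:g}) X u`_i (- n) (X (w i) n m).

(** The contribution of the left letters to the commutator of x t^j with [sug_term n]. By invariance
    the right letters contribute minus the same expression at n + j, so sums over n telescope. *)
Definition sug_comm (x : g) (j n : int) (m : M) : M :=
  \sum_(i < \dim {:g}) X (lie x u`_i) (j - n) (X (w i) n m).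

Lemma sug_term_linear n : linear (sug_term n).
Proof.
move=> a p q; rewrite /sug_term scaler_sumr -big_split; apply: eq_bigr => i _.
by rewrite /X !act_linearr.
Qed.

(** The two scalars come from the cocycle: the left letters meet x t^j at j = n, the right letters
    at j = -n. *)
Lemma sug_term_comm x j n m : X x j (sug_term n m) - sug_term n (X x j m) =
  sug_comm x j n m - sug_comm x j (n + j) m
  + ((if j == n then j%:~R * k else 0) + (if j == - n then j%:~R * k else 0)) *: X x j m.
Proof.
have sum1 : (\sum_(i < \dim {:g}) (if j == n then j%:~R * killing x u`_i * k else 0) *: X (w i) n m)
    = (if j == n then j%:~R * k else 0) *: X x j m.
  case: eqP => [->|_]; last by rewrite scale0r big1 // => i _; rewrite scale0r.
  rewrite {2}(dual_basis_expand x) (linear_sum_fun (X_linearl n m)) scaler_sumr.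
  apply: eq_bigr => i _; rewrite (linZ (X_linearl n m)) scalerA.
  by rewrite mulrAC.
have sum2 : (\sum_(i < \dim {:g}) (if j == - n then j%:~R * killing x (w i) * k else 0) *: X u`_i (- n) m)
    = (if j == - n then j%:~R * k else 0) *: X x j m.
  case: eqP => [->|_]; last by rewrite scale0r big1 // => i _; rewrite scale0r.
  rewrite {2}(basis_expand x) (linear_sum_fun (X_linearl (- n) m)) scaler_sumr.
  apply: eq_bigr => i _; rewrite (linZ (X_linearl _ m)) scalerA.
  by rewrite mulrAC.
have sum3 : sug_comm x j (n + j) m = - \sum_(i < \dim {:g}) X u`_i (- n) (X (lie x (w i)) (j + n) m).
  rewrite /sug_comm; have -> : j - (n + j) = - n by lia.
  rewrite [n + j]addrC.
  apply: (@dual_basis_invariant _ (fun a b => X a (- n) (X b (j + n) m))) => [b|a].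
    exact: X_linearl.
  by move=> c p q; rewrite X_linearl X_linear.
rewrite sum3 opprK scalerDl -sum1 -sum2 /sug_term (linear_sum_fun (X_linear x j)).
rewrite /sug_comm -sumrB -!big_split /=; apply: eq_bigr => i _.
rewrite X_comm (X_comm x (w i)) subr_eq0 addr_eq0.
rewrite !(linD (X_linear _ _)) (linZ (X_linear _ _)).
have Z (p q r s t : M) : p + r + s + q + t - p = q + r + (t + s).
  by rewrite addrC !addrA addNr add0r [r + s + q]addrC !addrA [RHS]addrAC.
exact: Z.
Qed.

(** Invariance and symmetry rewrite the second sum as minus the first with its letters in reverse
    order. The total is a sum of commutators, free of central terms as j is nonzero, and
    [casimir_adjoint] evaluates it. *)
Lemma sug_comm_add x j m : j != 0 -> sug_comm x j 0 m + sug_comm x j j m = X x j m.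
Proof.
move=> j0.
have -> : sug_comm x j j m = - \sum_(i < \dim {:g}) X (w i) 0 (X (lie x u`_i) j m).
  rewrite /sug_comm subrr.
  pose B a b := X a 0 (X b j m).
  have Bl b : linear (B^~ b) by exact: X_linearl.
  have Br a : linear (B a) by move=> c p q; rewrite /B X_linearl X_linear.
  rewrite (dual_basis_invariant Bl Br x); congr (- _).
  apply: (@dual_basis_swap _ (fun a b => B a (lie x b))) => [b|a]; first exact: Bl.
  by move=> c p q; rewrite lie_linearr Br.
rewrite /sug_comm -sumrB -[in RHS](casimir_adjoint x).
rewrite (linear_sum_fun (X_linearl j m)); apply: eq_bigr => i _.
rewrite subr0 X_comm addr0 (negPf j0) scale0r addr0.
by rewrite addrAC subrr add0r.
Qed.

(** The factor 2 accounts for negative indices: normal ordering and symmetry of the Casimir tensor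
    identify the terms at -n and n. *)
Definition sug_partial (R : nat) (m : M) : M :=
  sug_term 0 m + 2%:R *: \sum_(n < R) sug_term n.+1%:Z m.

Lemma sug_partial_linear R : linear (sug_partial R).
Proof.
move=> a p q; rewrite /sug_partial sug_term_linear.
have -> : \sum_(n < R) sug_term n.+1%:Z (a *: p + q) =
    a *: \sum_(n < R) sug_term n.+1%:Z p + \sum_(n < R) sug_term n.+1%:Z q.
  by rewrite scaler_sumr -big_split; apply: eq_bigr => i _; rewrite sug_term_linear.
by rewrite [2%:R *: (_ + _)]scalerDr [a *: (_ + _)]scalerDr !scalerA [_ * a]mulrC addrACA.
Qed.

Let bound m := proj1_sig (cid (smM m)).

Let bound_le m (x : g) (n : nat) : (bound m <= n)%N -> X x n%:Z m = 0.
Proof. by rewrite /bound; case: cid => R hR /=; apply: hR. Qed.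

Lemma sug_term_vanish m n : (bound m <= n)%N -> sug_term n%:Z m = 0.
Proof.
move=> mn; rewrite /sug_term big1 // => i _.
by rewrite (bound_le _ mn) (lin0 (X_linear _ _)).
Qed.

Lemma sug_comm_vanish x j m n : (bound m <= n)%N -> sug_comm x j n%:Z m = 0.
Proof.
move=> mn; rewrite /sug_comm big1 // => i _.
by rewrite (bound_le _ mn) (lin0 (X_linear _ _)).
Qed.

(** The locally finite sum [sum_(n in Z) : u_i t^(-n) w_i t^n :]. *)
Definition sugawara (m : M) : M := sug_partial (bound m) m.

Lemma sugawaraE m R : (bound m <= R)%N -> sugawara m = sug_partial R m.
Proof.
move=> /subnK <-; rewrite addnC /sugawara /sug_partial; congr (_ + _ *: _).
rewrite big_split_ord /= [X in _ = _ + X]big1 ?addr0 // => i _.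
by rewrite sug_term_vanish // -addnS leq_addr.
Qed.

Lemma sugawara_linear : linear sugawara.
Proof.
move=> a p q.
pose R := maxn (bound (a *: p + q)) (maxn (bound p) (bound q)).
rewrite (@sugawaraE _ R) ?(@sugawaraE p R) ?(@sugawaraE q R) ?sug_partial_linear //.
- by rewrite !leq_max leqnn !orbT.
- by rewrite !leq_max leqnn !orbT.
- by rewrite !leq_max leqnn.
Qed.

Lemma sug_partial_comm x j R m :
  X x j (sug_partial R m) - sug_partial R (X x j m) =
  (X x j (sug_term 0 m) - sug_term 0 (X x j m)) +
  2%:R *: \sum_(n < R) (X x j (sug_term n.+1%:Z m) - sug_term n.+1%:Z (X x j m)).
Proof.
rewrite /sug_partial (linD (X_linear _ _)) (linZ (X_linear _ _)).
by rewrite [X x j (\sum_(n < R) _)](linear_sum_fun (X_linear x j)) sumrB [in RHS]scalerBr [in LHS]opprD [LHS]addrACA.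
Qed.

(** Write C_n for [sug_comm x 1 n m]. The term at 0 gives C_0 - C_1, the others telescope to C_1 and
    add k x t. In total C_0 - C_1 + 2 (C_1 + k x t), and C_0 + C_1 = x t by [sug_comm_add]. *)
Lemma sugawara_comm1 x m :
  X x 1 (sugawara m) - sugawara (X x 1 m) = (1 + 2%:R * k) *: X x 1 m.
Proof.
(* The successor makes the sum nonempty: its first term, of index 1, is the only one with a central
   contribution. *)
pose R := (maxn (bound m) (bound (X x 1 m))).+1.
have mR : (bound m <= R)%N by rewrite leqW // leq_maxl.
rewrite (sugawaraE mR) (@sugawaraE (X x 1 m) R); last by rewrite leqW // leq_maxr.
rewrite sug_partial_comm sug_term_comm.
have -> : \sum_(n < R) (X x 1 (sug_term n.+1%:Z m) - sug_term n.+1%:Z (X x 1 m))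
    = sug_comm x 1 1 m + k *: X x 1 m.
  under eq_bigr do rewrite sug_term_comm; rewrite big_split /=; congr (_ + _).
    have -> : sug_comm x 1 1 m = - (sug_comm x 1 R.+1%:Z m - sug_comm x 1 1%:Z m).
      by rewrite (sug_comm_vanish _ _ (leqW mR)) sub0r opprK.
    rewrite -(telescope_sumr (fun n => sug_comm x 1 n.+1%:Z m) (leq0n R)) -sumrN.
    rewrite big_mkord; apply: eq_bigr => n _; rewrite opprB; congr (_ - _).
    by congr (sug_comm x 1 _ m); lia.
  rewrite big_ord_recl big1 => [|n _] /=.
    by rewrite addr0 mul1r addr0.
  by rewrite addr0 scale0r.
rewrite add0r oppr0 addr0 scale0r addr0 -(sug_comm_add x m (oner_neq0 _)).
rewrite scalerDl scale1r scalerDr scalerA scaler_nat mulr2n.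
rewrite !addrA subrK; congr (_ + _).
Qed.

(** Now, with C_n for [sug_comm x (- 1) n m], the term at 0 gives C_0 - C_(-1) and the others
    telescope to -C_0. *)
Lemma sugawara_commN1 x m :
  X x (- 1) (sugawara m) - sugawara (X x (- 1) m) = - (1 + 2%:R * k) *: X x (- 1) m.
Proof.
pose R := (maxn (bound m) (bound (X x (- 1) m))).+1.
have mR : (bound m <= R)%N by rewrite leqW // leq_maxl.
rewrite (sugawaraE mR) (@sugawaraE (X x (- 1) m) R); last by rewrite leqW // leq_maxr.
rewrite sug_partial_comm sug_term_comm.
have -> : \sum_(n < R) (X x (- 1) (sug_term n.+1%:Z m) - sug_term n.+1%:Z (X x (- 1) m))
    = - sug_comm x (- 1) 0 m - k *: X x (- 1) m.
  under eq_bigr do rewrite sug_term_comm; rewrite big_split /=; congr (_ + _).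
    have -> : - sug_comm x (- 1) 0 m = sug_comm x (- 1) R%:Z m - sug_comm x (- 1) 0%:Z m.
      by rewrite (sug_comm_vanish _ _ mR) sub0r.
    rewrite -(telescope_sumr (fun n => sug_comm x (- 1) n%:Z m) (leq0n R)).
    rewrite big_mkord; apply: eq_bigr => n _; congr (_ - _).
    by congr (sug_comm x (- 1) _ m); lia.
  rewrite big_ord_recl big1 => [|n _] /=.
    by rewrite add0r addr0 mulN1r scaleNr.
  by rewrite addr0 scale0r.
rewrite add0r oppr0 addr0 scale0r addr0.
have := @sug_comm_add x (- 1) m isT.
move: (X x (- 1) m) (sug_comm x (- 1) 0 m) (sug_comm x (- 1) (- 1) m) => y p q yE.
rewrite [2%:R *: _]scalerBr scalerN scalerA scaler_nat mulr2n opprD.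
rewrite scaleNr scalerDl scale1r opprD addrA; congr (_ - _).
by rewrite -yE addrACA subrr add0r opprD addrC.
Qed.

Hypothesis level : k != - 2%:R^-1.

(** Dividing by -(1 + 2 k) turns the commutators with x t and x t^-1 into those of [d], which
    suffices by [hat_degree_generated]. The constant [c] shifts the operator so that it vanishes on
    a chosen eigenvector. *)
Lemma sugawara_degree (c : K) : exists delta : {linear M -> M},
  (forall u m, delta (act u m) = act (hat_degree u) m + act u (delta m)) /\
  forall m, sugawara m = c *: m -> delta m = 0.
Proof.
have b0 : 1 + 2%:R * k != 0.
  apply: contra_neq level => e; apply: (@mulfI _ 2%:R); first by rewrite pnatr_eq0.
  by rewrite mulrN mulfV ?pnatr_eq0 //; apply/eqP; rewrite -addr_eq0 addrC e.
pose d (m : M) : M := - (1 + 2%:R * k)^-1 *: (sugawara m - c *: m).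
have ld : linear d.
  move=> a p q; rewrite /d sugawara_linear.
  move: (sugawara p) (sugawara q) (- _^-1) => sp sq e.
  have -> : a *: sp + sq - c *: (a *: p + q) = a *: (sp - c *: p) + (sq - c *: q).
    by rewrite scalerDr scalerBr !scalerA [c * a]mulrC opprD addrACA.
  by rewrite [e *: (_ + (_ - _))]scalerDr !scalerA [e * a]mulrC.
have dX x j m : (j == 1) || (j == - 1) -> d (X x j m) = j%:~R *: X x j m + X x j (d m).
  move=> j1; have E : X x j (sugawara m) = sugawara (X x j m)
      + j%:~R *: ((1 + 2%:R * k) *: X x j m).
    case/orP: j1 => /eqP ->; first by rewrite scale1r -sugawara_comm1 addrC subrK.
    by rewrite mulrN1z scaleN1r -scaleNr -sugawara_commN1 addrC subrK.
  rewrite /d (linZ (X_linear _ _)) (linD (X_linear _ _)) (linN (X_linear _ _)).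
  rewrite (linZ (X_linear _ _)) E; move: (X x j m) (sugawara (X x j m)) => z y.
  rewrite [y + _ - _]addrAC [X in _ = _ + X]scalerDr [RHS]addrCA scalerA.
  rewrite [_ * j%:~R]mulrC scalerA -mulrA mulNr mulVf // mulrN1 [(- j%:~R) *: _]scaleNr subrr.
  by rewrite addr0.
pose delta : {linear M -> M} := HB.pack d (GRing.isLinear.Build K M M *:%R d ld).
exists delta.
split; last by move=> m e; rewrite /= /d e subrr scaler0.
apply: (hat_degree_generated g_simple central ld) => x m.
  by rewrite dX ?eqxx // scale1r.
by rewrite dX ?eqxx ?orbT // scaleN1r.
Qed.

End Operator.
End DualBases.
End Sugawara.

(** * The theorem *)

Section HighestWeightGraded.
Variables (K : numClosedFieldType) (g : finLieAlgType K).
Hypothesis g_simple : simple g.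
Variable h : {vspace g}.
Hypothesis h_cartan : cartan_subalgebra h.
Variable D : seq (dual h).
Hypothesis D_base : root_base D.
Variable y0 : subvs_of h.
Hypothesis y0D : forall i : 'I_(size D), D`_i y0 = 1.
Variable N : nat.
Hypothesis N_bound : forall k x, ghom y0 k x -> x != 0 -> (absz k < N)%N.

(** On [v] only the index 0 of the Sugawara sum survives. Its terms are words of principal degree
    zero, so [prod_act_zero] makes [v] an eigenvector. *)
Lemma hw_graded (gam : hat_dual h) (M : lieModule (hat g)) (v : M) :
  hat_highest_weight_vector D gam v ->
  ((gam (0, 1) : K) = - 2%:R^-1 -> graded_from v) -> graded_from v.
Proof.
move=> hv; have [e /(_ e) //|lev _] := eqVneq (gam (0, 1) : K) (- 2%:R^-1).
have [v0 gv vpos vg] := hv.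
have cen1 : act (hcen g 1) v = (gam (0, 1) : K) *: v.
  rewrite -vg; congr act; congr pair.
  by rewrite /hat_cartan /= -(linear0 (@vsval _ _ h)) lmon0.
have central := hat_central_scalar gv cen1.
have smM := hw_smooth hv.
have [u ub uw] := weight_basis g_simple h_cartan D_base.
have [w wu] := dual_basis_exists g_simple h_cartan D_base ub.
suff [c vc] : exists c : K, sugawara u w smM v = c *: v.
  have [delta [dX d0]] := sugawara_degree g_simple h_cartan D_base ub wu central smM lev c.
  by exists delta; split=> //; apply: d0.
have lim (i : 'I_(\dim {:g})) : exists c : K, act (hmon u`_i (- 0)) (act (hmon (w i) 0) v) = c *: v.
  have [mu mui] := uw i.
  have wi := dual_root_space g_simple h_cartan D_base ub wu uw mui.
  have u0 : u`_i != 0.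
    by apply: (free_not0 (basis_free ub)); rewrite mem_nth // size_tuple.
  have [k [ke _ _]] := weight_height D_base y0D mui u0.
  have uk : ghom y0 k u`_i by exists mu.
  have wk : ghom y0 (- k) (w i) by exists (- mu); rewrite ?opp_lfunE ?ke ?mulrNz.
  pose l := [:: (k, hmon u`_i 0); (- k, hmon (w i) 0)].
  have hl : homs (hhom y0 N) l.
    have := hhom_hmon N 0 uk; have := hhom_hmon N 0 wk.
    by rewrite mul0r !add0r.
  have dl : degree_of l = 0 by rewrite !degree_of_cons degree_of_nil addr0 subrr.
  rewrite oppr0; apply: (prod_act_zero _ _ _ hl dl).
  - exact: hhom_lie.
  - exact: (hw_singular D_base y0D N_bound hv).
  - exact: (hw_zero h_cartan D_base y0D N_bound hv).
pose c i := proj1_sig (cid (lim i)).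
have cE (i : 'I_(\dim {:g})) : act (hmon u`_i (- 0)) (act (hmon (w i) 0) v) = c i *: v.
  by rewrite /c; case: cid.
exists (\sum_(i < \dim {:g}) c i); rewrite /sugawara /sug_partial [X in _ + _ *: X]big1 => [|n _].
  by rewrite scaler0 addr0 scaler_suml; apply: eq_bigr => i _; apply: cE.
rewrite /sug_term big1 // => i _.
have -> : act (hmon (w i) n.+1%:Z) v = 0 by apply: vpos; apply: tilde_nplus_hmon.
exact: act_linear0.
Qed.

End HighestWeightGraded.

(** The bound 2 comes from [eta] vanishing on brackets: for k at least 2, x t^k is a sum of brackets
    of y t^(k-1) with z t, both in [tilde_nplus]. *)
Lemma whittaker_smooth (K : numClosedFieldType) (g : finLieAlgType K) (g_simple : simple g)
  (h : {vspace g}) (D : seq (dual h)) (eta : hat g -> K) (W : lieModule (hat g)) :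
  whittaker_type D eta -> whittaker D eta W -> smooth W.
Proof.
move=> [eta_lin eta_lie _] [v [v0 gv vE]].
have tp (x : g) (k : nat) : (0 < k)%N -> tilde_nplus D (hmon x k%:Z).
  by move=> k0; apply: tilde_nplus_hmon; rewrite ltz_nat.
apply: (@smooth_generated _ _ W v 2) => // x k k2; rewrite vE; last exact/tp/ltnW.
have z0 : tilde_nplus D (0 : hat g) by apply: lspan0.
have eta0 : eta 0 = 0.
  have := eta_lin (-1) 0 0 z0 z0.
  by rewrite scaler0 addr0 mulN1r addNr.
suff -> : eta (hmon x k%:Z) = 0 by rewrite scale0r.
apply: (@simple_bracket_span _ _ g_simple (fun x => eta (hmon x k%:Z) = 0)) => [|y z].
  split=> [|b y z ey ez]; first by rewrite [hmon 0 k](lin0 (@hmon_linear _ g k)).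
  by rewrite hmon_linear eta_lin ?ey ?ez ?mulr0 ?addr0 //; apply/tp/ltnW.
have -> : k%:Z = k.-1%:Z + 1 by lia.
rewrite -lie_hmon_neq0; last by lia.
by apply: eta_lie; [apply: tp|apply: (tp z 1%N)]; lia.
Qed.

Theorem theorem6p3
  (R : realType) (g : finLieAlgType R[i]) (g_simple : simple g)
  (h : {vspace g}) (h_cartan : cartan_subalgebra h)
  (D : seq (dual h)) (D_base : root_base D)
  (V : dual h -> lieModule g)
  (V_irr : forall lam, irreducible (V lam))
  (V_hw : forall lam, highest_weight D lam (V lam))
  (m m' : nat) (m_gt0 : (0 < m)%N) (m'_gt0 : (0 < m')%N)
  (lam : {ffun 'I_m -> dual h}) (lam_neq0 : lam != 0)
  (lam' : {ffun 'I_m' -> dual h})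
  (a : 'I_m -> R[i]) (a_neq0 : forall i, a i != 0) (a_inj : injective a)
  (a' : 'I_m' -> R[i]) (a'_neq0 : forall i, a' i != 0) (a'_inj : injective a')
  (gam gam' : hat_dual h)
  (Vg Vg' : lieModule (hat g))
  (Vg_irr : hat_irreducible_highest_weight D gam Vg)
  (Vg'_irr : hat_irreducible_highest_weight D gam' Vg')
  (eta eta' : hat g -> R[i])
  (eta_type : whittaker_type D eta) (eta'_type : whittaker_type D eta')
  (W W' : lieModule (hat g))
  (W_irr : irreducible W) (W_whit : whittaker D eta W)
  (W'_irr : irreducible W') (W'_whit : whittaker D eta' W') :
  let E := evTensor a_neq0 (fun i => V (lam i)) in
  let E' := evTensor a'_neq0 (fun i => V (lam' i)) in
  [/\ ~ lieModule_iso (dind (tensorModule E Vg)) (dind (tensorModule E' W)),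
      lieModule_iso (dind (tensorModule E Vg)) (dind (tensorModule E' Vg'))
        <-> lieModule_iso E E' /\ gam = gam' &
      lieModule_iso (dind (tensorModule E W)) (dind (tensorModule E' W'))
        <-> lieModule_iso E E' /\ lieModule_iso W W'].
Proof.
move=> E E'.
have [y0 y0D] := height_exists D_base.
have [N N_bound] := ghom_bounded y0.
have [irrVg [v [hv gr]]] := Vg_irr; have [irrVg' [v' [hv' gr']]] := Vg'_irr.
have {}gr := hw_graded g_simple h_cartan D_base y0D N_bound hv gr.
have {}gr' := hw_graded g_simple h_cartan D_base y0D N_bound hv' gr'.
have V_schur l : schur (V l).
  exact: (irreducible_highest_weight_schur g_simple h_cartan D_base y0D (V_irr l) (V_hw l)).
have [irrE schE] : irreducible E /\ schur E by apply: evTensor_irreducible_schur.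
have [irrE' schE'] : irreducible E' /\ schur E' by apply: evTensor_irreducible_schur.
have smVg : smooth Vg := hw_smooth hv.
have smVg' : smooth Vg' := hw_smooth hv'.
have smW et (U : lieModule (hat g)) : whittaker_type D et -> whittaker D et U -> smooth U.
  exact: whittaker_smooth.
have smoW := smW _ _ eta_type W_whit; have smoW' := smW _ _ eta'_type W'_whit.
(* The common core of the three claims: both the induction and the tensor product cancel, whatever
   the smooth irreducible second factors are. *)
have cancel (P Q : lieModule (hat g)) : irreducible P -> irreducible Q ->
    smooth P -> smooth Q ->
    lieModule_iso (dind (tensorModule E P)) (dind (tensorModule E' Q)) <->
    lieModule_iso E E' /\ lieModule_iso P Q.
  move=> irrP irrQ smP smQ; split=> [iso|[isoE isoP]]; last first.
    by apply/dind_iso/tensor_iso.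
  have {}iso : lieModule_iso (tensorModule E P) (tensorModule E' Q).
    apply: dind_iso_irreducible iso; apply: tensor_irreducible => //;
      exact: evTensor_decoupled.
  by apply: (tensor_iso_cancel _ _ _ _ _ _ _ iso) => //; apply: evTensor_decoupled.
split.
- move=> /(cancel _ _ irrVg W_irr smVg smoW) [_ /lieModule_iso_sym].
  (* An isomorphism would carry the Whittaker vector of [W] into the highest weight module [Vg]. *)
  move=> /hom_of_iso [f [f' [[lf fx] [lf' _] fK _]]].
  have [w [w0 _ wE]] := W_whit.
  apply: (hw_no_whittaker g_simple h_cartan D_base y0D N_bound hv (w := f w) eta_type).
    by apply: contra_neq w0 => fw; rewrite -[w]fK fw (lin0 lf').
  by move=> u up; rewrite -fx wE // (linZ lf).
- rewrite (cancel _ _ irrVg irrVg' smVg smVg'); split=> -[isoE].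
    move=> iso; split=> //.
    exact: (hw_weight_unique g_simple h_cartan D_base y0D N_bound hv hv' irrVg' gr' iso).
  move=> gg; split=> //; move: hv'; rewrite -gg => hv''.
  exact: (hw_unique g_simple h_cartan D_base y0D N_bound hv hv'' irrVg irrVg' gr gr').
- exact: cancel.
Qed.
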